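(* Let $L=(L_x,L_\partial)\in\mathbb{Q}^n\times\mathbb{Q}^n$ satisfy $L_{x_j}+L_{\partial_j}=c$ for all $j$, for some constant $c>0$. Then for every $\beta\in\mathbb{C}^d$, $$\operatorname{ch}^L(M_A(\beta))=\bigcup_{\tau\in\Phi_A^{L_\partial}}\overline{\Upsilon_A^\tau}=\bigsqcup_{\tau\in\Phi_A^{L_\partial}}\Upsilon_A^\tau,$$ where $\Upsilon_A^\tau$ is the conormal variety to the orbit $O_A^\tau\subseteq\widehat{\mathbb{C}}^n$, viewed inside $T^*\widehat{\mathbb{C}}^n\cong\mathbb{C}^n_x\times\widehat{\mathbb{C}}^n_\xi$.
   Context: $A\in\mathbb{Z}^{d\times n}$ is full and pointed. $D_A=\mathbb{C}[x]\langle\partial\rangle$, and $M_A(\beta)=D_A/H_A(\beta)$ with $H_A(\beta)=D_A(I_A,\{\sum_ja_{ij}x_j\partial_j-\beta_i\}_{i=1}^d)$, where $I_A$ is the toric ideal generated by $\partial^{\mathbf u_+}-\partial^{\mathbf u_-}$ for $\mathbf u\in\ker_{\mathbb{Z}}A$. For a weight $L$ as in the claim, $\operatorname{gr}^L(D_A)$ is a commutative polynomial ring $\mathbb{C}[x,\xi]$, where $\xi_j$ is the symbol of $\partial_j$. The $L$-characteristic variety is $\operatorname{ch}^L(M_A(\beta))=\operatorname{Var}(\operatorname{gr}^L H_A(\beta))\subseteq\mathbb{C}^{2n}$. The torus $\mathbb{T}=(\mathbb{C}^* )^d$ acts on $\widehat{\mathbb{C}}^n$ by $\eta\cdot\xi=(\eta^{\mathbf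 a_j}\xi_j)_j$. For a set $\tau$ of columns, $O_A^\tau$ is the orbit of the 0/1 indicator vector $\mathbf 1_\tau$. $(A,L')$-umbrella, for $L'\in\mathbb{Q}^n$. Put $\mathbf a_j^{L'}=(L'_j:\mathbf a_j)\in\mathbb{P}^d_\mathbb{Q}$, where $\mathbb{Q}^d\subseteq\mathbb{P}^d_\mathbb{Q}$ via $\mathbf a\mapsto(1:\mathbf a)$. Choose a linear form $f$ positive on all $\mathbf a_j$ and $\varepsilon>0$ with $f(\mathbf a_j)>\varepsilon|L'_j|$, and let $H_\varepsilon=\{f(x)=-\varepsilon x_0\}$. Then $\Delta_A^{L'}$ is the convex hull of $\{\mathbf 0,\mathbf a_1^{L'},\dots,\mathbf a_n^{L'}\}$ in $\mathbb{P}^d_\mathbb{Q}\smallsetminus H_\varepsilon$. The umbrella $\Phi_A^{L'}$ is the set of faces of $\Delta_A^{L'}$ not containing $\mathbf 0$, each identified with the set of columns on it. *)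

(* Defs.v *)
From mathcomp Require Import all_boot all_order all_algebra.
From mathcomp Require Import Rstruct.
From mathcomp.real_closed Require Import complex.
From mathcomp Require Import mpoly.

Set Implicit Arguments.
Unset Strict Implicit.
Unset Printing Implicit Defensive.

Import Order.TTheory GRing.Theory Num.Theory.
Local Open Scope ring_scope.

Definition CC : numClosedFieldType := complex Rdefinitions.R.

Definition full_mat (d n : nat) (A : 'M[int]_(d, n)) : Prop :=
  forall z : 'I_d -> int, exists k : 'I_n -> int,
    forall i, z i = \sum_(j < n) A i j * k j.

Definition pointed_mat (d n : nat) (A : 'M[int]_(d, n)) : Prop :=
  exists h : 'I_d -> rat, forall j : 'I_n, 0 < \sum_(i < d) h i * (A i j)%:~R.

(* The Weyl algebra D = C[x]<d>.  An element is represented by its     *)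
(* (unique) normally ordered expansion  sum c_{a,b} x^a d^b, stored as  *)
(* a commutative polynomial in 2n variables: variable (lshift n j)      *)
(* stands for x_j, variable (rshift n j) for d_j.  The *same* type is   *)
(* the commutative ring gr^L(D) = C[x, xi] (xi_j = symbol of d_j).     *)

Definition Dpoly (n : nat) := {mpoly CC[n + n]}.

Definition xpart (n : nat) (m : 'X_{1..n + n}) : 'X_{1..n} :=
  [multinom m (lshift n i) | i < n].
Definition dpart (n : nat) (m : 'X_{1..n + n}) : 'X_{1..n} :=
  [multinom m (rshift n i) | i < n].

Definition xdmon (n : nat) (a b : 'X_{1..n}) : 'X_{1..n + n} :=
  [multinom (match split i with inl j => a j | inr j => b j end) | i < n + n].

(* Action of D on C[x]: x^a d^b acts by  f |-> x^a * (d^b f).  The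
   Weyl algebra is the algebra of these operators; this action is
   faithful, so operator identities determine products in D. *)
Definition Dact (n : nat) (P : Dpoly n) (f : {mpoly CC[n]}) : {mpoly CC[n]} :=
  \sum_(m <- msupp P) P@_m *: ('X_[xpart m] * mderivm (dpart m) f).

Definition upos (n : nat) (u : 'I_n -> int) : 'X_{1..n} :=
  [multinom (if (0 <= u j)%R then absz (u j) else 0%N) | j < n].
Definition uneg (n : nat) (u : 'I_n -> int) : 'X_{1..n} :=
  [multinom (if (u j < 0)%R then absz (u j) else 0%N) | j < n].
Definition unitm (n : nat) (j : 'I_n) : 'X_{1..n} :=
  [multinom ((k == j) : nat) | k < n].

Definition toric_gen (n : nat) (u : 'I_n -> int) : Dpoly n :=
  'X_[xdmon 0%MM (upos u)] - 'X_[xdmon 0%MM (uneg u)].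

Definition euler_gen (d n : nat) (A : 'M[int]_(d, n)) (beta : 'I_d -> CC)
    (i : 'I_d) : Dpoly n :=
  \sum_(j < n) (A i j)%:~R *: 'X_[xdmon (unitm j) (unitm j)] - (beta i)%:MP.

Definition HA_gen (d n : nat) (A : 'M[int]_(d, n)) (beta : 'I_d -> CC)
    (g : Dpoly n) : Prop :=
  (exists u : 'I_n -> int,
      (forall i, \sum_(j < n) A i j * u j = 0) /\ g = toric_gen u)
  \/ (exists i, g = euler_gen A beta i).

(* P lies in the left ideal H_A(beta) = D(I_A, {E_i - beta_i}):
   P = sum_k Q_k g_k in D with generators g_k (product in D). *)
Definition HA (d n : nat) (A : 'M[int]_(d, n)) (beta : 'I_d -> CC)
    (P : Dpoly n) : Prop :=
  exists s : seq (Dpoly n * Dpoly n),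
    (forall q, q \in s -> HA_gen A beta q.2) /\
    (forall f, Dact P f = \sum_(q <- s) Dact q.1 (Dact q.2 f)).

Definition Lweight (n : nat) (Lx Ld : 'I_n -> rat) (m : 'X_{1..n + n}) : rat :=
  \sum_(j < n) (Lx j * (m (lshift n j))%:R + Ld j * (m (rshift n j))%:R).

Definition inL (n : nat) (Lx Ld : 'I_n -> rat) (P : Dpoly n) : {mpoly CC[n + n]} :=
  \sum_(m <- msupp P | all (fun m' => Lweight Lx Ld m' <= Lweight Lx Ld m)
                            (msupp P))
     P@_m *: 'X_[m].

Definition chL (d n : nat) (A : 'M[int]_(d, n)) (beta : 'I_d -> CC)
    (Lx Ld : 'I_n -> rat) (p : 'I_(n + n) -> CC) : Prop :=
  forall P, HA A beta P -> meval p (inL Lx Ld P) = 0.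

Definition xcoord (n : nat) (p : 'I_(n + n) -> CC) (j : 'I_n) : CC := p (lshift n j).
Definition xicoord (n : nat) (p : 'I_(n + n) -> CC) (j : 'I_n) : CC := p (rshift n j).

Definition orbit (d n : nat) (A : 'M[int]_(d, n)) (tau : {set 'I_n})
    (xi : 'I_n -> CC) : Prop :=
  exists eta : 'I_d -> CC, (forall i, eta i != 0) /\
    forall j, xi j = (\prod_(i < d) eta i ^ (A i j)) * (j \in tau)%:R.

(* tangent space of the orbit at xi: image of the Lie algebra of T,
   spanned by the vectors (a_ij xi_j)_j, i = 1..d *)
Definition orbit_tangent (d n : nat) (A : 'M[int]_(d, n)) (xi : 'I_n -> CC)
    (v : 'I_n -> CC) : Prop :=
  exists c : 'I_d -> CC, forall j, v j = \sum_(i < d) c i * (A i j)%:~R * xi j.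

Definition Upsilon (d n : nat) (A : 'M[int]_(d, n)) (tau : {set 'I_n})
    (p : 'I_(n + n) -> CC) : Prop :=
  orbit A tau (xicoord p) /\
  forall v, orbit_tangent A (xicoord p) v ->
    \sum_(j < n) xcoord p j * v j = 0.

Definition zclosure (N : nat) (S : ('I_N -> CC) -> Prop) (p : 'I_N -> CC) : Prop :=
  forall f : {mpoly CC[N]}, (forall q, S q -> meval q f = 0) -> meval p f = 0.

Definition umbrella_data (d n : nat) (A : 'M[int]_(d, n)) (L' : 'I_n -> rat)
    (f : 'I_d -> rat) (eps : rat) : Prop :=
  0 < eps /\ forall j : 'I_n,
    0 < \sum_(i < d) f i * (A i j)%:~R /\
    eps * `|L' j| < \sum_(i < d) f i * (A i j)%:~R.

(* In the affine chart { f(y) + eps*y_0 = 1 } of P^d \ H_eps, the point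
   a_j^{L'} = (L'_j : a_j) is (L'_j, a_j) / (f(a_j) + eps L'_j) and 0 = (1:0)
   is (1, 0)/eps.  A linear form (l0, l) on Q^{d+1} takes these values: *)
Definition lval_col (d n : nat) (A : 'M[int]_(d, n)) (L' : 'I_n -> rat)
    (f : 'I_d -> rat) (eps : rat) (l0 : rat) (l : 'I_d -> rat) (j : 'I_n) : rat :=
  (l0 * L' j + \sum_(i < d) l i * (A i j)%:~R) /
  (\sum_(i < d) f i * (A i j)%:~R + eps * L' j).

Definition lval_zero (eps l0 : rat) : rat := l0 / eps.

(* tau in Phi_A^{L'}: tau is the set of columns lying on a face F of the
   polytope Delta = conv(0, a_1^{L'}, ..., a_n^{L'}) with 0 notin F.
   Faces are the sets Delta cap {ell = M} for valid inequalities ell <= M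
   (this includes the empty face). *)
Definition umbrella (d n : nat) (A : 'M[int]_(d, n)) (L' : 'I_n -> rat)
    (f : 'I_d -> rat) (eps : rat) (tau : {set 'I_n}) : Prop :=
  exists (l0 : rat) (l : 'I_d -> rat) (M : rat),
    lval_zero eps l0 < M /\
    (forall j, lval_col A L' f eps l0 l j <= M) /\
    (forall j, (j \in tau) = (lval_col A L' f eps l0 l j == M)).

(* Main.v *)
Require Import Defs.
From mathcomp Require Import all_boot all_order all_algebra.
From mathcomp Require Import Rstruct.
From mathcomp.real_closed Require Import complex.
From mathcomp Require Import mpoly.
From mathcomp Require Import boolp functions.
From mathcomp Require Import lra ring zify.
Import Order.TTheory GRing.Theory Num.Theory.
Local Open Scope ring_scope.
Set Implicit Arguments.
Unset Strict Implicit.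
Unset Printing Implicit Defensive.

(* Faces tau of the umbrella correspond to functionals v with v.a_j <= L_d(j), with equality
   exactly on tau. For p in ch^L put tau = {j | xi_j <> 0}: the initial forms of the toric binomials
   vanish at p, so Motzkin's alternative produces such a v, and extending characters from the column
   lattice to Z^d puts xi on the orbit; the Euler operators give conormality.

   Conversely, let P be in H_A(beta). Formal sums of exp(sum_(j in V) x_j t^(a_j)) x^e t^g, taken
   modulo total derivatives in some of the t-directions, form a D-module in which a Gamma series U
   of minimal negative support is killed by H_A(beta). With respect to a weight extending v, P acts
   on the top part of U as a convolution operator read off from in_L(P). A convolution that kills
   the top part of U is zero, and evaluating it at characters shows that in_L(P) vanishes at the
   points (y, xi) with xi_j = t^(a_j) on tau and y_k t^(a_k) = - sum_j B_kj y_j t^(a_j) for k in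
   rho, the sum being over the columns j on the same level as k. Letting the y_j tend to infinity
   at suitable rates, these points degenerate to all of the fibre of the conormal variety, so in_L(P)
   vanishes on it. Since ch^L is closed, it also contains the closures. *)

(** * Linear inequalities and circuits *)

(** The initial forms of the given generators need not generate the initial ideal, so all elements
    of [H_A(beta)] are controlled at once, through one module element that they kill. Its top weight
    part has to exist. In a Gamma series, raising the exponent of [x_j] by 1 changes the weight by
    the height [lam v j], and the exponents outside [s2] are bounded below; so the heights of the
    columns in the series must be at most 0. Columns that cannot be lowered that far go into the
    exponential instead. What prevents lowering is a circuit of positive height, hence [rho] grows
    along circuits. The price is one relation for every [k] in [rho]. For [k] in [tau] it is a
    conormal equation; for the other [k] it is foreign and must become void in the limit. This needs
    a column outside [rho], on the level of [k], with nonzero coefficient; otherwise [y_k = 0] would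
    be forced. A circuit of maximal average height provides it: after the shift all its columns tie,
    and the one left out of [rho] becomes the partner [o k]. Other columns on that level must be
    dominated by [o k], whence the exponents [kap]. *)

Definition dotp {F : pzSemiRingType} {d : nat} (u w : 'I_d -> F) : F := \sum_i u i * w i.

Section Dot.
Variables (F : comPzRingType) (d : nat).
Implicit Types u w x : 'I_d -> F.

Lemma dotpC u w : dotp u w = dotp w u.
Proof. by apply: eq_bigr => i _; rewrite mulrC. Qed.

Lemma dotpDr u w x : dotp u (fun i => w i + x i) = dotp u w + dotp u x.
Proof. by rewrite /dotp -big_split; apply: eq_bigr => i _; rewrite mulrDr. Qed.

Lemma dotpZr u w k : dotp u (fun i => k * w i) = k * dotp u w.
Proof. by rewrite /dotp mulr_sumr; apply: eq_bigr => i _; rewrite mulrCA. Qed.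

Lemma dotpDl u w x : dotp (fun i => w i + x i) u = dotp w u + dotp x u.
Proof. by rewrite dotpC dotpDr !(dotpC u). Qed.

Lemma dotpZl u w k : dotp (fun i => k * w i) u = k * dotp w u.
Proof. by rewrite dotpC dotpZr (dotpC u). Qed.

Lemma dotp_sumr (I : finType) (P : pred I) u (w : I -> 'I_d -> F) :
  dotp u (fun i => \sum_(j | P j) w j i) = \sum_(j | P j) dotp u (w j).
Proof.
rewrite /dotp exchange_big; apply: eq_bigr => i _.
by rewrite mulr_sumr.
Qed.

End Dot.

(* Bartl's induction on the number of constraints. *)
Lemma farkas (I : finType) (N : nat) (a : I -> 'I_N -> rat) (b : 'I_N -> rat) (r : seq I) :
  (forall x, (forall i, i \in r -> dotp (a i) x <= 0) -> dotp b x <= 0) ->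
  exists mu : I -> rat, [/\ forall i, 0 <= mu i, forall i, i \notin r -> mu i = 0 &
    forall t, b t = \sum_i mu i * a i t].
Proof.
elim: r => [|i0 r IH] in a b *.
  move=> H; exists (fun _ => 0); split=> // t.
  rewrite big1 => [|i _]; last by rewrite mul0r.
  (* Without constraints [b] itself can be tested, so its sum of squares is at most 0. *)
  have := H b (fun _ => ltac:(by [])).
  rewrite /dotp => le0.
  have : \sum_i b i * b i == 0.
    by rewrite eq_le le0 sumr_ge0 // => i _; rewrite -expr2 sqr_ge0.
  rewrite psumr_eq0 => [/allP /(_ t)|i _]; last by rewrite -expr2 sqr_ge0.
  by rewrite mem_index_enum mulf_eq0 orbb => /(_ isT) /eqP.
move=> H.
(* Either [i0] is redundant, or some [x0] meets all other constraints with [dotp b x0 > 0] and hence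
   violates [i0]. *)
have [H1|/existsNP[x0 /not_implyP[x0r /negP]]] :=
  pselect (forall x, (forall i, i \in r -> dotp (a i) x <= 0) -> dotp b x <= 0).
  have [mu [mu0 mur mub]] := IH a b H1.
  exists mu; split=> // i; rewrite inE negb_or => /andP[_]; exact: mur.
rewrite -ltNge => bx0.
have ax0 : 0 < dotp (a i0) x0.
  rewrite ltNge; apply/negP => le0.
  have : dotp b x0 <= 0.
    by apply: H => i; rewrite inE => /orP[/eqP->|/x0r].
  by rewrite leNgt bx0.
have [in0r|i0r] := boolP (i0 \in r).
  by have := x0r _ in0r; rewrite leNgt ax0.
pose k := (dotp (a i0) x0)^-1.
have kgt : 0 < k by rewrite invr_gt0.
(* Both [a'] and [b'] vanish at [x0]; by [key] they are [a] and [b] composed with the projection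
   along [x0] onto the hyperplane where [a i0] vanishes. *)
pose a' i t := a i t + (- (k * dotp (a i) x0)) * a i0 t.
pose b' t := b t + (- (k * dotp b x0)) * a i0 t.
have key (c : 'I_N -> rat) x : dotp (fun t => c t + (- (k * dotp c x0)) * a i0 t) x =
   dotp c (fun t => x t + (- (k * dotp (a i0) x)) * x0 t).
  by rewrite dotpDl dotpZl dotpDr dotpZr; ring.
have [x xr|mu [mu0 mur mub]] := IH a' b'.
  rewrite key; apply: H => i; rewrite inE => /orP[/eqP->|ir].
    by rewrite dotpDr dotpZr mulNr mulrAC mulVf ?gt_eqF // mul1r subrr.
  by rewrite -key; apply: xr.
pose m0 := k * dotp b x0 - \sum_i mu i * (k * dotp (a i) x0).
exists (fun i => if i == i0 then m0 else mu i); split=> [i|i|t].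
- case: eqP => _ //; rewrite /m0 subr_ge0.
  apply: (@le_trans _ _ 0); last by rewrite mulr_ge0 ?ltW.
  apply: sumr_le0 => i' _.
  have [ir|/mur->] := boolP (i' \in r); last by rewrite mul0r.
  by rewrite mulr_ge0_le0 // pmulr_rle0 //; apply: x0r.
- by rewrite inE negb_or => /andP[/negPf-> /mur].
- have -> : b t = b' t + (k * dotp b x0) * a i0 t by rewrite /b'; ring.
  rewrite mub.
  rewrite (bigD1 i0) //= [RHS](bigD1 i0) //= eqxx mur // mul0r add0r.
  rewrite /a'.
  have -> : \sum_(i | i != i0) (if i == i0 then m0 else mu i) * a i t =
            \sum_(i | i != i0) mu i * a i t.
    by apply: eq_bigr => i /negPf->.
  rewrite [X in m0 * _ + X](_ : _ = \sum_(i | i != i0) mu i * (a i t + - (k * dotp (a i) x0) * a i0 t)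
     + (\sum_(i | i != i0) mu i * (k * dotp (a i) x0)) * a i0 t); last first.
    rewrite mulr_suml -big_split; apply: eq_bigr => i _ /=; ring.
  have -> : m0 = k * dotp b x0 - \sum_(i | i != i0) mu i * (k * dotp (a i) x0).
    by rewrite /m0 (bigD1 i0) //= mur // mul0r add0r.
  ring.
Qed.

(* Motzkin's transposition theorem: E equations, W weak and T strict inequalities. *)
Lemma motzkin (n d : nat) (a : 'I_n -> 'I_d -> rat) (h : 'I_n -> rat) (E W T : {set 'I_n}) :
  (forall j, j \in T -> j \notin E) ->
  (exists x : 'I_d -> rat, [/\ forall j, j \in E -> dotp (a j) x = h j,
     forall j, j \in W -> dotp (a j) x <= h j & forall j, j \in T -> dotp (a j) x < h j]) \/
  (exists m : 'I_n -> rat, [/\ forall j, j \notin E :|: W :|: T -> m j = 0,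
     forall j, j \notin E -> 0 <= m j,
     forall i, \sum_j m j * a j i = 0 &
     \sum_j m j * h j < 0 \/ (\sum_j m j * h j <= 0 /\ exists2 j, j \in T & m j != 0)]).
Proof.
move=> TE.
(* Homogenisation: the coordinate [ord0] carries [- h j], and a solution with [y ord0 > 0] is
   rescaled at the end. *)
pose f (j : 'I_n) (t : 'I_d.+1) : rat := if unlift ord0 t is Some i then a j i else - h j.
pose z (t : 'I_d.+1) : rat := (t == ord0)%:R.
have fE j y : dotp (f j) y = dotp (a j) (fun i => y (lift ord0 i)) - h j * y ord0.
  rewrite /dotp big_ord_recl /f unlift_none mulNr addrC; congr (_ - _).
  by apply: eq_bigr => i _; rewrite liftK.
have zE y : dotp z y = y ord0.
  rewrite /dotp big_ord_recl /z eqxx mul1r big1 ?addr0 // => i _.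
  by rewrite mul0r.
(* An equation is a pair of opposite inequalities, told apart by the boolean sign; [None] stands for
   [0 <= y ord0]. *)
pose I : finType := option ('I_n * bool).
pose g (i : I) : 'I_d.+1 -> rat := match i with
  | None => fun t => - z t
  | Some (j, b) => fun t => (-1) ^+ b * f j t end.
pose P (i : I) := match i with None => true | Some (j, b) => if b then j \in E else j \in E :|: W :|: T end.
pose r := [seq i <- enum I | P i].
have rP i : (i \in r) = P i by rewrite mem_filter mem_enum andbT.
pose weak y := [/\ 0 <= y ord0, forall j, j \in E -> dotp (f j) y = 0 & forall j, j \in W :|: T -> dotp (f j) y <= 0].
have weakP y : (forall i, i \in r -> dotp (g i) y <= 0) -> weak y.
  move=> H; split.
  - have := H None; rewrite rP => /(_ isT).
    have -> : dotp (g None) y = - dotp z y.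
      by rewrite -mulN1r -dotpZl; apply: eq_bigr => t _; rewrite /= mulN1r.
    by rewrite zE oppr_le0.
  - move=> j jE; apply/eqP; rewrite eq_le; apply/andP; split.
      have := H (Some (j, false)); rewrite rP /= !inE jE => /(_ isT).
      by rewrite dotpZl expr0 mul1r.
    have := H (Some (j, true)); rewrite rP /= jE => /(_ isT).
    by rewrite dotpZl expr1 mulN1r oppr_le0.
  - move=> j jW; have := H (Some (j, false)); rewrite rP /= -setUA in_setU jW orbT => /(_ isT).
    by rewrite dotpZl expr0 mul1r.
have cert (b : 'I_d.+1 -> rat) : (forall y, weak y -> dotp b y <= 0) ->
   exists m : 'I_n -> rat, exists m0 : rat, [/\ 0 <= m0, forall j, j \notin E :|: W :|: T -> m j = 0,
     forall j, j \notin E -> 0 <= m j,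
     forall i, \sum_j m j * a j i = b (lift ord0 i) &
     - (\sum_j m j * h j) - m0 = b ord0].
  move=> H; have [y /weakP/H //|mu [mu0 mur mub]] := @farkas I d.+1 g b r.
  pose m j := mu (Some (j, false)) - mu (Some (j, true)).
  have sumE t : b t = \sum_j m j * f j t - mu None * z t.
    rewrite mub.
    have -> : \sum_(i : I) mu i * g i t = mu None * g None t +
       \sum_(jb : 'I_n * bool) mu (Some jb) * g (Some jb) t.
      rewrite (bigD1 None) //=; congr (_ + _).
      rewrite (reindex_omap Some id) //=; last by case.
      by apply: eq_bigl => i; rewrite eqxx.
    rewrite addrC mulrN; congr (_ - _).
    rewrite [LHS](_ : _ = \sum_j \sum_b mu (Some (j, b)) * g (Some (j, b)) t); last first.
      by rewrite pair_bigA; apply: eq_bigr => -[].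
    apply: eq_bigr => j _; rewrite big_bool /= expr0 expr1 /m; ring.
  exists m, (mu None); split=> // [j jn|j jn|i|].
  - have jE : j \notin E by apply: contra jn; rewrite -setUA in_setU => ->.
    by rewrite /m (mur (Some (j, false))) ?rP // (mur (Some (j, true))) ?rP // subrr.
  - by rewrite /m [mu (Some (j, true))]mur ?subr0 // rP.
  - rewrite sumE /z eq_sym (negPf (neq_lift _ _)) mulr0 subr0; apply: eq_bigr => j _.
    by rewrite /f liftK.
  - rewrite sumE /z eqxx mulr1; congr (_ - _); rewrite -sumrN; apply: eq_bigr => j _.
    by rewrite /f unlift_none mulrN.
have [/cert[m [m0 [m00 mS mE ma mh]]]|/existsNP[y0 /not_implyP[y0w /negP]]] :=
    pselect (forall y, weak y -> dotp z y <= 0).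
  right; exists m; split=> //.
  left; have {}mh : - (\sum_j m j * h j) - m0 = 1 by [].
  lra.
rewrite zE -ltNge => y00.
(* If no weak solution is strict at [s], the certificate expresses [- f s], and raising the
   multiplier of [s] by 1 gives a relation that is nonzero in [T]. *)
have [[s [sT /cert[m [m0 [m00 mS mE ma mh]]]]]|Hs] := pselect (exists s, s \in T /\
    forall y, weak y -> dotp (fun t => - f s t) y <= 0).
  right; exists (fun j => m j + (j == s)%:R); split=> [j jn|j jE|i|].
  - rewrite mS // add0r; case: eqP => // js.
    by move: jn; rewrite js !inE sT orbT.
  - by rewrite addr_ge0 ?mE ?ler0n.
  - under eq_bigr do rewrite mulrDl.
    rewrite big_split /= ma /f liftK (bigD1 s) //= eqxx mul1r big1 ?addr0 ?addNr //.
    by move=> j /negPf->; rewrite mul0r.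
  right; split.
    under eq_bigr do rewrite mulrDl.
    rewrite big_split /= [X in _ + X](bigD1 s) //= eqxx mul1r.
    rewrite [X in _ + (_ + X)]big1 ?addr0 => [|j /negPf->]; last by rewrite mul0r.
    move: mh; rewrite /f unlift_none opprK; lra.
  exists s => //; rewrite eqxx gt_eqF //.
  by rewrite ltr_wpDl ?mE ?TE.
have yex (s : 'I_n) : exists y, weak y /\ (s \in T -> dotp (f s) y < 0).
  have [sT|_] := boolP (s \in T); last by exists y0.
  apply: contra_notP Hs => Hn; exists s; split=> // y yw; rewrite leNgt; apply/negP => lt0.
  apply: Hn; exists y; split=> // _; move: lt0.
  have -> : dotp (fun t => - f s t) y = - dotp (f s) y.
    by rewrite -mulN1r -dotpZl; apply: eq_bigr => t _; rewrite mulN1r.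
  by rewrite oppr_gt0.
have [ys ysP] := fin_all_exists yex.
left.
(* The sum of weak solutions, one strict at each [s], is strict everywhere. *)
pose y t := y0 t + \sum_s ys s t.
have yE b : dotp b y = dotp b y0 + \sum_s dotp b (ys s) by rewrite dotpDr dotp_sumr.
have y_gt : 0 < y ord0.
  rewrite /y ltr_wpDr // sumr_ge0 // => s _; by have [[]] := ysP s.
have yf j : dotp (a j) (fun i => (y ord0)^-1 * y (lift ord0 i)) = h j + (y ord0)^-1 * dotp (f j) y.
  rewrite dotpZr fE mulrBr mulrCA mulVf ?gt_eqF // mulr1; ring.
have [w1 w2 w3] := y0w.
exists (fun i => (y ord0)^-1 * y (lift ord0 i)); split=> j jS; rewrite yf // yE.
- rewrite w2 // big1 => [|s _]; first by rewrite addr0 mulr0 addr0.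
  by have [[_ /(_ _ jS)-> _] _] := ysP s.
- have Wj : j \in W :|: T by rewrite inE jS.
  rewrite gerDl pmulr_rle0 ?invr_gt0 // -[0]addr0.
  apply: lerD; [exact: w3|apply: sumr_le0 => s _].
  by have [[_ _ w] _] := ysP s; apply: w.
- have Wj : j \in W :|: T by rewrite inE jS orbT.
  rewrite gtrDl pmulr_rlt0 ?invr_gt0 // -[0]addr0.
  apply: ler_ltD; first exact: w3.
  rewrite (bigD1 j) //= -[0]addr0.
  apply: ltr_leD; first by have [_ ->] := ysP j.
  by apply: sumr_le0 => s _; have [[_ _ w] _] := ysP s; apply: w.
Qed.

Lemma max_ex (T : finType) (P : T -> rat -> Prop) :
  (forall x r s, P x r -> P x s -> r = s) -> (exists x r, P x r) ->
  exists x r, P x r /\ forall y s, P y s -> s <= r.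
Proof.
move=> Pf [x0 [r0 P0]].
pose F x := if pselect (exists r, P x r) is left h then sval (cid h) else 0.
have FP x r : P x r -> F x = r.
  rewrite /F => Px; case: pselect => [h|[]]; last by exists r.
  by apply: (Pf x) => //; case: (cid h).
pose Q x := `[< exists r, P x r >].
have Q0 : Q x0 by apply/asboolP; exists r0.
case: (arg_maxP F Q0) => x /asboolP[r Pxr] xm; exists x, r; split=> // y s Pys.
rewrite -(FP _ _ Pxr) -(FP _ _ Pys); apply: xm; apply/asboolP; by exists s.
Qed.

Section Lin.
Variables (n d : nat) (a : 'I_n -> 'I_d -> rat).
Implicit Types (S R : {set 'I_n}) (m b : 'I_n -> rat) (x v : 'I_d -> rat).

Definition comb m : 'I_d -> rat := fun i => \sum_j m j * a j i.
Definition relv m := forall i, comb m i = 0.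
Definition supp_in S m := forall j, j \notin S -> m j = 0.
Definition indep S := forall m, supp_in S m -> relv m -> forall j, m j = 0.
Definition rep S b x := supp_in S b /\ comb b =1 x.
Definition inspan S x := exists b, rep S b x.

Lemma combD m b i : comb (fun j => m j + b j) i = comb m i + comb b i.
Proof. by rewrite /comb -big_split; apply: eq_bigr => j _; rewrite mulrDl. Qed.

Lemma combZ k m i : comb (fun j => k * m j) i = k * comb m i.
Proof. by rewrite /comb mulr_sumr; apply: eq_bigr => j _; rewrite mulrA. Qed.

Lemma comb1 j i : comb (fun j' => (j' == j)%:R) i = a j i.
Proof.
rewrite /comb (bigD1 j) //= eqxx mul1r big1 ?addr0 // => j' /negPf->.
by rewrite mul0r.
Qed.

Lemma dot_comb m v : dotp (comb m) v = \sum_j m j * dotp (a j) v.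
Proof.
rewrite /dotp /comb; under eq_bigr do rewrite mulr_suml.
rewrite exchange_big; apply: eq_bigr => j _; rewrite mulr_sumr.
by apply: eq_bigr => i _; rewrite mulrA.
Qed.

Lemma dot_rep S b x v : rep S b x -> dotp x v = \sum_j b j * dotp (a j) v.
Proof. by move=> [_ bx]; rewrite -dot_comb; apply: eq_bigr => i _; rewrite bx. Qed.

Lemma indep_uniq S b b' x : indep S -> rep S b x -> rep S b' x -> b =1 b'.
Proof.
move=> iS [bS bx] [bS' bx'] j; apply/eqP; rewrite -subr_eq0; apply/eqP.
have := iS (fun j => b j + (-1) * b' j); rewrite -[in b j - _]mulN1r; apply.
- by move=> k kS; rewrite bS // bS' // mulr0 addr0.
- by move=> i; rewrite combD combZ bx bx' mulN1r subrr.
Qed.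

Lemma supp_inW S R m : S \subset R -> supp_in S m -> supp_in R m.
Proof. by move=> /subsetP SR mS j jR; apply: mS; apply: contra jR => /SR. Qed.

Lemma inspanW S R x : S \subset R -> inspan S x -> inspan R x.
Proof. by move=> SR [b [bS bx]]; exists b; split=> //; apply: supp_inW bS. Qed.

Lemma rep1 S j : j \in S -> rep S (fun j' => (j' == j)%:R) (a j).
Proof.
move=> jS; split=> [k|]; last exact: comb1.
by case: eqP => // ->; rewrite jS.
Qed.

Lemma inspan_mem S j : j \in S -> inspan S (a j).
Proof. by move=> jS; exists (fun j' => (j' == j)%:R); exact: rep1. Qed.

Lemma inspan_comb S m x : (forall j, m j != 0 -> inspan S (a j)) -> comb m =1 x ->
  inspan S x.
Proof.
move=> H mx.
have H' j : exists b, m j != 0 -> rep S b (a j).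
  by case: eqP => [_|/eqP /H[b bP]]; [exists m|exists b].
have [B BP] := fin_all_exists H'.
exists (fun k => \sum_(j | m j != 0) m j * B j k); split.
  move=> k kS; rewrite big1 // => j mj; have [-> //] := BP j mj; by rewrite mulr0.
move=> i; rewrite -mx /comb; under eq_bigr do rewrite mulr_suml.
rewrite exchange_big [RHS](bigID (fun j => m j != 0)) /= [X in _ + X]big1 ?addr0; last first.
  by move=> j; rewrite negbK => /eqP->; rewrite mul0r.
apply: eq_bigr => j mj; have [_ <-] := BP j mj.
by rewrite /comb mulr_sumr; apply: eq_bigr => k _; rewrite mulrA.
Qed.

Lemma inspan_trans S R x : (forall j, j \in S -> inspan R (a j)) -> inspan S x -> inspan R x.
Proof.
move=> H [b [bS bx]]; apply: inspan_comb bx => j bj; apply: H.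
by apply: contraR bj => /bS->.
Qed.

Lemma solve_inspan S m j : supp_in (j |: S) m -> relv m -> m j != 0 -> inspan S (a j).
Proof.
move=> mS mr mj.
apply: (@inspan_comb _ (fun k => - (m j)^-1 * m k + (k == j)%:R)).
  move=> k; have [->|kj] := eqVneq k j; first by rewrite mulNr mulVf // addNr eqxx.
  rewrite addr0 => mk; apply: inspan_mem; apply: contraR mk => kS.
  have -> : m k = 0 by apply: mS; rewrite !inE negb_or kj.
  by rewrite mulr0.
by move=> i; rewrite combD combZ comb1 mr mulr0 add0r.
Qed.

Lemma indep_add S j : indep S -> ~ inspan S (a j) -> indep (j |: S).
Proof.
move=> iS nS m mS mr.
have mj : m j = 0 by apply: contra_notP nS => /eqP; exact: solve_inspan.
apply: iS => // k kS; have [->//|kj] := eqVneq k j.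
by apply: mS; rewrite !inE negb_or kj.
Qed.

Lemma basis_extend R S : indep R -> R \subset S ->
  exists R', [/\ R \subset R', R' \subset S, indep R' & forall j, j \in S -> inspan R' (a j)].
Proof.
have [k kE] := ubnP #|S :\: R|; elim: k => // k IH in R kE * => iR RS.
have [[j [jS jR]]|H] := pselect (exists j, j \in S /\ ~ inspan R (a j)); last first.
  exists R; split=> // j jS; apply: contra_notP H => nj; by exists j.
have jnR : j \notin R by apply/negP => /inspan_mem.
have [|||R' [R1 R2 R3 R4]] := IH (j |: R).
- have jSR : j \in S :\: R by rewrite inE jnR.
  rewrite setUC -setDDl; move: kE; rewrite (cardsD1 j) jSR add1n ltnS; exact.
- exact: indep_add.
- by rewrite subUset sub1set jS.
exists R'; split=> //; apply: subset_trans R1; exact: subsetUr.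
Qed.

(** With equations only, a certificate of infeasibility is a relation with nonzero coefficient at
    [j0], which would put [a j0] into the span of [S]. *)
Lemma perp_exists S j0 : ~ inspan S (a j0) ->
  exists v, (forall j, j \in S -> dotp (a j) v = 0) /\ dotp (a j0) v = 1.
Proof.
move=> nS.
have jnS : j0 \notin S by apply/negP => /inspan_mem.
case: (@motzkin n d a (fun j => (j == j0)%:R) (j0 |: S) set0 set0) => [j|[v [vE _ _]]|].
- by rewrite in_set0.
- exists v; split=> [j jS|]; last by rewrite vE ?setU11 // eqxx.
  by rewrite vE; [case: eqP => // jj; rewrite -jj jS in jnS|apply/setU1P; right].
move=> [m [mS _ mr H]]; exfalso; apply: nS.
apply: (@solve_inspan _ m) => // [j jS|]; first by apply: mS; rewrite !setU0.
case: H => [|[_ [j]]]; last by rewrite in_set0.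
rewrite (bigD1 j0) //= eqxx mulr1 big1 ?addr0 => [|j /negPf->]; last by rewrite mulr0.
by move=> /lt_eqF->.
Qed.

Section Circuit.
Variable R : {set 'I_n}.
Hypothesis iR : indep R.

(** Positive circuits after contraction of the span of [R]. The normalised sum makes weighted
    heights over [S] into averages and leaves [m] determined by [S]. *)
Definition circuit S m := [/\ forall j, j \in S -> 0 < m j /\ ~ inspan R (a j),
  supp_in (R :|: S) m, relv m, \sum_(j in S) m j = 1 &
  forall m', supp_in (R :|: S) m' -> relv m' -> exists t, forall j, m' j = t * m j].

Definition outs := [set j | `[< ~ inspan R (a j) >]].

Lemma outsP j : reflect (~ inspan R (a j)) (j \in outs).
Proof. by rewrite inE; apply: asboolP. Qed.

Lemma outs_R j : j \in R -> j \notin outs.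
Proof. by move=> jR; apply/outsP; apply; exact: inspan_mem. Qed.

(** Induction on the outer support: unless the relation is unique up to scale, a multiple of another
    relation of total height 0 can be subtracted until a coefficient dies, with the others still
    nonnegative and the total height unchanged. *)
Lemma circuit_of_cert mu m : supp_in (R :|: outs) m -> (forall j, j \in outs -> 0 <= m j) ->
  relv m -> \sum_(j in outs) m j * mu j < 0 ->
  exists S m', circuit S m' /\ \sum_(j in S) m' j * mu j < 0.
Proof.
pose Sm m := [set j in outs | m j != 0].
have [k kE] := ubnP #|Sm m|; elim: k => // k IH in m kE * => mS m0 mr mu0.
pose S := Sm m.
have sumS b : supp_in (R :|: S) b -> \sum_(j in outs) b j * mu j = \sum_(j in S) b j * mu j.
  move=> bS; rewrite (bigID (mem S)) /= [X in _ + X]big1 ?addr0.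
    by apply: eq_bigl => j; rewrite !inE; case: `[< _ >].
  move=> j /andP[jo jS]; rewrite bS ?mul0r // inE negb_or jS andbT.
  by apply: contraL jo; exact: outs_R.
have mSS : supp_in (R :|: S) m.
  move=> j; rewrite in_setU negb_or => /andP[jR]; rewrite in_set negb_and negbK => /orP[jo|/eqP //].
  by apply: mS; rewrite inE negb_or jR.
have Spos j : j \in S -> 0 < m j /\ ~ inspan R (a j).
  by rewrite in_set => /andP[jo mj]; rewrite lt0r mj m0 //; split=> //; apply/outsP.
have [H|/existsNP[m1 /not_implyP[m1S /not_implyP[m1r m1n]]]] := pselect (forall m',
   supp_in (R :|: S) m' -> relv m' -> exists t, forall j, m' j = t * m j).
  have s0 : 0 < \sum_(j in S) m j.
    have [j jS] : exists j, j \in S.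
      apply/set0Pn; apply: contraTneq mu0 => S0.
      by rewrite sumS // S0 big_set0 ltxx.
    rewrite (bigD1 j) //= ltr_pwDl ?(Spos j jS).1 // sumr_ge0 // => i /andP[iS _].
    exact: ltW (Spos i iS).1.
  set s := \sum_(j in S) m j in s0.
  exists S, (fun j => s^-1 * m j); split; first split.
  - by move=> j /Spos[mj nj]; rewrite mulr_gt0 ?invr_gt0.
  - by move=> j /mSS->; rewrite mulr0.
  - by move=> i; rewrite combZ mr mulr0.
  - by rewrite -mulr_sumr mulVf ?gt_eqF.
  - move=> m' /H{}H /H[t tE]; exists (t * s) => j.
    by rewrite tE mulrA mulfK ?gt_eqF.
  under eq_bigr do rewrite -mulrA.
  by rewrite -mulr_sumr pmulr_rlt0 ?invr_gt0 // -sumS.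
(* [q] makes the height of [m2] vanish; the denominator is the negative height of [m]. *)
pose q := (\sum_(j in S) m1 j * mu j) / (\sum_(j in S) m j * mu j).
pose m2 j := m1 j + (- q) * m j.
have m2S : supp_in (R :|: S) m2 by move=> j jS; rewrite /m2 mSS // m1S // mulr0 addr0.
have m2r : relv m2 by move=> i; rewrite combD combZ m1r mr mulr0 addr0.
have m2mu : \sum_(j in S) m2 j * mu j = 0.
  rewrite (eq_bigr (fun j => m1 j * mu j + (- q) * (m j * mu j))) => [|j _]; last first.
    by rewrite /m2 mulrDl mulrA.
  by rewrite big_split -mulr_sumr /= /q mulNr divfK ?subrr // -sumS // lt_eqF.
have [j1 [j1S j1n]] : exists j, j \in S /\ m2 j != 0.
  apply: contra_notP m1n => H; exists q => j.
  have -> : m1 j = m2 j + q * m j by rewrite /m2; ring.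
  rewrite (@iR m2 _ m2r) ?add0r // => l lR; have [lS|lS] := boolP (l \in S).
    by apply/eqP; apply: contra_notT H => ?; exists l.
  by rewrite m2S // inE negb_or lR.
have [m3 [m3S m3r m3mu [j3 [j3S j3p]]]] : exists m3, [/\ supp_in (R :|: S) m3, relv m3,
    \sum_(j in S) m3 j * mu j = 0 & exists j, j \in S /\ 0 < m3 j].
  have [lt|gt|e] := ltgtP (m2 j1) 0; last by rewrite e eqxx in j1n.
    exists (fun j => (-1) * m2 j); split.
    - by move=> j /m2S->; rewrite mulr0.
    - by move=> i; rewrite combZ m2r mulr0.
    - by under eq_bigr do rewrite -mulrA; rewrite -mulr_sumr m2mu mulr0.
    - by exists j1; rewrite mulN1r oppr_gt0.
  by exists m2; split=> //; exists j1.
pose Q j := (j \in S) && (0 < m3 j).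
have Q3 : Q j3 by rewrite /Q j3S.
case: (arg_minP (fun j => m j / m3 j) Q3) => l /andP[lS lp] lmin.
pose t := m l / m3 l.
have t0 : 0 <= t by rewrite divr_ge0 ?ltW // (Spos l lS).1.
pose m4 j := m j + (- t) * m3 j.
have m4S : supp_in (R :|: S) m4 by move=> j jS; rewrite /m4 mSS // m3S // mulr0 addr0.
have SO : S \subset outs by apply/subsetP => j; rewrite in_set => /andP[].
have m4l : m4 l = 0 by rewrite /m4 /t mulNr divfK ?subrr // gt_eqF.
apply: (IH m4).
- rewrite ltnS in kE; apply: leq_trans kE; apply: proper_card; apply/properP; split.
    apply/subsetP => j; rewrite in_set => /andP[jo]; apply: contraR => jS.
    by rewrite m4S // inE negb_or jS andbT; apply: contraL jo; exact: outs_R.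
  by exists l => //; rewrite inE m4l eqxx andbF.
- by apply: supp_inW m4S; rewrite setUS.
- move=> j jo; have [jS|jS] := boolP (j \in S); last first.
    by rewrite m4S // inE negb_or jS andbT; apply: contraL jo; exact: outs_R.
  rewrite /m4 mulNr subr_ge0; have [p|np] := ltP 0 (m3 j).
    by rewrite -ler_pdivlMr //; apply: lmin; rewrite /Q jS.
  by apply: (@le_trans _ _ 0); [rewrite mulr_ge0_le0|rewrite ltW // (Spos j jS).1].
- by move=> i; rewrite combD combZ mr m3r mulr0 addr0.
- rewrite sumS // (eq_bigr (fun j => m j * mu j + (- t) * (m3 j * mu j))) => [|j _].
    by rewrite big_split -mulr_sumr /= m3mu mulr0 addr0 -sumS.
  by rewrite /m4 mulrDl mulrA.
Qed.

(* Either the heights can be shifted below mu, or a circuit with negative height obstructs. *)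
Lemma circuit_alt (mu : 'I_n -> rat) :
  (exists v, (forall k, k \in R -> dotp (a k) v = 0) /\
     forall j, ~ inspan R (a j) -> dotp (a j) v <= mu j) \/
  (exists S m, circuit S m /\ \sum_(j in S) m j * mu j < 0).
Proof.
pose h j := if j \in R then 0 else mu j.
case: (@motzkin n d a h R outs set0) => [j|[v [vE vW _]]|[m [mS m0 mr H]]].
- by rewrite inE.
- left; exists v; split=> [k kR|j /outsP jo]; first by rewrite vE // /h kR.
  by have := vW j jo; rewrite /h; case: ifP => // /outs_R; rewrite jo.
right; apply: (@circuit_of_cert mu m) => //.
- by move=> j jS; apply: mS; rewrite setU0.
- by move=> j jo; apply: m0; apply: contraL jo; exact: outs_R.
case: H => [|[_ [j]]]; last by rewrite in_set0.
rewrite (bigID (mem outs)) /= [X in _ + X]big1 ?addr0 => [|j jo].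
  rewrite (eq_bigr (fun j => m j * mu j)) // => j jo; rewrite /h.
  by case: ifP => // /outs_R; rewrite jo.
have [jR|jR] := boolP (j \in R); first by rewrite /h jR mulr0.
by rewrite mS ?mul0r // setU0 inE negb_or jR.
Qed.

Lemma circuit_uniq S m m' : circuit S m -> circuit S m' -> m =1 m'.
Proof.
move=> [_ _ _ m1 mu] [_ mS' mr' m1' _]; have [t tE] := mu _ mS' mr'.
have t1 : t = 1.
  have := m1'; under eq_bigr do rewrite tE; by rewrite -mulr_sumr m1 mulr1.
by move=> j; rewrite tE t1 mul1r.
Qed.

(** By [circuit_uniq] the height is a function of the support, so only finitely many values
    compete. *)
Lemma max_circuit (lam : 'I_n -> rat) : (exists S m, circuit S m) ->
  exists S m, circuit S m /\ forall S' m', circuit S' m' ->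
    \sum_(j in S') m' j * lam j <= \sum_(j in S) m j * lam j.
Proof.
move=> [S0 [m0 c0]].
pose P S r := exists m, circuit S m /\ r = \sum_(j in S) m j * lam j.
have [S r s [m [cm ->]] [m' [cm' ->]]||S [r [[m [cm ->]] H]]] := @max_ex _ P.
- by apply: eq_bigr => j _; rewrite (circuit_uniq cm cm').
- by exists S0, (\sum_(j in S0) m0 j * lam j); exists m0.
exists S, m; split=> // S' m' c'; apply: (H S'); by exists m'.
Qed.

End Circuit.
End Lin.

(** * Frames *)

Section Frame.
Variables (n d : nat) (a : 'I_n -> 'I_d -> rat) (Lx : 'I_n -> rat) (c : rat) (tau : {set 'I_n}).
Hypothesis c0 : 0 < c.
Implicit Types (R S : {set 'I_n}) (v : 'I_d -> rat).

Definition lam v j := Lx j + dotp (a j) v.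

(* The invariant of the inductive construction of a frame: columns outside the span of R lie
   below those of R, and each step adds to R all but one column of a circuit modulo R. *)
Record pframe R v (o : 'I_n -> 'I_n) (kap : 'I_n -> nat) : Prop := PFrame {
  pf_indep : indep a R;
  pf_le : forall j, lam v j <= c;
  pf_tau : forall j, (j \in tau) = (lam v j == c);
  pf_span : forall j, j \in tau -> inspan a R (a j);
  pf_pos : forall k, k \in R -> 0 < lam v k;
  pf_out : forall j k, k \in R -> ~ inspan a R (a j) -> lam v j <= lam v k;
  pf_rep : forall j b k, rep a R b (a j) -> k \in R -> b k != 0 -> lam v j <= lam v k;
  pf_o : forall k, k \in R :\: tau -> [/\ o k \notin R, inspan a R (a (o k)),
     lam v (o k) = lam v k, (forall b, rep a R b (a (o k)) -> b k != 0) & kap (o k) = kap k];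
  pf_kap : forall j b k, k \in R :\: tau -> j \notin R -> j != o k -> rep a R b (a j) ->
     b k != 0 -> lam v j = lam v k -> (kap j < kap k)%N;
  pf_kap0 : forall j, ~ inspan a R (a j) -> kap j = 0%N;
  pf_kapn : forall k, k \in R :\: tau -> (n < kap k + #|R|)%N;
  pf_dom : forall u x, supp_in tau u -> supp_in (R :\: tau) x ->
     (forall i, comb a u i + \sum_k x k * (a (o k) i - a k i) = 0) -> forall k, x k = 0 }.

Lemma lam_span R v' x : (forall k, k \in R -> dotp (a k) v' = 0) ->
  inspan a R x -> dotp x v' = 0.
Proof.
move=> H [b bx]; rewrite (dot_rep v' bx) big1 // => j _.
have [jR|jR] := boolP (j \in R); first by rewrite H // mulr0.
by have [-> //] := bx; rewrite mul0r.
Qed.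

Lemma indep0 : indep a set0.
Proof. by move=> m mS _ j; apply: mS; rewrite in_set0. Qed.

Lemma pframe_init v : (forall j, lam v j <= c) -> (forall j, (j \in tau) = (lam v j == c)) ->
  exists R, pframe R v id (fun _ => 0%N).
Proof.
move=> vle vtau.
have [R [_ Rt iR Rs]] := basis_extend indep0 (sub0set tau).
have lamR k : k \in R -> lam v k = c.
  by move=> /(subsetP Rt); rewrite vtau => /eqP.
have RtE : R :\: tau = set0 by apply/eqP; rewrite setD_eq0.
exists R; split=> //.
- by move=> k /lamR->.
- by move=> j k /lamR-> _.
- by move=> j b k _ /lamR-> _.
- by move=> k; rewrite RtE in_set0.
- by move=> j b k; rewrite RtE in_set0.
- by move=> k; rewrite RtE in_set0.
- by move=> u x _ xS _ k; apply: xS; rewrite RtE in_set0.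
Qed.

(** A relation pairs to 0 with every functional, and here the terms from [R] vanish; so shifts by
    such [v'] preserve the average height of a circuit. *)
Lemma circuit_shift R S m v' : (forall k, k \in R -> dotp (a k) v' = 0) -> circuit a R S m ->
  \sum_(j in S) m j * dotp (a j) v' = 0.
Proof.
move=> v'R [mp mS mr m1 mu].
have := dot_comb a m v'.
have -> : dotp (comb a m) v' = 0 by rewrite /dotp big1 // => i _; rewrite mr mul0r.
rewrite (bigID (mem S)) /= [X in _ + X]big1 ?addr0 => [<- //|j jS].
have [jR|jR] := boolP (j \in R); first by rewrite v'R // mulr0.
by rewrite mS ?mul0r // in_setU negb_or jR.
Qed.

(** If the outer columns cannot be lowered to height at most 0, some circuit has positive average
    height. Let [t] be the largest such average and shift all outer columns to height at most [t];
    then the columns of the maximising circuit lie exactly at [t], and all but one of them enter the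
    basis. *)
Lemma pframe_step R v o kap : pframe R v o kap ->
  (exists v', (forall k, k \in R -> dotp (a k) v' = 0) /\
     forall j, ~ inspan a R (a j) -> lam v j + dotp (a j) v' <= 0) \/
  (exists R' v' o' kap', (#|R| < #|R'|)%N /\ pframe R' v' o' kap').
Proof.
move=> [iR vle vtau Rspan Rpos Rout Rrep Ro Rkap Rkap0 Rkapn Rdom].
have [[v' [v'R v'o]]|[S0 [m0 [c0' s0]]]] := circuit_alt iR (fun j => - lam v j).
  left; exists v'; split=> // j jo; have := v'o j jo; lra.
right.
have [S [m [cS Smax]]] := max_circuit (lam v) (ex_intro _ S0 (ex_intro _ m0 c0')).
set t := \sum_(j in S) m j * lam v j in Smax.
have [mp mS mr m1 mu] := cS.
have t0 : 0 < t.
  apply: lt_le_trans (Smax _ _ c0'); move: s0.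
  by under eq_bigr do rewrite mulrN; rewrite sumrN oppr_lt0.
have m_le (b : rat) : (forall j, j \in S -> lam v j <= b) -> t <= b.
  move=> H; rewrite -[b]mul1r -m1 mulr_suml; apply: ler_sum => j jS.
  apply: ler_wpM2l; [exact: ltW (mp j jS).1|exact: H].
have Sne : exists j, j \in S.
  apply/set0Pn; apply: contra_eq_neq m1 => ->; rewrite big_set0 eq_sym; exact: oner_neq0.
(* Outer columns are not in [tau], so their heights are below [c]; this keeps [tau] the set of
   columns of height [c] after the shift. *)
have t_lt : t < c.
  have [j jS] := Sne.
  rewrite -[c]mul1r -m1 mulr_suml; rewrite -subr_gt0 -sumrB (bigD1 j) //=.
  have H i : i \in S -> 0 < m i * c - m i * lam v i.
    move=> iS; rewrite -mulrBr mulr_gt0 ?(mp i iS).1 // subr_gt0 lt_neqAle vle -vtau andbT.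
    by apply/negP => /Rspan; exact: (mp i iS).2.
  apply: ltr_pwDl; first exact: H.
  by apply: sumr_ge0 => i /andP[iS _]; apply/ltW/H.
(* An obstruction to the shift would be a circuit of average height above [t]. *)
have [[v' [v'R v'o]]|[S1 [m1' [c1 s1]]]] := circuit_alt iR (fun j => t - lam v j); last first.
  exfalso; move: s1; under eq_bigr do rewrite mulrBr.
  rewrite sumrB -mulr_suml; have [_ _ _ -> _] := c1.
  by rewrite mul1r subr_lt0 ltNge Smax.
pose v1 i := v i + v' i.
have lam1 j : lam v1 j = lam v j + dotp (a j) v' by rewrite /lam dotpDr addrA.
have lam_in j : inspan a R (a j) -> lam v1 j = lam v j.
  by move=> jR; rewrite lam1 (lam_span v'R jR) addr0.
have lam_out j : ~ inspan a R (a j) -> lam v1 j <= t.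
  by move=> /v'o; rewrite lam1; lra.
(* Numbers at most [t] whose average with positive weights is [t] all equal [t]. *)
have lam_S j : j \in S -> lam v1 j = t.
  move=> jS; apply/eqP; rewrite eq_le; apply/andP; split.
    by apply: lam_out; exact: (mp j jS).2.
  rewrite leNgt; apply/negP => lt.
  have : \sum_(i in S) m i * lam v1 i < t.
    rewrite -[t]mul1r -m1 mulr_suml -subr_gt0 -sumrB (bigD1 j) //= ltr_pwDl //.
      by rewrite -mulrBr mulr_gt0 ?(mp j jS).1 // subr_gt0.
    apply: sumr_ge0 => i /andP[iS _].
    rewrite -mulrBr mulr_ge0 //; first exact: ltW (mp i iS).1.
    rewrite subr_ge0; apply: lam_out; exact: (mp i iS).2.
  under eq_bigr do rewrite lam1 mulrDr.
  by rewrite big_split /= (circuit_shift v'R cS) addr0 -/t ltxx.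
have [o1 o1S] := Sne.
pose R' := R :|: (S :\ o1).
have SR j : j \in S -> j \notin R.
  by move=> /mp[_ nj]; apply/negP => /inspan_mem.
have RR' : R \subset R' by apply: subsetUl.
have R'i : indep a R'.
  move=> m' m'S m'r; have [|//|th thE] := mu m'.
    by move=> j; rewrite in_setU negb_or => /andP[jR jS]; apply: m'S; rewrite !inE negb_or jR (negPf jS) andbF.
  have th0 : th = 0.
    have := thE o1; rewrite m'S ?inE ?eqxx ?orbF ?(negPf (SR _ o1S)) // => /esym/eqP.
    by rewrite mulf_eq0 (gt_eqF (mp _ o1S).1) orbF => /eqP.
  by move=> j; rewrite thE th0 mul0r.
have o1R' : o1 \notin R' by rewrite !inE eqxx orbF SR.
pose bo j := - (m o1)^-1 * m j + (j == o1)%:R.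
have repo : rep a R' bo (a o1).
  split=> [j|i]; last by rewrite combD combZ comb1 mr mulr0 add0r.
  rewrite /bo; have [->|jo] := eqVneq j o1.
    by move=> _; rewrite mulNr mulVf ?gt_eqF ?addNr // (mp _ o1S).1.
  rewrite !inE jo /= => /norP[jR jS]; have -> : m j = 0 by apply: mS; rewrite in_setU negb_or jR.
  by rewrite mulr0 addr0.
have S_o j : j \in S -> j != o1 -> j \in R' by move=> jS jo; rewrite !inE jo jS orbT.
have R'P j : j \in R' -> j \in R \/ (j \in S /\ j != o1).
  by rewrite !inE => /orP[|/andP[? ?]]; [left|right].
have R'card : (#|R| < #|R'|)%N.
  apply: proper_card; rewrite properE RR' /=; apply/negP => R'R.
  apply: (mp _ o1S).2; exists bo; split; last by case: repo.
  move=> j jR; apply: (repo.1 j); apply: contra jR; exact: (subsetP R'R).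
have inR' j : inspan a R (a j) -> inspan a R' (a j) by apply: inspanW.
have R'n : (#|R'| <= n)%N by rewrite -[X in (_ <= X)%N](card_ord n) max_card.
have lamR k : k \in R -> t <= lam v1 k.
  move=> kR; rewrite lam_in; last exact: inspan_mem.
  by apply: m_le => j jS; apply: Rout => //; exact: (mp j jS).2.
have lamR' k : k \in R' -> t <= lam v1 k.
  by move=> /R'P[/lamR//|[kS _]]; rewrite lam_S.
have rep_old j b : inspan a R (a j) -> rep a R' b (a j) -> rep a R b (a j).
  move=> [b' rb'] rb; have rb2 : rep a R' b' (a j) by case: rb' => ? ?; split=> //; apply: supp_inW RR' _.
  have bb' := indep_uniq R'i rb rb2.
  by case: rb' => s e; split=> [k /s <-|i]; [exact: bb'|case: rb => _ ->].
pose o' k := if k \in S then o1 else o k.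
(* This value is positive because [#|R'| <= n], and it is below all earlier ones by [pf_kapn], since
   [#|R'|] has grown; columns not yet in the span keep 0. Hence columns reached later are
   dominated. *)
pose kap' j := if j \in S then (n.+1 - #|R'|)%N else kap j.
have R'tau k : k \in R' :\: tau -> (k \in R :\: tau) /\ k \notin S \/ k \in S /\ k != o1.
  rewrite inE => /andP[kt /R'P[kR|]]; [left|by right].
  rewrite inE kt kR; split=> //; apply/negP => /SR; by rewrite kR.
exists R', v1, o', kap'; split=> //; split=> //.
- move=> j; have [jR|jR] := pselect (inspan a R (a j)); first by rewrite lam_in.
  exact: le_trans (lam_out j jR) (ltW t_lt).
- move=> j; have [jR|jR] := pselect (inspan a R (a j)); first by rewrite lam_in.
  rewrite (lt_eqF (le_lt_trans (lam_out j jR) t_lt)); apply/negP => /Rspan; exact: jR.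
- by move=> j /Rspan/inR'.
- by move=> k kR'; apply: lt_le_trans t0 (lamR' k kR').
- move=> j k kR' njR'; apply: le_trans (lam_out j _) (lamR' k kR').
  by move=> /inR'.
- move=> j b k rb kR' bk; have [jR|jR] := pselect (inspan a R (a j)); last first.
    exact: le_trans (lam_out j jR) (lamR' k kR').
  have rb' := rep_old _ _ jR rb.
  have kR : k \in R by apply: contraR bk => kR; case: rb' => ->.
  rewrite !lam_in //; [exact: Rrep rb' kR bk|exact: inspan_mem].
- move=> k /R'tau[[kRt kS]|[kS ko]].
    have [ok1 ok2 ok3 ok4 ok5] := Ro k kRt.
    have kR : k \in R by move: kRt; rewrite inE => /andP[].
    have okS : o k \notin S by apply/negP => /mp[_].
    rewrite /o' (negPf kS); split.
    + by rewrite !inE negb_or ok1 (negPf okS) andbF.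
    + exact: inR'.
    + by rewrite !lam_in //; exact: inspan_mem.
    + by move=> b /(rep_old _ _ ok2) /ok4.
    + by rewrite /kap' (negPf kS) (negPf okS).
  rewrite /o' kS; split=> //.
  + by exists bo.
  + by rewrite !lam_S.
  + move=> b rb; rewrite (indep_uniq R'i rb repo k) /bo (negPf ko) addr0.
    by rewrite mulf_neq0 ?oppr_eq0 ?invr_eq0 ?gt_eqF ?(mp _ o1S).1 ?(mp _ kS).1.
  + by rewrite /kap' kS o1S.
- move=> j b k kRt jR' jo rb bk lamE.
  have [jR|jR] := pselect (inspan a R (a j)).
    have rb' := rep_old _ _ jR rb.
    have kR : k \in R by apply: contraR bk => kR; case: rb' => ->.
    have kS : k \notin S by apply: contraL kR; exact: SR.
    have jS : j \notin S by apply/negP => /mp[_].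
    rewrite /kap' (negPf kS) (negPf jS); apply: (Rkap _ b) => //.
    + by move: kRt; rewrite !inE kR => /andP[->].
    + by apply: contra jR'; exact: (subsetP RR').
    + by move: jo; rewrite /o' (negPf kS).
    + by move: lamE; rewrite !lam_in //; exact: inspan_mem.
  case/R'tau: kRt => [[kRt kS]|[kS ko]].
    rewrite /kap' (negPf kS); case: ifP => jS.
      by move: (Rkapn k kRt) R'card R'n; clear; lia.
    by rewrite (Rkap0 _ jR); move: (Rkapn k kRt) R'card R'n; clear; lia.
  have jS : j \notin S.
    by apply: contra jR' => jS; apply: S_o => //; move: jo; rewrite /o' kS.
  by rewrite /kap' kS (negPf jS) (Rkap0 _ jR); move: R'n; clear; lia.
- move=> j jR'; have jR : ~ inspan a R (a j) by move=> /inR'.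
  rewrite /kap'; case: ifP => jS; last exact: Rkap0.
  exfalso; apply: jR'; have [->|jo] := eqVneq j o1; first by exists bo.
  by apply: inspan_mem; exact: S_o.
- move=> k /R'tau[[kRt kS]|[kS ko]]; rewrite /kap' ?kS ?(negPf kS).
    by move: (Rkapn k kRt) R'card; clear; lia.
  by move: R'n; clear; lia.
(* Modulo the span of [R] only the terms of the new columns survive. They form a relation on [S]
   with coefficient sum 0, hence a multiple [th] of [m]; as the coefficients of [m] on [S] sum to 1,
   [th = 0], and the earlier [pf_dom] handles the rest. *)
- move=> u x uS xS H.
  have xR k : k \in R :\: tau -> k \notin S -> inspan a R (fun i => a (o k) i - a k i).
    move=> kRt kS; have [_ [b [bS bE]] _ _ _] := Ro k kRt.
    exists (fun j => b j + (-1) * (j == k)%:R); split=> [j jR|i].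
      rewrite bS // add0r; case: eqP => [jk|]; last by rewrite mulr0.
      by move: kRt; rewrite -jk inE (negPf jR) andbF.
    by rewrite combD combZ comb1 bE mulN1r.
  pose X := \sum_(k in S :\ o1) x k.
  have [b [bS bE]] : exists b, supp_in R b /\ forall i, comb a b i =
      comb a u i + \sum_(k in R :\: tau) x k * (a (o' k) i - a k i).
    have H' k : exists b, k \in R :\: tau -> rep a R b (fun i => a (o' k) i - a k i).
      have [kRt|_] := boolP (k \in R :\: tau); last by exists x.
      have kS : k \notin S by move: kRt; rewrite inE => /andP[_ kR]; apply: contraL kR; exact: SR.
      have [b rb] := xR k kRt kS; exists b => _; by rewrite /o' (negPf kS).
    have [B BP] := fin_all_exists H'.
    have [b0 [b0S b0E]] : inspan a R (comb a u).
      apply: (@inspan_comb _ _ a R u) => // j uj; apply: Rspan.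
      by apply: contraR uj => /uS->.
    exists (fun j => b0 j + \sum_(k in R :\: tau) x k * B k j); split=> [j jR|i].
      rewrite b0S // add0r big1 // => k kRt; have [-> //] := BP k kRt; by rewrite mulr0.
    rewrite combD b0E; congr (_ + _).
    rewrite /comb; under eq_bigr do rewrite mulr_suml.
    rewrite exchange_big; apply: eq_bigr => k kRt; have [_ <-] := BP k kRt.
    by rewrite /comb mulr_sumr; apply: eq_bigr => j _; rewrite mulrA.
  have split_x i : \sum_k x k * (a (o' k) i - a k i) =
      \sum_(k in R :\: tau) x k * (a (o' k) i - a k i) + \sum_(k in S :\ o1) x k * (a o1 i - a k i).
    rewrite (bigID (mem (R :\: tau))) /=; congr (_ + _).
    rewrite (bigID (mem (S :\ o1))) /= [X in _ + X]big1 ?addr0.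
      apply: eq_big => [k|k /andP[_]]; last by rewrite /o' inE => /andP[_ ->].
      rewrite !inE; case kS: (k \in S); last by rewrite !andbF.
      by rewrite (negPf (SR _ kS)) andbF.
    move=> k /andP[kRt kS]; rewrite xS ?mul0r //.
    by apply/negP => /R'tau[[]|[k1 k2]]; [rewrite (negPf kRt)|move: kS; rewrite !inE k1 k2].
  pose m' j := b j + (X * (j == o1)%:R - (if j \in S :\ o1 then x j else 0)).
  have m'r i : comb a m' i = 0.
    rewrite combD bE -[RHS](H i) split_x -addrA; congr (_ + (_ + _)).
    rewrite /comb; under eq_bigr do rewrite mulrBl.
    rewrite sumrB.
    have -> : \sum_j X * (j == o1)%:R * a j i = X * a o1 i.
      by rewrite -(comb1 a o1 i) /comb mulr_sumr; apply: eq_bigr => j _; rewrite mulrA.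
    have -> : \sum_j (if j \in S :\ o1 then x j else 0) * a j i = \sum_(j in S :\ o1) x j * a j i.
      by rewrite [RHS]big_mkcond; apply: eq_bigr => j _; case: ifP; rewrite ?mul0r.
    by rewrite mulr_suml -sumrB; apply: eq_bigr => k _; rewrite mulrBr.
  have [|th thE] := mu m' _ m'r.
    move=> j; rewrite in_setU => /norP[jR jS]; rewrite /m' bS // in_setD1 (negPf jS) andbF.
    by rewrite subr0 add0r; case: eqP => [jo|]; [rewrite jo o1S in jS|rewrite mulr0].
  have thk k : k \in S :\ o1 -> - x k = th * m k.
    move=> kS; rewrite -thE /m' kS bS ?add0r; last by apply: SR; move: kS; rewrite inE => /andP[].
    by move: kS; rewrite !inE => /andP[/negPf-> _]; rewrite mulr0 sub0r.
  have tho : X = th * m o1.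
    by rewrite -thE /m' bS ?SR // !inE eqxx mulr1 subr0 add0r.
  have th0 : th = 0.
    have : th * \sum_(j in S) m j = 0.
      rewrite (big_setD1 o1) //= mulrDr -tho mulr_sumr.
      rewrite (eq_bigr (fun k => - x k)) => [|k kS]; last by rewrite thk.
      by rewrite sumrN subrr.
    by rewrite m1 mulr1.
  have xS0 k : k \in S -> x k = 0.
    move=> kS; have [->|ko] := eqVneq k o1.
      by apply: xS; rewrite !inE eqxx (negPf (SR _ o1S)) andbF.
    by apply: oppr_inj; rewrite thk ?th0 ?mul0r ?oppr0 // !inE ko.
  apply: (Rdom u x) => // [k kRt|i].
    have [/xS0//|kS] := boolP (k \in S).
    by apply: xS; apply: contra kRt => /R'tau[[]//|[]]; rewrite (negPf kS).
  rewrite -[RHS](H i); congr (_ + _); apply: eq_bigr => k _.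
  by rewrite /o'; case: ifP => // /xS0->; rewrite !mul0r.
Qed.
End Frame.

Section FrameEnd.
Variables (n d : nat) (a : 'I_n -> 'I_d -> rat) (Lx : 'I_n -> rat) (c : rat) (tau : {set 'I_n}).
Hypothesis c0 : 0 < c.
Hypothesis full : forall x, inspan a setT x.
Implicit Types (R S : {set 'I_n}) (v : 'I_d -> rat).
Notation lam := (lam a Lx).

Definition inV (s2 : {set 'I_n}) (l : 'I_n -> 'I_d -> rat) j :=
  [forall k in s2, dotp (a j) (l k) == 0].

(* V is the set of columns in the span of rho. For k in rho, the relation
   y_k t^(a_k) = - sum_j B_kj y_j t^(a_j) with B_kj = (a_j, l_k) runs over the columns j of V
   outside rho with lam v j = lam v k. For k outside tau, o k is the column that dominates it when
   y_j grows like e^(- kap j) as e tends to 0, and fr_dom says that the ratios t^(a_(o k)) / t^(a_k)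
   can be prescribed independently of the values of t on tau. *)
Record frame (rho s2 : {set 'I_n}) v (l : 'I_n -> 'I_d -> rat) (o : 'I_n -> 'I_n)
    (kap : 'I_n -> nat) : Prop := Frame {
  fr_disj : forall k, k \in s2 -> k \notin rho;
  fr_dual : forall k k', k \in rho :|: s2 -> k' \in rho :|: s2 -> dotp (a k') (l k) = (k == k')%:R;
  fr_basis : forall (x : 'I_d -> rat) i, x i = \sum_(k in rho :|: s2) dotp x (l k) * a k i;
  fr_le : forall j, lam v j <= c;
  fr_tau : forall j, (j \in tau) = (lam v j == c);
  fr_pos : forall k, k \in rho -> 0 < lam v k;
  fr_rep : forall j k, inV s2 l j -> k \in rho -> dotp (a j) (l k) != 0 -> lam v j <= lam v k;
  fr_out : forall j, ~~ inV s2 l j -> lam v j <= 0;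
  fr_s2 : forall k, k \in s2 -> lam v k = 0;
  fr_o : forall k, k \in rho :\: tau -> [/\ o k \notin rho, inV s2 l (o k),
     lam v (o k) = lam v k, dotp (a (o k)) (l k) != 0 & kap (o k) = kap k];
  fr_kap : forall j k, k \in rho :\: tau -> j \notin rho -> j != o k -> inV s2 l j ->
     dotp (a j) (l k) != 0 -> lam v j = lam v k -> (kap j < kap k)%N;
  fr_dom : forall u x, supp_in tau u -> supp_in (rho :\: tau) x ->
     (forall i, comb a u i + \sum_k x k * (a (o k) i - a k i) = 0) -> forall k, x k = 0 }.

Lemma pframe_end v : (forall j, lam v j <= c) -> (forall j, (j \in tau) = (lam v j == c)) ->
  exists R v o kap, pframe a Lx c tau R v o kap /\
  exists v', (forall k, k \in R -> dotp (a k) v' = 0) /\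
     forall j, ~ inspan a R (a j) -> lam v j + dotp (a j) v' <= 0.
Proof.
move=> vle vtau.
have [R pf] := pframe_init c0 vle vtau.
move: v (fun j : 'I_n => j) (fun=> 0%N) pf {vle vtau}.
have [k kE] := ubnP (n - #|R|); elim: k => // k IH in R kE * => v o kap pf.
have [H|[R' [v' [o' [kap' [R'R pf']]]]]] := pframe_step pf.
  by exists R, v, o, kap.
apply: IH pf'.
have R'n : (#|R'| <= n)%N by rewrite -[X in (_ <= X)%N](card_ord n) max_card.
by move: R'n R'R kE; clear; lia.
Qed.

(** Moving along a direction that fixes [R] and the tight columns, until a further outer column
    becomes tight, ends at a vertex: there the tight columns complete [R] to a spanning set. They
    later supply [s2]. *)
Lemma vertex R (lm : 'I_n -> rat) v' : (forall k, k \in R -> dotp (a k) v' = 0) ->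
  (forall j, ~ inspan a R (a j) -> lm j + dotp (a j) v' <= 0) ->
  exists v S, [/\ forall k, k \in R -> dotp (a k) v = 0,
    forall j, ~ inspan a R (a j) -> lm j + dotp (a j) v <= 0,
    forall j, j \in S -> lm j + dotp (a j) v = 0 /\ ~ inspan a R (a j) &
    forall j, inspan a (R :|: S) (a j)].
Proof.
pose act v := [set j in outs a R | lm j + dotp (a j) v == 0].
have actP v j : j \in act v -> lm j + dotp (a j) v = 0 /\ ~ inspan a R (a j).
  by rewrite in_set => /andP[/outsP ? /eqP].
have [k kE] := ubnP #|outs a R :\: act v'|; elim: k => // k IH in v' kE * => v'R v'o.
have [H|/existsNP[j0 nj0]] := pselect (forall j, inspan a (R :|: act v') (a j)).
  by exists v', (act v'); split=> //; exact: actP.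
have [w [wS wj0]] := perp_exists nj0.
pose Q j := (j \in outs a R) && (0 < dotp (a j) w).
have Q0 : Q j0.
  rewrite /Q wj0 ltr01 andbT; apply/outsP => j0R; apply: nj0; apply: inspanW j0R; exact: subsetUl.
pose sl j := - (lm j + dotp (a j) v') / dotp (a j) w.
case: (arg_minP sl Q0) => j1 /andP[j1o j1w] j1m.
pose v1 i := v' i + sl j1 * w i.
have v1E j : lm j + dotp (a j) v1 = lm j + dotp (a j) v' + sl j1 * dotp (a j) w.
  by rewrite /v1 dotpDr dotpZr addrA.
have sl0 : 0 <= sl j1.
  apply: divr_ge0; last exact: ltW.
  by rewrite oppr_ge0; apply: v'o; apply/outsP.
have v1j1 : lm j1 + dotp (a j1) v1 = 0.
  by rewrite v1E /sl divfK ?gt_eqF // subrr.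
have actS : act v' \subset act v1.
  apply/subsetP => j ja; have [e jo] := actP _ _ ja.
  have w0 := wS j; rewrite in_setU ja orbT in w0.
  rewrite in_set v1E e add0r w0 // mulr0 eqxx andbT; exact/outsP.
apply: (IH v1).
- rewrite ltnS in kE; apply: leq_trans kE; apply: proper_card; apply/properP; split.
    exact: setDS.
  exists j1; last by rewrite in_setD in_set v1j1 eqxx j1o.
  rewrite in_setD j1o andbT; apply/negP => ja.
  have := wS j1; rewrite in_setU ja orbT => /(_ isT) e.
  by rewrite e ltxx in j1w.
- by move=> l lR; rewrite dotpDr dotpZr v'R // wS ?mulr0 ?addr0 // in_setU lR.
- move=> j jo; rewrite v1E; have [p|np] := ltP 0 (dotp (a j) w).
    have jQ : Q j by rewrite /Q p andbT; apply/outsP.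
    have := j1m j jQ; rewrite -(ler_pM2r p) => le1.
    by apply: le_trans (lerD (lexx _) le1) _; rewrite /sl divfK ?gt_eqF // subrr.
  by rewrite -[0]addr0; apply: lerD; [exact: v'o|rewrite mulr_ge0_le0].
Qed.

Theorem frame_exists v : (forall j, lam v j <= c) -> (forall j, (j \in tau) = (lam v j == c)) ->
  exists rho s2 v l o kap, frame rho s2 v l o kap.
Proof.
move=> vle vtau.
have [R [{vle vtau}v [o [kap [pf [v' [v'R v'o]]]]]]] := pframe_end vle vtau.
have [w [S [wR wo wS Ssp]]] := vertex v'R v'o.
have [iR vle vtau Rspan Rpos Rout Rrep Ro Rkap Rkap0 Rkapn Rdom] := pf.
have [R' [RR' R'S iR' R'sp]] := basis_extend iR (subsetUl R S).
have R'x x : inspan a R' x.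
  by apply: inspan_trans (full x) => j _; apply: inspan_trans (Ssp j) => k; exact: R'sp.
have [b bP] := fin_all_exists (fun i => R'x (fun i' => (i' == i)%:R)).
(* Transposing the expansions of the unit vectors in the basis [R'] gives the dual basis. *)
pose l k i := b i k.
have repl x : rep a R' (fun k => dotp x (l k)) x.
  split=> [k kR'|i].
    by rewrite /dotp big1 // => i _; rewrite /l; have [-> //] := bP i; rewrite mulr0.
  rewrite /comb; under eq_bigr do rewrite /dotp mulr_suml.
  rewrite exchange_big (eq_bigr (fun i' => x i' * (i == i')%:R)) => [|i' _].
    rewrite (bigD1 i) //= eqxx mulr1 big1 ?addr0 // => i'.
    by rewrite eq_sym => /negPf->; rewrite mulr0.
  have [_ <-] := bP i'; rewrite /comb mulr_sumr; apply: eq_bigr => j _.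
  by rewrite mulrA.
pose s2 := R' :\: R.
have RE : R :|: s2 = R'.
  apply/setP => k; rewrite in_setU in_setD; case: (boolP (k \in R)) => //= kR.
  by rewrite (subsetP RR').
pose v1 i := v i + w i.
have v1E j : lam v1 j = lam v j + dotp (a j) w by rewrite /lam dotpDr addrA.
have lam_in j : inspan a R (a j) -> lam v1 j = lam v j.
  by move=> jR; rewrite v1E (lam_span wR jR) addr0.
have lam_out j : ~ inspan a R (a j) -> lam v1 j <= 0.
  by rewrite v1E; exact: wo.
have dual k k' : k \in R' -> k' \in R' -> dotp (a k') (l k) = (k == k')%:R.
  move=> kR k'R; exact: (indep_uniq iR' (repl (a k')) (rep1 a k'R)).
have inVrep j : inV s2 l j -> rep a R (fun k => dotp (a j) (l k)) (a j).
  move=> /forall_inP jV; have [jS jE] := repl (a j); split=> // k kR.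
  by have [kR'|/jS//] := boolP (k \in R'); apply/eqP/jV; rewrite in_setD kR.
have repE j b' : rep a R b' (a j) -> forall k, dotp (a j) (l k) = b' k.
  move=> [b'S b'E] k; apply: (indep_uniq iR' (repl (a j))); split=> //; exact: supp_inW b'S.
have inVP j : inV s2 l j <-> inspan a R (a j).
  split=> [/inVrep H|[b' rb]]; first by exists (fun k => dotp (a j) (l k)).
  apply/forall_inP => k; rewrite in_setD => /andP[kR _].
  by rewrite (repE _ _ rb) rb.1.
have RinV k : k \in R -> inspan a R (a k) by exact: inspan_mem.
exists R, s2, v1, l, o, kap; split.
- by move=> k; rewrite in_setD => /andP[].
- by rewrite RE.
- move=> x i; rewrite RE; have [xS <-] := repl x; rewrite /comb [LHS](bigID (mem R')) /=.
  rewrite [X in _ + X]big1 ?addr0 // => k /xS->; by rewrite mul0r.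
- move=> j; have [jR|jR] := pselect (inspan a R (a j)); first by rewrite lam_in.
  exact: le_trans (lam_out j jR) (ltW c0).
- move=> j; have [jR|jR] := pselect (inspan a R (a j)); first by rewrite lam_in.
  rewrite (lt_eqF (le_lt_trans (lam_out j jR) c0)); apply/negP => /Rspan; exact: jR.
- by move=> k kR; rewrite lam_in ?Rpos //; exact: RinV.
- move=> j k jV kR B0; rewrite !lam_in; first exact: Rrep (inVrep _ jV) kR B0.
    exact: RinV.
  exact/inVP.
- by move=> j /negP jV; apply: lam_out => /inVP.
- move=> k; rewrite in_setD => /andP[kR kR'].
  have := subsetP R'S k kR'; rewrite in_setU (negPf kR) => /wS[].
  by rewrite v1E.
- move=> k kRt; have [o1 o2 o3 o4 o5] := Ro k kRt; split=> //.
  + exact/inVP.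
  + rewrite !lam_in //; apply: RinV; by move: kRt; rewrite in_setD => /andP[].
  + by apply: (o4 (fun k' => dotp (a (o k)) (l k'))); apply: inVrep; exact/inVP.
- move=> j k kRt jR jo jV B0 lamE; apply: (Rkap j _ k kRt jR jo (inVrep _ jV) B0).
  have kR : k \in R by move: kRt; rewrite in_setD => /andP[].
  by rewrite -(lam_in _ (RinV _ kR)) -lamE lam_in //; exact/inVP.
- exact: Rdom.
Qed.
End FrameEnd.

(** * Modules over the Weyl algebra *)

Section LinExt.
Variables (N : nat) (V : lmodType CC) (F : 'X_{1..N} -> V).

Definition linext (P : {mpoly CC[N]}) : V := \sum_(m <- msupp P) P@_m *: F m.

Lemma linextE (s : seq 'X_{1..N}) P : uniq s -> {subset msupp P <= s} ->
  linext P = \sum_(m <- s) P@_m *: F m.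
Proof.
move=> us Ps; rewrite /linext [RHS](bigID (fun m => m \in msupp P)) /=.
rewrite [X in _ + X]big1 ?addr0 => [|m /memN_msupp_eq0->]; last by rewrite scale0r.
rewrite -[RHS]big_filter; apply: perm_big; apply: uniq_perm => [||m].
- exact: msupp_uniq.
- exact: filter_uniq.
- by rewrite mem_filter; case: (boolP (m \in msupp P)) => // /Ps->.
Qed.

Lemma linextD k P Q : linext (k *: P + Q) = k *: linext P + linext Q.
Proof.
pose s := undup (msupp P ++ msupp Q ++ msupp (k *: P + Q)).
have us : uniq s by apply: undup_uniq.
rewrite !(@linextE s) // => [|m|m|m]; try by rewrite mem_undup !mem_cat => ->; rewrite ?orbT.
rewrite scaler_sumr -big_split; apply: eq_bigr => m _ /=.
by rewrite mcoeffD mcoeffZ scalerDl scalerA.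
Qed.

Lemma linextX m : linext 'X_[m] = F m.
Proof. by rewrite /linext msuppX big_seq1 mcoeffX eqxx scale1r. Qed.

Lemma linext0 : linext 0 = 0.
Proof. by rewrite /linext msupp0 big_nil. Qed.

Lemma linextZ k P : linext (k *: P) = k *: linext P.
Proof. by rewrite -[k *: P]addr0 linextD linext0 addr0. Qed.

Lemma linextDD P Q : linext (P + Q) = linext P + linext Q.
Proof. by rewrite -[P]scale1r linextD !scale1r. Qed.

Lemma linextB P Q : linext (P - Q) = linext P - linext Q.
Proof. by rewrite linextDD -[- Q]scaleN1r linextZ scaleN1r. Qed.

Lemma linext_sum (I : Type) (r : seq I) (Q : pred I) (G : I -> {mpoly CC[N]}) :
  linext (\sum_(i <- r | Q i) G i) = \sum_(i <- r | Q i) linext (G i).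
Proof.
elim: r => [|i r IH]; first by rewrite !big_nil linext0.
by rewrite !big_cons; case: ifP; rewrite ?linextDD IH.
Qed.

End LinExt.

Lemma linext_eq (N : nat) (V : lmodType CC) (f g : {mpoly CC[N]} -> V) :
  (forall k P Q, f (k *: P + Q) = k *: f P + f Q) ->
  (forall k P Q, g (k *: P + Q) = k *: g P + g Q) ->
  (forall m, f 'X_[m] = g 'X_[m]) -> f =1 g.
Proof.
move=> fl gl fg; elim/mpolyind => [|c m p _ _ IH]; last by rewrite fl gl fg IH.
have z (h : {mpoly CC[N]} -> V) : (forall k P Q, h (k *: P + Q) = k *: h P + h Q) -> h 0 = 0.
  move=> hl; have := hl (-1) 0 0; rewrite scaler0 addr0 scaleN1r addNr; exact.
by rewrite !z.
Qed.

Section Words.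
Variables (n : nat) (V : lmodType CC).
Implicit Types (O : 'I_n -> V -> V) (a : 'X_{1..n}) (u : V).

Definition lin_op (f : V -> V) := forall k u w, f (k *: u + w) = k *: f u + f w.

Lemma lin_op0 f : lin_op f -> f 0 = 0.
Proof. move=> fl; have := fl (-1) 0 0; rewrite scaler0 addr0 scaleN1r addNr; exact. Qed.

Lemma lin_opZ f k u : lin_op f -> f (k *: u) = k *: f u.
Proof. by move=> fl; rewrite -[k *: u]addr0 fl lin_op0 // addr0. Qed.

Lemma lin_opD f u w : lin_op f -> f (u + w) = f u + f w.
Proof. by move=> fl; rewrite -[u]scale1r fl !scale1r. Qed.

Lemma lin_op_iter f k : lin_op f -> lin_op (iter k f).
Proof. by move=> fl; elim: k => [|k IH] c u w //=; rewrite IH fl. Qed.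

Definition wordop O (r : seq 'I_n) a u := foldr (fun j w => iter (a j) (O j) w) u r.
Definition opm O a u := wordop O (index_enum 'I_n) a u.

Lemma wordop_lin O r a : (forall j, lin_op (O j)) -> lin_op (wordop O r a).
Proof. by move=> Ol; elim: r => [|j r IH] k u w //=; rewrite IH lin_op_iter. Qed.

Lemma opm_lin O a : (forall j, lin_op (O j)) -> lin_op (opm O a).
Proof. exact: wordop_lin. Qed.

Lemma opm0 O u : opm O 0%MM u = u.
Proof. by rewrite /opm; elim: (index_enum _) => //= j r ->; rewrite mnmE. Qed.

Lemma iter_comm (f g : V -> V) k u : (forall w, f (g w) = g (f w)) ->
  f (iter k g u) = iter k g (f u).
Proof. by move=> fg; elim: k => //= k IH; rewrite fg IH. Qed.

Lemma opmS O j a u : (forall i k w, O i (O k w) = O k (O i w)) ->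
  opm O (U_(j) + a)%MM u = O j (opm O a u).
Proof.
move=> Oc; rewrite /opm.
have : count_mem j (index_enum 'I_n) = 1%N by rewrite count_uniq_mem ?index_enum_uniq ?mem_index_enum.
suff H r : wordop O r (U_(j) + a)%MM u = iter (count_mem j r) (O j) (wordop O r a u).
  by rewrite H => ->.
elim: r => //= i r ->; rewrite mnmDE mnm1E eq_sym.
case: eqVneq => [->|ij] /=.
  rewrite !add0n; congr (O j _); elim: (a j) => //= k ->.
  exact: iter_comm.
by rewrite !add0n; elim: (a i) => //= k ->; rewrite iter_comm.
Qed.

Lemma mnm_ind (P : 'X_{1..n} -> Prop) : P 0%MM -> (forall j a, P a -> P (U_(j) + a)%MM) ->
  forall a, P a.
Proof.
move=> P0 PS a; have [k kE] := ubnP (mdeg a); elim: k => // k IH in a kE *.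
have [->//|a0] := eqVneq a 0%MM.
have [j aj] : exists j, a j != 0%N.
  apply/existsP; rewrite -negb_forall; apply: contra a0 => /forallP H.
  by apply/eqP/mnmP => j; rewrite mnmE; apply/eqP.
have aE : a = (U_(j) + (a - U_(j)))%MM.
  by rewrite addmC submK //; apply/mnm_lepP => i; rewrite mnm1E; case: eqP => // <-; rewrite lt0n.
rewrite aE; apply: PS; apply: IH; move: kE; rewrite [in X in X -> _]aE mdegD mdeg1 add1n ltnS.
exact.
Qed.

End Words.

Lemma subm_self n (b : 'X_{1..n}) : (b - b)%MM = 0%MM.
Proof. by rewrite -{1}[b]add0m addmK. Qed.

Section WeylModule.
Variable n : nat.

Lemma xpartD (m1 m2 : 'X_{1..n + n}) : xpart (m1 + m2)%MM = (xpart m1 + xpart m2)%MM.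
Proof. by apply/mnmP => j; rewrite !mnmE. Qed.
Lemma dpartD (m1 m2 : 'X_{1..n + n}) : dpart (m1 + m2)%MM = (dpart m1 + dpart m2)%MM.
Proof. by apply/mnmP => j; rewrite !mnmE. Qed.
Lemma xpartB (m1 m2 : 'X_{1..n + n}) : xpart (m1 - m2)%MM = (xpart m1 - xpart m2)%MM.
Proof. by apply/mnmP => j; rewrite !mnmE. Qed.
Lemma dpartB (m1 m2 : 'X_{1..n + n}) : dpart (m1 - m2)%MM = (dpart m1 - dpart m2)%MM.
Proof. by apply/mnmP => j; rewrite !mnmE. Qed.
Lemma xpartU (j : 'I_n) : xpart U_(lshift n j)%MM = U_(j)%MM.
Proof. by apply/mnmP => i; rewrite !mnmE (inj_eq (@lshift_inj _ _)). Qed.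
Lemma dpartU (j : 'I_n) : dpart U_(rshift n j)%MM = U_(j)%MM.
Proof. by apply/mnmP => i; rewrite !mnmE (inj_eq (@rshift_inj _ _)). Qed.
Lemma xpartUr (j : 'I_n) : xpart U_(rshift n j)%MM = 0%MM.
Proof. by apply/mnmP => i; rewrite !mnmE eq_rlshift. Qed.
Lemma dpartUl (j : 'I_n) : dpart U_(lshift n j)%MM = 0%MM.
Proof. by apply/mnmP => i; rewrite !mnmE eq_lrshift. Qed.

Lemma xdpart_inj (m1 m2 : 'X_{1..n + n}) : xpart m1 = xpart m2 -> dpart m1 = dpart m2 -> m1 = m2.
Proof.
move=> /mnmP xE /mnmP dE; apply/mnmP => i.
by case: (split_ordP i) => j ->; [have := xE j|have := dE j]; rewrite !mnmE.
Qed.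

(** Modules are given by operators satisfying the Weyl relations, which avoids constructing the
    algebra itself. *)
Record weyl (V : lmodType CC) (X D : 'I_n -> V -> V) : Prop := Weyl {
  weyl_Xl : forall j, lin_op (X j);
  weyl_Dl : forall j, lin_op (D j);
  weyl_XX : forall i j u, X i (X j u) = X j (X i u);
  weyl_DD : forall i j u, D i (D j u) = D j (D i u);
  weyl_DX : forall i j u, D i (X j u) = X j (D i u) + (i == j)%:R *: u }.

Definition act (V : lmodType CC) (X D : 'I_n -> V -> V) (P : Dpoly n) (u : V) :=
  linext (fun m => opm X (xpart m) (opm D (dpart m) u)) P.

(* Left multiplication by x_j and d_j on normally ordered expressions. *)
Definition regX (j : 'I_n) (P : Dpoly n) : Dpoly n := 'X_(lshift n j) * P.
Definition regD (j : 'I_n) (P : Dpoly n) : Dpoly n :=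
  'X_(rshift n j) * P + mderiv (lshift n j) P.

Section Act.
Variables (V : lmodType CC) (X D : 'I_n -> V -> V).
Hypothesis W : weyl X D.

Lemma D_opmX j a u : D j (opm X a u) = opm X a (D j u) + (a j)%:R *: opm X (a - U_(j))%MM u.
Proof.
elim/mnm_ind: a => [|i a IH]; first by rewrite !opm0 mnmE scale0r addr0.
rewrite opmS; last exact: weyl_XX W.
rewrite (weyl_DX W) IH (lin_opD _ _ (weyl_Xl W i)) (lin_opZ _ _ (weyl_Xl W i)).
rewrite opmS; last exact: weyl_XX W.
rewrite -addrA; congr (_ + _); rewrite mnmDE mnm1E eq_sym.
have [<-|ij] := eqVneq i j.
  have -> : (U_(i) + a - U_(i))%MM = a by rewrite addmC addmK.
  rewrite add1n -natr1 scalerDl; congr (_ + _).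
  have [a0|a0] := posnP (a i); first by rewrite a0 !scale0r.
  rewrite -opmS; last exact: weyl_XX W.
  rewrite addmC submK //; apply/mnm_lepP => k; rewrite mnm1E; case: eqP => // <-.
  exact: a0.
rewrite add0n scale0r addr0 -opmS; last exact: weyl_XX W.
congr (_ *: opm _ _ _); apply/mnmP => k; rewrite !mnmE.
have [<-|ki] := eqVneq i k; last by rewrite !add0n.
by rewrite eq_sym (negPf ij) !subn0.
Qed.

Lemma act_lin u k P Q : act X D (k *: P + Q) u = k *: act X D P u + act X D Q u.
Proof. exact: linextD. Qed.

Lemma act_regX j P u : act X D (regX j P) u = X j (act X D P u).
Proof.
move: P; apply: linext_eq => [k P Q|k P Q|m].
- by rewrite /regX mulrDr -scalerAr act_lin.
- by rewrite act_lin (weyl_Xl W).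
rewrite /regX -mpolyXD /act !linextX xpartD dpartD xpartU dpartUl add0m opmS //.
exact: weyl_XX W.
Qed.

Lemma act_regD j P u : act X D (regD j P) u = D j (act X D P u).
Proof.
move: P; apply: linext_eq => [k P Q|k P Q|m].
- rewrite -act_lin; congr act; rewrite /regD mulrDr -scalerAr mderivD mderivZ scalerDr.
  by rewrite -!addrA; congr (_ + _); rewrite addrCA.
- by rewrite act_lin (weyl_Dl W).
rewrite /regD -mpolyXD mderivX /act linextDD -scaler_nat linextZ !linextX.
rewrite !xpartD !dpartD xpartUr dpartU add0m opmS; last exact: weyl_DD W.
rewrite xpartB dpartB xpartU dpartUl D_opmX; congr (_ + _ *: _).
  by rewrite mnmE -[RHS]mulr1.
by congr (opm X _ (opm D _ u)); apply/mnmP => i; rewrite !mnmE subn0.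
Qed.

End Act.

Lemma act_morph (V1 V2 : lmodType CC) (X1 D1 : 'I_n -> V1 -> V1) (X2 D2 : 'I_n -> V2 -> V2)
  (phi : V1 -> V2) Q u : (forall k u w, phi (k *: u + w) = k *: phi u + phi w) ->
  (forall j u, phi (X1 j u) = X2 j (phi u)) -> (forall j u, phi (D1 j u) = D2 j (phi u)) ->
  phi (act X1 D1 Q u) = act X2 D2 Q (phi u).
Proof.
move=> pl pX pD.
have popm (O1 : 'I_n -> V1 -> V1) (O2 : 'I_n -> V2 -> V2) a w :
    (forall j u, phi (O1 j u) = O2 j (phi u)) -> phi (opm O1 a w) = opm O2 a (phi w).
  move=> pO; rewrite /opm; elim: (index_enum _) => //= j r <-.
  by elim: (a j) => //= k IH; rewrite pO IH.
move: Q; apply: linext_eq => [k P Q|k P Q|m].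
- by rewrite act_lin pl.
- by rewrite act_lin.
by rewrite /act !linextX (popm X1 X2) // (popm D1 D2).
Qed.

(** [act regX regD Q P] is the normally ordered product of [Q] and [P], since [P |-> act X D P u]
    intertwines left multiplication with the action on [V]. *)
Lemma act_act (V : lmodType CC) (X D : 'I_n -> V -> V) (W : weyl X D) Q P u :
  act X D (act regX regD Q P) u = act X D Q (act X D P u).
Proof.
apply: (act_morph (phi := fun P => act X D P u)) => [k P1 P2|j P1|j P1].
- exact: act_lin.
- exact: act_regX.
- exact: act_regD.
Qed.

Definition polX (j : 'I_n) (f : {mpoly CC[n]}) := 'X_j * f.
Definition polD (j : 'I_n) (f : {mpoly CC[n]}) := mderiv j f.

Lemma weyl_pol : weyl polX polD.
Proof.
split=> [j k u w|j k u w|i j u|i j u|i j u].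
- by rewrite /polX mulrDr -scalerAr.
- by rewrite /polD mderivD mderivZ.
- by rewrite /polX mulrCA.
- exact: mderiv_comm.
rewrite /polD /polX mderivM mderivX mnm1E addrC eq_sym; congr (_ + _).
case: eqVneq => [->|_]; last by rewrite !scale0r mul0r.
by rewrite !scale1r subm_self mpolyX0 mul1r.
Qed.

Lemma Dact_act P f : Dact P f = act polX polD P f.
Proof.
rewrite /act /linext; apply: eq_bigr => m _; congr (_ *: _).
have -> w a : opm polX a w = 'X_[a] * w.
  elim/mnm_ind: a => [|j a IH]; first by rewrite opm0 mpolyX0 mul1r.
  rewrite opmS; last by move=> i k v; rewrite /polX mulrCA.
  by rewrite IH /polX mpolyXD mulrA.
congr (_ * _); elim/mnm_ind: (dpart m) => [|j a IH].
  by rewrite opm0 mderivm0m.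
by rewrite opmS -?IH /polD => [|i k v]; [rewrite addmC mderivmDm mderivmU1m|exact: mderiv_comm].
Qed.

(** Apply [P] to [x^b], where [b] is a [dpart] of least degree in the support. Any other term kills
    [x^b] or has the same [dpart], and then a different power of [x] separates it. *)
Lemma Dact_faithful (P : Dpoly n) : (forall f, Dact P f = 0) -> P = 0.
Proof.
move=> H; apply/eqP; rewrite -msupp_eq0; apply: contraT => Pn0.
have [m0 m0P] : exists m0, m0 \in msupp P by case: (msupp P) Pn0 => // m0 s _; exists m0; exact: mem_head.
pose Q k := has (fun m => mdeg (dpart m) == k) (msupp P).
have exk : exists k, Q k.
  by exists (mdeg (dpart m0)); apply/hasP; exists m0.
case: (ex_minnP exk) => k /hasP[m mP /eqP mk] kmin.
pose b := dpart m.
have := congr1 (fun p : {mpoly CC[n]} => p@_(xpart m)) (H 'X_[b]).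
rewrite /Dact raddf_sum mcoeff0 /= (bigD1_seq m) ?msupp_uniq //= big1_seq ?addr0.
  rewrite mcoeffZ mderivmX -/b subm_self mpolyX0.
  rewrite -scalerAr mulr1 mcoeffZ mcoeffX eqxx mulr1 => /eqP.
  rewrite mulf_eq0 mcoeff_eq0 mP /= pnatr_eq0 => /eqP e0.
  have : (0 < \prod_(i < n) b i ^_ b i)%N.
    by apply: prodn_gt0 => i; rewrite ffactnn fact_gt0.
  by rewrite e0.
move=> m' /andP[m'm m'P]; rewrite mderivmX.
have [le|nle] := boolP (dpart m' <= b)%MM; last first.
  have -> : (\prod_(i < n) b i ^_ dpart m' i)%N = 0%N.
    have [i lt] : exists i, ~~ (dpart m' i <= b i)%N.
      by apply/existsP; rewrite -negb_forall; apply: contra nle => /forallP ?; apply/mnm_lepP.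
    by rewrite (bigD1 i) //= ffact_small ?mul0n // ltnNge.
  by rewrite scale0r mulr0 scaler0 mcoeff0.
have bE : dpart m' = b.
  have kle : (mdeg b <= mdeg (dpart m'))%N.
    by rewrite /b mk; apply: kmin; apply/hasP; exists m'.
  have : mdeg (b - dpart m')%MM = 0%N.
    by apply/eqP; rewrite -leqn0 -(leq_add2l (mdeg (dpart m'))) -mdegD addmC submK // addn0.
  by move/eqP; rewrite mdeg_eq0 => /eqP e0; rewrite -[b](submK le) e0 add0m.
rewrite bE subm_self mpolyX0 -scalerAr mulr1 !mcoeffZ mcoeffX.
case: eqP => [e|_]; last by rewrite !mulr0.
by case/eqP: m'm; apply: xdpart_inj.
Qed.

Lemma act_sum (V : lmodType CC) (X D : 'I_n -> V -> V) (I : Type) (r : seq I)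
    (G : I -> Dpoly n) u :
  act X D (\sum_(i <- r) G i) u = \sum_(i <- r) act X D (G i) u.
Proof. exact: linext_sum. Qed.

Lemma act_sub (V : lmodType CC) (X D : 'I_n -> V -> V) (P Q : Dpoly n) u :
  act X D (P - Q) u = act X D P u - act X D Q u.
Proof. exact: linextB. Qed.

Lemma act_opm0 (V : lmodType CC) (X D : 'I_n -> V -> V) m u :
  act X D 'X_[m] u = opm X (xpart m) (opm D (dpart m) u).
Proof. exact: linextX. Qed.

(** Membership in the ideal is expressed by operators on polynomials; faithfulness turns it into an
    identity of normally ordered expressions, which holds in every module. *)
Theorem weyl_transfer (V : lmodType CC) (X D : 'I_n -> V -> V) (W : weyl X D)
    (P : Dpoly n) (s : seq (Dpoly n * Dpoly n)) u :
  (forall f, Dact P f = \sum_(q <- s) Dact q.1 (Dact q.2 f)) ->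
  act X D P u = \sum_(q <- s) act X D q.1 (act X D q.2 u).
Proof.
move=> H.
have -> : P = \sum_(q <- s) act regX regD q.1 q.2.
  apply/eqP; rewrite -subr_eq0; apply/eqP/Dact_faithful => f.
  rewrite Dact_act act_sub -Dact_act H act_sum.
  apply/eqP; rewrite subr_eq0; apply/eqP/eq_bigr => q _.
  by rewrite (act_act weyl_pol) -!Dact_act.
by rewrite act_sum; apply: eq_bigr => q _; rewrite act_act.
Qed.

End WeylModule.

Lemma fctZD (T : Type) (k : CC) (u w : T -> CC) e : (k *: u + w) e = k * u e + w e.
Proof. by []. Qed.

Ltac vec := apply/rowP => ?; rewrite !mxE; ring.

(** * Formal sums over a lattice as a module over the Weyl algebra *)

Section LatticeModule.
Variables (n N : nat).
Local Notation I := 'rV[int]_N.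
Variables (un al : 'I_n -> I) (en lk : 'I_n -> I -> CC)
  (e0 th0 : 'I_n -> CC) (B : 'I_n -> 'I_n -> CC) (rho : {set 'I_n}) (V : pred 'I_n).
Hypotheses (enD : forall j g h, en j (g + h) = en j g + en j h)
  (lkD : forall j g h, lk j (g + h) = lk j g + lk j h)
  (en_un : forall j k, en j (un k) = (j == k)%:R) (en_al : forall j k, en j (al k) = 0)
  (lk_un : forall j k, lk j (un k) = 0) (lk_al : forall j k, j \in rho -> lk j (al k) = B j k)
  (B_dual : forall j k, j \in rho -> k \in rho -> B j k = (j == k)%:R).

(* The module of formal sums of the functions exp(sum_{j in V} x_j t^{a_j}) x^e t^g,
   stored as their coefficient families: d_k acts as t^{a_k} for k in rho. *)
Definition latX (j : 'I_n) (c : I -> CC) : I -> CC := fun e =>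
  if j \in rho then - ((th0 j + lk j e) * c (e + al j) +
     \sum_(k | V k && (k \notin rho)) B j k * c (e - (un k + al k - al j)))
  else c (e - un j).

Definition latD (j : 'I_n) (c : I -> CC) : I -> CC := fun e =>
  if j \in rho then c (e - al j)
  else (e0 j + en j e + 1) * c (e + un j) + (V j)%:R * c (e - al j).

Let enN j g : en j (- g) = - en j g.
Proof.
have z : en j 0 = 0 by apply: (addrI (en j 0)); rewrite -enD !addr0.
by apply/eqP; rewrite -addr_eq0 -enD addNr z.
Qed.
Let lkN j g : lk j (- g) = - lk j g.
Proof.
have z : lk j 0 = 0 by apply: (addrI (lk j 0)); rewrite -lkD !addr0.
by apply/eqP; rewrite -addr_eq0 -lkD addNr z.
Qed.

Lemma latX_lin j : lin_op (latX j).
Proof.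
move=> k u w; apply/funext => e; rewrite fctZD /latX; case: ifP => // _.
under eq_bigr do rewrite fctZD mulrDr mulrCA.
rewrite fctZD big_split -mulr_sumr /=; ring.
Qed.

Lemma latD_lin j : lin_op (latD j).
Proof.
move=> k u w; apply/funext => e; rewrite fctZD /latD; case: ifP => // _.
rewrite !fctZD; ring.
Qed.

Let latXr j c e : j \in rho -> latX j c e = - ((th0 j + lk j e) * c (e + al j) +
     \sum_(k | V k && (k \notin rho)) B j k * c (e - (un k + al k - al j))).
Proof. by rewrite /latX => ->. Qed.
Let latXn j c e : j \notin rho -> latX j c e = c (e - un j).
Proof. by rewrite /latX => /negPf->. Qed.
Let latDr j c e : j \in rho -> latD j c e = c (e - al j).
Proof. by rewrite /latD => ->. Qed.
Let latDn j c e : j \notin rho ->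
  latD j c e = (e0 j + en j e + 1) * c (e + un j) + (V j)%:R * c (e - al j).
Proof. by rewrite /latD => /negPf->. Qed.

Let XXrn i j c : i \in rho -> j \notin rho -> latX i (latX j c) = latX j (latX i c).
Proof.
move=> ir jr; apply/funext => e; rewrite latXr // !(latXn _ _ jr) latXr //.
rewrite lkD lkN lk_un oppr0 addr0; congr (- (_ * c _ + _)); first by rewrite addrAC.
by apply: eq_bigr => k _; rewrite latXn // addrAC.
Qed.

(** The expansion is symmetric in [i] and [j], so the two operators commute. It uses [B j i = 0], by
    which the shift by [al i] leaves [lk j] unchanged. *)
Let XXrr i j c e : i != j -> i \in rho -> j \in rho ->
  latX i (latX j c) e =
  (th0 i + lk i e) * (th0 j + lk j e) * c (e + (al i + al j))
  + \sum_(k | V k && (k \notin rho)) ((th0 i + lk i e) * B j k + (th0 j + lk j e) * B i k - B i k * B j k)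
       * c (e - (un k + al k - (al i + al j)))
  + \sum_(k | V k && (k \notin rho)) \sum_(k' | V k' && (k' \notin rho)) B i k * B j k'
       * c (e - (un k + al k + (un k' + al k') - (al i + al j))).
Proof.
move=> ij ir jr; have Bji : B j i = 0 by rewrite B_dual // eq_sym (negPf ij).
rewrite latXr //.
under eq_bigr do rewrite (latXr _ _ jr).
rewrite (latXr _ (e + al i) jr).
rewrite lkD (lk_al _ jr) Bji addr0.
rewrite mulrN opprD opprK mulrDr -!addrA; congr (_ + _).
  by rewrite mulrA addrA.
rewrite mulr_sumr -sumrN.
rewrite [in RHS](eq_bigr (fun k => (th0 i + lk i e) * (B j k * c (e + al i - (un k + al k - al j))) +
  B i k * ((th0 j + lk j e - B j k) * c (e - (un k + al k - al i) + al j)))); last first.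
  move=> k _.
  have -> : e + al i - (un k + al k - al j) = e - (un k + al k - (al i + al j)).
    by vec.
  have -> : e - (un k + al k - al i) + al j = e - (un k + al k - (al i + al j)).
    by vec.
  ring.
rewrite big_split /= -addrA; congr (_ + _); rewrite -big_split; apply: eq_bigr => k _ /=.
rewrite !(lkD, lkN) lk_un !(lk_al _ jr) Bji.
rewrite mulrN opprK mulrDr; congr (_ + _); first by congr (_ * (_ * _)); ring.
rewrite mulr_sumr; apply: eq_bigr => k' _; rewrite mulrA; congr (_ * c _).
by vec.
Qed.

(** For [j] in [rho], [latX] comes from setting a total derivative in the direction dual to [al j]
    to zero and solving for [x_j]. The Weyl relation holds because [lk j] changes by [B j j = 1]
    under [al j]; for [D i] with [i] outside [rho], the change of [lk j] under [al i] cancels the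
    derivative of the [i]-th summand. *)
Lemma lat_weyl : weyl latX latD.
Proof.
split=> [j|j|i j u|i j u|i j u]; [exact: latX_lin|exact: latD_lin|..].
- have [->//|ij] := eqVneq i j.
  have [ir|ir] := boolP (i \in rho); have [jr|jr] := boolP (j \in rho).
  + apply/funext => e; have ji : j != i by rewrite eq_sym.
    rewrite (XXrr _ _ ij ir jr) (XXrr _ _ ji jr ir) [al j + al i]addrC; congr (_ + _ + _).
    * by rewrite [X in X * _]mulrC.
    * apply: eq_bigr => k _; congr (_ * _); ring.
    * rewrite exchange_big; apply: eq_bigr => k _; apply: eq_bigr => k' _.
      by rewrite [B i _ * _]mulrC [un k + _ + _]addrC.
  + exact: XXrn.
  + by rewrite (XXrn _ jr ir).
  + by apply/funext => e; rewrite !latXn // addrAC.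
- have [ir|ir] := boolP (i \in rho); have [jr|jr] := boolP (j \in rho); apply/funext => e.
  + by rewrite !latDr // addrAC.
  + rewrite !(latDr _ _ ir) !(latDn _ _ jr) !(latDr _ _ ir) enD enN en_al subr0.
    by congr (_ * u _ + _ * u _); vec.
  + rewrite !(latDr _ _ jr) !(latDn _ _ ir) !(latDr _ _ jr) enD enN en_al subr0.
    by congr (_ * u _ + _ * u _); vec.
  + have [->//|ij] := eqVneq i j.
    rewrite !latDn // !enD !enN !en_un !en_al [j == i]eq_sym (negPf ij) !addr0 !oppr0 !addr0.
    rewrite [e + un i + un j]addrAC [e - al i + _]addrAC [e + un i - al j]addrAC [e - al i - _]addrAC.
    ring.
apply/funext => e; rewrite addrC fctZD addrC.
have [ir|ir] := boolP (i \in rho); have [jr|jr] := boolP (j \in rho).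
- rewrite latDr // !latXr // lkD lkN lk_al // (B_dual jr ir) eq_sym.
  rewrite latDr // [e - al i + _]addrAC.
  rewrite [X in _ = - (_ + X) + _](eq_bigr (fun k => B j k * u (e - al i - (un k + al k - al j)))); last first.
    by move=> k _; rewrite latDr // addrAC.
  have [->|_] := eqVneq i j; rewrite /GRing.scale /=; last by ring.
  rewrite addrK; ring.
- have -> : (i == j) = false by apply: contraNF jr => /eqP <-.
  by rewrite latDr // !latXn // latDr // mul0r addr0 addrAC.
- have -> : (i == j) = false by apply: contraNF ir => /eqP ->.
  rewrite mul0r addr0 latDn // !latXr // lkD lk_un addr0 latDn // enD en_al addr0.
  rewrite lkD lkN lk_al //.
  have H1 : \sum_(k | V k && (k \notin rho)) B j k * latD i u (e - (un k + al k - al j)) =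
    (e0 i + en i e + 1) * (\sum_(k | V k && (k \notin rho)) B j k * u (e + un i - (un k + al k - al j)))
    + (V i)%:R * (\sum_(k | V k && (k \notin rho)) B j k * u (e - al i - (un k + al k - al j)))
    - (V i)%:R * B j i * u (e - al i + al j).
    rewrite !mulr_sumr -big_split /=.
    rewrite (eq_bigr (fun k => ((e0 i + en i e + 1) * (B j k * u (e + un i - (un k + al k - al j))) +
       (V i)%:R * (B j k * u (e - al i - (un k + al k - al j)))) - (i == k)%:R * B j k * u (e - (un k + al k - al j) + un i))); last first.
      move=> k _; rewrite latDn // !enD enN !enD enN en_un !en_al.
      rewrite [e - al i - _]addrAC [e + un i - _]addrAC; ring.
    rewrite sumrB; congr (_ - _).
    have [Vi|Vi] := boolP (V i).
      rewrite (bigD1 i) /= ?Vi // eqxx big1 ?addr0 => [|k /andP[_ ki]].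
        have -> : e - (un i + al i - al j) + un i = e - al i + al j by vec.
        by rewrite ?Vi.
      by rewrite eq_sym (negPf ki) !mul0r.
    rewrite big1 ?mul0r // => k /andP[Vk _].
    by case: eqP => [ik|_]; [rewrite ik Vk in Vi|rewrite !mul0r].
  rewrite H1 [e + un i + al j]addrAC [e - al i + al j]addrAC; ring.
- rewrite latDn // !latXn // latDn // enD enN en_un [e + un i - _]addrAC [e - al i - _]addrAC.
  have [->|_] := eqVneq i j; last by rewrite subr0 mul0r addr0.
  rewrite subrK; ring.
Qed.
End LatticeModule.

(** * Gamma series *)

(* Reciprocal Gamma values along e0 + Z, renormalised where 1 / Gamma vanishes. *)
Lemma gamma_ratio (e0 : CC) : exists g : int -> CC, forall z : int,
  g z != 0 /\ (e0 + z%:~R + 1 != 0 -> (e0 + z%:~R + 1) * g (z + 1) = g z).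
Proof.
pose f (z : int) : CC := if e0 + z%:~R + 1 == 0 then 1 else e0 + z%:~R + 1.
have f0 z : f z != 0 by rewrite /f; case: ifP => [_|/negbT//]; exact: oner_neq0.
pose g (z : int) : CC := match z with
  | Posz k => \prod_(i < k) (f i)^-1
  | Negz k => \prod_(i < k.+1) f (- (i.+1)%:Z) end.
exists g => z; split.
  by case: z => k; apply/prodf_neq0 => i _; rewrite ?invr_eq0 f0.
move=> z0; have <- : f z = e0 + z%:~R + 1 by rewrite /f (negPf z0).
case: z {z0} => k; rewrite /g.
  by rewrite -PoszD addn1 big_ord_recr /= mulrCA divff // mulr1.
have -> : Negz k + 1 = - (k%:Z) by rewrite NegzE -addn1 PoszD opprD subrK.
rewrite [RHS]big_ord_recr /= NegzE mulrC; congr (_ * _).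
case: k => [|k]; first by rewrite [RHS]big_ord0 [LHS]big_ord0.
by rewrite -NegzE.
Qed.

Section Series.
Variables (d n : nat) (A : 'M[int]_(d, n)) (beta : 'I_d -> CC).
Definition acol (j : 'I_n) (i : 'I_d) : rat := (A i j)%:~R.
Variables (rho s2 : {set 'I_n}) (l : 'I_n -> 'I_d -> rat).
Hypothesis hdisj : forall k, k \in s2 -> k \notin rho.
Hypothesis hdual : forall k k', k \in rho :|: s2 -> k' \in rho :|: s2 ->
  dotp (acol k') (l k) = (k == k')%:R.
Hypothesis hbasis : forall (x : 'I_d -> rat) i,
  x i = \sum_(k in rho :|: s2) dotp x (l k) * acol k i.
Notation V := (inV acol s2 l).
Notation I := 'rV[int]_(n + d).

(* A row (e, g) encodes the exponents of x^e t^g. *)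
Definition colv (j : 'I_n) : 'rV[int]_d := \row_i A i j.
Definition un (j : 'I_n) : I := row_mx (delta_mx 0 j) 0.
Definition al (j : 'I_n) : I := row_mx 0 (colv j).
Definition xc (j : 'I_n) (g : I) : int := lsubmx g 0 j.
Definition tlv (k : 'I_n) (w : 'rV[int]_d) : rat := \sum_i (w 0 i)%:~R * l k i.
Definition en (j : 'I_n) (g : I) : CC := (xc j g)%:~R.
Definition lk (k : 'I_n) (g : I) : CC := ratr (tlv k (rsubmx g)).
Definition BB (j k : 'I_n) : CC := ratr (dotp (acol k) (l j)).
Definition bb (k : 'I_n) : CC := \sum_i beta i * ratr (l k i).
(** In the basis [rho :|: s2], the [s2] coordinates of [beta] shift the exponents of [x], and minus
    the [rho] coordinates ([th0]) shift those of [t]. *)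
Definition e0 (j : 'I_n) : CC := if j \in s2 then bb j else 0.
Definition th0 (j : 'I_n) : CC := - bb j.
Definition serX := @latX n (n + d) un al lk th0 BB rho V.
Definition serD := @latD n (n + d) un al en e0 rho V.

Lemma xcD j g h : xc j (g + h) = xc j g + xc j h. Proof. by rewrite /xc !mxE. Qed.
Lemma xcN j g : xc j (- g) = - xc j g. Proof. by rewrite /xc !mxE. Qed.
Lemma xc_un j k : xc j (un k) = (j == k)%:R.
Proof. by rewrite /xc /un row_mxKl mxE eqxx. Qed.
Lemma xc_al j k : xc j (al k) = 0.
Proof. by rewrite /xc /al row_mxKl mxE. Qed.
Lemma rsubD (g h : I) : rsubmx (g + h) = rsubmx g + rsubmx h.
Proof. exact: raddfD. Qed.
Lemma rsubN (g : I) : rsubmx (- g) = - rsubmx g.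
Proof. exact: raddfN. Qed.
Lemma rsub_un j : rsubmx (un j) = 0. Proof. exact: row_mxKr. Qed.
Lemma rsub_al j : rsubmx (al j) = colv j. Proof. exact: row_mxKr. Qed.
Lemma tlvD k w w' : tlv k (w + w') = tlv k w + tlv k w'.
Proof.
by rewrite /tlv -big_split; apply: eq_bigr => i _; rewrite mxE intrD mulrDl.
Qed.
Lemma tlv0 k : tlv k 0 = 0.
Proof. by rewrite /tlv big1 // => i _; rewrite mxE mul0r. Qed.
Lemma tlvZ k z w : tlv k (z *: w) = z%:~R * tlv k w.
Proof.
by rewrite /tlv mulr_sumr; apply: eq_bigr => i _; rewrite mxE intrM mulrA.
Qed.
Lemma tlv_sum k (J : Type) (r : seq J) (P : pred J) F :
  tlv k (\sum_(j <- r | P j) F j) = \sum_(j <- r | P j) tlv k (F j).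
Proof.
elim: r => [|j r IH]; first by rewrite !big_nil tlv0.
by rewrite !big_cons; case: ifP; rewrite ?tlvD IH.
Qed.
Lemma tlv_col k j : tlv k (colv j) = dotp (acol j) (l k).
Proof. by apply: eq_bigr => i _; rewrite mxE. Qed.

Lemma ser_weyl : weyl serX serD.
Proof.
apply: lat_weyl => [j g h|j g h|j k|j k|j k|j k _|j k jr kr].
- by rewrite /en xcD intrD.
- by rewrite /lk rsubD tlvD rmorphD.
- by rewrite /en xc_un; case: eqP.
- by rewrite /en xc_al.
- by rewrite /lk rsub_un tlv0 rmorph0.
- by rewrite /lk rsub_al tlv_col.
- by rewrite /BB hdual ?in_setU ?jr ?kr //; case: eqP => _; rewrite ?rmorph1 ?rmorph0.
Qed.

Lemma V_dual j k : V j -> k \in s2 -> dotp (acol j) (l k) = 0.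
Proof. by move=> /forall_inP H /H /eqP. Qed.

Lemma rho_V j : j \in rho -> V j.
Proof.
move=> jr; apply/forall_inP => k ks; rewrite hdual ?in_setU ?jr ?ks ?orbT //.
by have [kj|//] := eqVneq k j; have := hdisj ks; rewrite kj jr.
Qed.

Lemma s2_V j : j \in s2 -> ~~ V j.
Proof.
move=> js; apply/forall_inPn; exists j => //.
by rewrite hdual ?in_setU ?js ?orbT // eqxx oner_neq0.
Qed.

Definition neg j (z : int) := `[< exists m : int, e0 j + z%:~R = m%:~R /\ (m < 0) >].
Definition nsupp (g : I) := [set j | ~~ V j & neg j (xc j g)].
Definition rs (g : I) : 'rV[int]_d := \sum_j xc j g *: colv j.
(** Only variables outside [V] may occur, and the exponent [al0 + A e] of [t] has to lie in the span
    of [rho]. *)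
Definition inW (al0 : 'rV[int]_d) (g : I) :=
  [forall j, V j ==> (xc j g == 0)] && [forall k in s2, tlv k (al0 + rs g) == 0].

Lemma neg_cross j z : e0 j + z%:~R + 1 = 0 -> neg j z /\ ~~ neg j (z + 1).
Proof.
move=> e; split.
  apply/asboolP; exists (-1); split=> //; apply/eqP; rewrite -subr_eq0 intrN opprK; apply/eqP.
  exact: e.
apply/asboolPn => -[m [mE m0]]; move: mE; rewrite intrD addrA e => /esym/eqP.
by rewrite intr_eq0 => /eqP m00; rewrite m00 in m0.
Qed.

Lemma neg_step j z : e0 j + z%:~R + 1 != 0 -> neg j (z + 1) = neg j z.
Proof.
move=> e; apply/asboolP/asboolP => -[m [mE m0]].
  exists (m - 1); split; last by move: m0; lia.
  by rewrite intrB -mE intrD addrA addrK.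
exists (m + 1); split; first by rewrite !intrD addrA mE.
have : m + 1 != 0 by apply: contra e => /eqP e; rewrite mE -[1]/(1%:~R) -intrD e.
by move: m0; lia.
Qed.

Lemma neg_mono j z : neg j (z + 1) -> neg j z.
Proof.
move=> H; have [e|e] := eqVneq (e0 j + z%:~R + 1) 0; first exact: (neg_cross e).1.
by rewrite -neg_step.
Qed.

Lemma rsD g h : rs (g + h) = rs g + rs h.
Proof. by rewrite /rs -big_split; apply: eq_bigr => j _; rewrite xcD scalerDl. Qed.

Lemma rs_un j : rs (un j) = colv j.
Proof.
rewrite /rs (bigD1 j) //= xc_un eqxx scale1r big1 ?addr0 // => k /negPf kj.
by rewrite xc_un kj scale0r.
Qed.

Lemma inW_V al0 g j : V j -> inW (al0 + colv j) g = inW al0 g.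
Proof.
move=> Vj; rewrite /inW; congr (_ && _); apply: eq_forallb => k.
case: (boolP (k \in s2)) => //= ks.
by rewrite [al0 + colv j + _]addrAC (tlvD k (al0 + rs g)) tlv_col V_dual // addr0.
Qed.

Lemma inW_nV al0 g j : ~~ V j -> inW (al0 + colv j) g = inW al0 (g + un j).
Proof.
move=> Vj; rewrite /inW; congr (_ && _); apply: eq_forallb => k.
  case: (boolP (V k)) => //= Vk; rewrite xcD xc_un.
  by have [kj|_] := eqVneq k j; [rewrite -kj Vk in Vj|rewrite addr0].
by rewrite rsD rs_un addrA [al0 + _ + colv j]addrAC.
Qed.

Lemma nsupp_un g j : nsupp (g + un j) \subset nsupp g.
Proof.
apply/subsetP => k; rewrite !in_set xcD xc_un => /andP[->] /=.
by case: eqP => _; [exact: neg_mono|rewrite addr0].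
Qed.

Variable Is : {set 'I_n}.
(* Minimality of the negative support keeps the recursion for the coefficients valid where
   e0 + z + 1 vanishes. *)
Definition minI al0 := forall g, inW al0 g -> nsupp g \subset Is -> nsupp g = Is.

Lemma minI_add al0 j : minI al0 -> minI (al0 + colv j).
Proof.
move=> H g; have [Vj|Vj] := boolP (V j); first by rewrite inW_V //; exact: H.
rewrite inW_nV // => gW gI; apply/eqP; rewrite eqEsubset gI /=.
by rewrite -(H _ gW) ?nsupp_un // (subset_trans _ gI) ?nsupp_un.
Qed.

Variable gam : 'I_n -> int -> CC.
Hypothesis gamS : forall j z, e0 j + z%:~R + 1 != 0 -> (e0 j + z%:~R + 1) * gam j (z + 1) = gam j z.

Definition usupp al0 g := [&& inW al0 g, rsubmx g == al0 + rs g & nsupp g == Is].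
(** The Gamma series with terms [x^(e0 + e) t^(al0 + A e) / prod_j Gamma(e0_j + e_j + 1)], [j]
    outside [V], cut down to the exponents of negative support [Is]; [gam] plays the role of the
    reciprocal Gamma values. *)
Definition useries al0 (g : I) : CC :=
  if usupp al0 g then \prod_(j | ~~ V j) gam j (xc j g) else 0.

Lemma rho_nV j : ~~ V j -> j \notin rho.
Proof. by apply: contra; exact: rho_V. Qed.

Lemma xcV al0 g j : inW al0 g -> V j -> xc j g = 0.
Proof. by move=> /andP[/forallP /(_ j) /implyP H _] /H /eqP. Qed.

Lemma xc_unn j k g : k != j -> xc k (g + un j) = xc k g.
Proof. by move=> /negPf kj; rewrite xcD xc_un kj addr0. Qed.

Lemma xc_al' j k g : xc k (g - al j) = xc k g.
Proof. by rewrite xcD xcN xc_al subr0. Qed.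

Lemma usupp_al al0 g j : V j -> usupp al0 (g - al j) = usupp (al0 + colv j) g.
Proof.
move=> Vj; have rsE : rs (g - al j) = rs g.
  by apply: eq_bigr => k _; rewrite xc_al'.
rewrite /usupp inW_V // rsubD rsubN rsub_al rsE subr_eq addrAC; congr [&& _, _ & _].
  by rewrite /inW rsE; congr (_ && _); apply: eq_forallb => k; rewrite xc_al'.
by congr (_ == _); apply/setP => k; rewrite !in_set xc_al'.
Qed.

(** Differentiation adds column [j] to the parameter: through the factor [t^(a_j)] for [j] in [V],
    through the recursion of [gam] otherwise. *)
Lemma serD_useries al0 j : minI al0 -> serD j (useries al0) = useries (al0 + colv j).
Proof.
move=> mI; apply/funext => g.
have shift : V j -> useries al0 (g - al j) = useries (al0 + colv j) g.
  move=> Vj; rewrite /useries usupp_al //; case: ifP => // _.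
  by apply: eq_bigr => k _; rewrite xc_al'.
rewrite /serD /latD; case: ifP => [jr|jr]; first by rewrite shift // rho_V.
have [Vj|Vj] := boolP (V j).
  have js : j \notin s2 by apply/negP => /s2_V; rewrite Vj.
  rewrite shift // mul1r [X in X + _](_ : _ = 0) ?add0r //.
  rewrite /useries; case: ifP => [/and3P[gW _ _]|_]; last by rewrite mulr0.
  have := xcV gW Vj; rewrite xcD xc_un eqxx /en /e0 (negPf js) add0r => e.
  by rewrite -[1]/(1%:~R) -intrD e mul0r.
rewrite mul0r addr0 /en.
rewrite /useries /usupp inW_nV // rsubD rsub_un addr0 rsD rs_un.
rewrite (_ : al0 + colv j + rs g = al0 + (rs g + colv j)); last by rewrite [rs g + _]addrC addrA.
case: (boolP (inW al0 (g + un j))) => [gW|_]; last by rewrite mulr0.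
rewrite !andTb; case: eqP => _; last by rewrite mulr0.
rewrite !andTb.
(* Where the factor vanishes, [j] is in the negative support of [g] but not in that of [g + un j];
   by minimality [g] then does not occur on the right. *)
have [e|e] := eqVneq (e0 j + (xc j g)%:~R + 1) 0.
  rewrite e mul0r; case: eqP => // gI.
  have [n1 n2] := neg_cross e.
  have : nsupp (g + un j) = Is by apply: mI => //; rewrite -gI nsupp_un.
  by rewrite -gI => /setP /(_ j); rewrite !in_set Vj n1 xcD xc_un eqxx (negPf n2).
have -> : nsupp (g + un j) = nsupp g.
  apply/setP => k; rewrite !in_set; congr (_ && _).
  have [->|kj] := eqVneq k j; last by rewrite xc_unn.
  by rewrite xcD xc_un eqxx neg_step.
case: eqP => _; last by rewrite mulr0.
rewrite (bigD1 j) //= [RHS](bigD1 j) //= mulrA xcD xc_un eqxx gamS //; congr (_ * _).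
by apply: eq_bigr => k /andP[_ kj]; rewrite xc_unn.
Qed.

Lemma serD_opm (q : 'X_{1..n}) : minI 0 ->
  opm serD q (useries 0) = useries (\sum_j (q j)%:Z *: colv j) /\ minI (\sum_j (q j)%:Z *: colv j).
Proof.
move=> mI; elim/mnm_ind: q => [|j q [IH mq]].
  by rewrite opm0 big1 => [|j _]; [split|rewrite mnmE scale0r].
have -> : \sum_k ((U_(j) + q)%MM k)%:Z *: colv k = \sum_k (q k)%:Z *: colv k + colv j.
  rewrite addrC -[X in X + _](rs_un j) /rs -big_split; apply: eq_bigr => k _ /=.
  by rewrite -scalerDl mnmDE mnm1E xc_un eq_sym PoszD natz.
split; last exact: minI_add.
by rewrite opmS ?IH ?serD_useries //; exact: weyl_DD ser_weyl.
Qed.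

Lemma big_rho_s2 (R : zmodType) (F : 'I_n -> R) :
  \sum_(k in rho :|: s2) F k = \sum_(k in rho) F k + \sum_(k in s2) F k.
Proof.
rewrite (bigID (mem s2)) /= addrC; congr (_ + _); apply: eq_bigl => k; rewrite in_setU.
  case: (boolP (k \in s2)) => ks; rewrite ?andbF ?orbF ?andbT //.
  by rewrite (negPf (hdisj ks)).
by rewrite andb_orl andbb; case: (boolP (k \in s2)) => //= _; rewrite ?orbT ?andbF.
Qed.

Lemma hbasis_int (w : 'rV[int]_d) i :
  (w 0 i)%:~R = \sum_(k in rho :|: s2) tlv k w * (A i k)%:~R :> rat.
Proof. exact: (hbasis (fun i => (w 0 i)%:~R)). Qed.

Lemma col_V j i : V j -> (A i j)%:~R = \sum_(k in rho) BB k j * (A i k)%:~R :> CC.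
Proof.
move=> Vj; have := hbasis (acol j) i; rewrite big_rho_s2.
rewrite [X in _ + X]big1 ?addr0 => [|k ks]; last by rewrite V_dual // mul0r.
move=> /(congr1 (ratr : rat -> CC)); rewrite ratr_int rmorph_sum /= => ->.
by apply: eq_bigr => k _; rewrite rmorphM /= ratr_int.
Qed.

Lemma beta_bb i : beta i = \sum_(k in rho :|: s2) bb k * (A i k)%:~R.
Proof.
under eq_bigr do rewrite /bb mulr_suml.
rewrite exchange_big (bigD1 i) //= [X in _ + X]big1 ?addr0.
  have := hbasis (fun i' => (i' == i)%:R) i; rewrite eqxx => /(congr1 (ratr : rat -> CC)).
  rewrite rmorph1 rmorph_sum /= => e1; rewrite -[LHS]mulr1 [X in _ * X = _]e1 mulr_sumr; apply: eq_bigr => k _.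
  rewrite rmorphM /= ratr_int mulrA; congr (_ * ratr _ * _).
  by rewrite /dotp (bigD1 i) //= eqxx mul1r big1 ?addr0 // => i' /negPf->; rewrite mul0r.
move=> i' ii'; have := hbasis (fun i0 => (i0 == i')%:R) i; rewrite eq_sym (negPf ii').
move=> /(congr1 (ratr : rat -> CC)); rewrite rmorph0 rmorph_sum /= => e1.
apply/eqP; rewrite -[X in _ == X](mulr0 (beta i')) [X in _ == _ * X]e1 mulr_sumr; apply/eqP/eq_bigr => k _.
rewrite rmorphM /= ratr_int -mulrA; congr (_ * (ratr _ * _)).
rewrite /dotp (bigD1 i') //= eqxx mul1r big1 ?addr0 // => i0 /negPf->.
by rewrite mul0r.
Qed.

(** The terms from solving for [x_j], [j] in [rho], cancel by [col_V] against those of the other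
    columns of [V]. As the exponent of [t] is [A e], the integral parts cancel too, and [e0] and
    [th0] leave the two parts of [beta]. *)
Lemma euler_useries i g :
  \sum_j (A i j)%:~R * serX j (serD j (useries 0)) g = beta i * useries 0 g.
Proof.
set u := useries 0.
have XDn j : j \notin rho -> serX j (serD j u) g =
    (e0 j + en j g) * u g + (V j)%:R * u (g - (un j + al j)).
  move=> jr; rewrite /serX /serD /latX /latD (negPf jr) subrK /en xcD xcN xc_un eqxx.
  by rewrite intrB addrA subrK opprD addrA.
have XDr j : j \in rho -> serX j (serD j u) g =
    - ((th0 j + lk j g) * u g + \sum_(k | V k && (k \notin rho)) BB j k * u (g - (un k + al k))).
  move=> jr; rewrite /serX /serD /latX /latD jr addrK; congr (- (_ + _)).
  by apply: eq_bigr => k _; congr (_ * u _); vec.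
rewrite (bigID (mem rho)) /=.
rewrite (eq_bigr (fun j => - ((A i j)%:~R * (th0 j + lk j g) * u g) - \sum_(k | V k && (k \notin rho)) (A i j)%:~R * (BB j k * u (g - (un k + al k))))); last first.
  by move=> j jr; rewrite XDr // mulrN mulrDr opprD mulrA mulr_sumr.
rewrite sumrB exchange_big /=.
rewrite [X in _ - X + _](eq_bigr (fun k => (A i k)%:~R * u (g - (un k + al k)))) => [|k /andP[Vk _]]; last first.
  rewrite (col_V _ Vk) mulr_suml; apply: eq_bigr => j _; ring.
rewrite [X in _ + X](eq_bigr (fun j => (A i j)%:~R * (e0 j + en j g) * u g + (V j)%:R * ((A i j)%:~R * u (g - (un j + al j))))) => [|j jr]; last first.
  rewrite XDn //; ring.
rewrite [X in _ + X]big_split /=.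
have -> : \sum_(j | j \notin rho) (V j)%:R * ((A i j)%:~R * u (g - (un j + al j))) =
   \sum_(k | V k && (k \notin rho)) (A i k)%:~R * u (g - (un k + al k)).
  rewrite (bigID V) /= [X in _ + X]big1 ?addr0 => [|j /andP[_ /negPf->]]; last by rewrite mul0r.
  by apply: eq_big => [j|j /andP[_ ->]]; [rewrite andbC|rewrite mul1r].
rewrite addrCA subrK addrC.
rewrite /u /useries; case: ifP => [/and3P[gW /eqP gR _]|_]; last first.
  by rewrite !big1 ?addr0 ?mulr0 // => j _; rewrite !mulr0 ?oppr0.
set G := \prod_(j | _) _.
rewrite sumrN -!mulr_suml -mulNr -mulrDl; congr (_ * _); rewrite addrC.
under eq_bigr do rewrite mulrDr.
rewrite big_split /=; under [X in _ - X]eq_bigr do rewrite mulrDr.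
rewrite [X in _ - X]big_split /=.
have -> : \sum_(j | j \notin rho) (A i j)%:~R * en j g = \sum_(j in rho) (A i j)%:~R * lk j g.
  have := hbasis_int (rsubmx g) i; rewrite big_rho_s2.
  rewrite [X in _ + X]big1 ?addr0 => [|k ks]; last first.
    move: gW; rewrite /inW -gR => /andP[_ /forall_inP /(_ k ks) /eqP->].
    by rewrite mul0r.
  move=> /(congr1 (ratr : rat -> CC)); rewrite ratr_int rmorph_sum /= => e1.
  rewrite [RHS](eq_bigr (fun k => ratr (tlv k (rsubmx g) * (A i k)%:~R))); last first.
    by move=> k _; rewrite rmorphM /= ratr_int mulrC.
  rewrite -e1 gR add0r /rs summxE rmorph_sum /= [RHS](bigID (mem rho)) /= [X in _ = X + _]big1 ?add0r.
    by apply: eq_bigr => j _; rewrite !mxE rmorphM /= mulrC.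
  by move=> j jr; rewrite (xcV gW) ?rho_V // scale0r mxE.
rewrite opprD addrACA subrr addr0 beta_bb big_rho_s2.
rewrite addrC -sumrN; congr (_ + _).
  by apply: eq_bigr => k _; rewrite /th0 mulrN opprK mulrC.
rewrite [RHS](eq_bigr (fun j => (A i j)%:~R * e0 j)); last first.
  by move=> j js; rewrite /e0 js mulrC.
rewrite (bigID (mem s2)) /= [X in _ + X]big1 ?addr0.
  apply: eq_bigl => j; case: (boolP (j \in s2)) => js; rewrite ?andbF // andbT; exact: hdisj.
by move=> j /andP[_ /negPf js]; rewrite /e0 js mulr0.
Qed.

End Series.

Section Gens.
Variable n : nat.

Lemma xpart_xdmon (a b : 'X_{1..n}) : xpart (xdmon a b) = a.
Proof. by apply/mnmP => j; rewrite !mnmE (unsplitK (inl _ j)). Qed.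

Lemma dpart_xdmon (a b : 'X_{1..n}) : dpart (xdmon a b) = b.
Proof. by apply/mnmP => j; rewrite !mnmE (unsplitK (inr _ j)). Qed.

Lemma unitmE (j : 'I_n) : unitm j = U_(j)%MM.
Proof. by apply/mnmP => k; rewrite mnmE mnm1E eq_sym. Qed.

Lemma upos_uneg (u : 'I_n -> int) j : (upos u j)%:Z - (uneg u j)%:Z = u j.
Proof.
rewrite !mnmE; have [u0|u0] := lerP 0 (u j); first by rewrite gez0_abs // subr0.
by rewrite ltz0_abs // sub0r opprK.
Qed.

Lemma opm_unit (V : lmodType CC) (O : 'I_n -> V -> V) j u :
  (forall i k w, O i (O k w) = O k (O i w)) -> opm O U_(j)%MM u = O j u.
Proof. by move=> Oc; rewrite -[U_(j)%MM]addm0 opmS // opm0. Qed.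

End Gens.

Section Kill.
Variables (d n : nat) (A : 'M[int]_(d, n)) (beta : 'I_d -> CC).
Variables (rho s2 : {set 'I_n}) (l : 'I_n -> 'I_d -> rat).
Hypothesis hdisj : forall k, k \in s2 -> k \notin rho.
Hypothesis hdual : forall k k', k \in rho :|: s2 -> k' \in rho :|: s2 ->
  dotp (acol A k') (l k) = (k == k')%:R.
Hypothesis hbasis : forall (x : 'I_d -> rat) i,
  x i = \sum_(k in rho :|: s2) dotp x (l k) * acol A k i.
Notation X := (serX A beta rho s2 l).
Notation D := (serD A beta rho s2 l).
Notation minI := (minI A beta s2 l).
Notation e0 := (e0 beta s2 l).

Let W : weyl X D := ser_weyl beta hdual.

Variables (Is : {set 'I_n}) (gam : 'I_n -> int -> CC).
Hypothesis gamS : forall j z, e0 j + z%:~R + 1 != 0 -> (e0 j + z%:~R + 1) * gam j (z + 1) = gam j z.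
Hypothesis mI : minI Is 0.
Notation U := (useries A beta s2 l Is gam).

(** The two monomials of a toric generator move the parameter of the series by the same vector
    [A u_+ = A u_-]; the Euler generators are [euler_useries]. *)
Lemma HA_kill P : HA A beta P -> act X D P (U 0) = 0.
Proof.
move=> [s [sgen sP]]; rewrite (weyl_transfer W (U 0) sP) big1_seq // => q /andP[_ /sgen qg].
suff -> : act X D q.2 (U 0) = 0.
  by rewrite /act /linext big1 // => m _; rewrite (lin_op0 (opm_lin _ (weyl_Dl W)))
    (lin_op0 (opm_lin _ (weyl_Xl W))) scaler0.
case: qg => [[u [uA ->]]|[i ->]].
  rewrite /toric_gen act_sub !act_opm0 !xpart_xdmon !dpart_xdmon !opm0.
  rewrite !(serD_opm hdisj hdual gamS _ mI).1.
  apply/eqP; rewrite subr_eq0; apply/eqP; congr (U _); apply/eqP; rewrite -subr_eq0 -sumrB.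
  apply/eqP/rowP => i; rewrite summxE mxE -[RHS](uA i); apply: eq_bigr => j _.
  by rewrite -scalerBl !mxE upos_uneg mulrC.
rewrite /euler_gen act_sub act_sum -alg_mpolyC -mpolyX0.
rewrite [act _ _ (_ *: 'X_[_]) _]linextZ linextX.
have -> : xpart 0%MM = 0%MM :> 'X_{1..n} by apply/mnmP => j; rewrite !mnmE.
have -> : dpart 0%MM = 0%MM :> 'X_{1..n} by apply/mnmP => j; rewrite !mnmE.
rewrite !opm0; apply/eqP; rewrite subr_eq0; apply/eqP/funext => g.
rewrite [RHS](_ : _ = beta i * U 0 g) // -(@euler_useries d n A beta rho s2 l hdisj hdual hbasis).
rewrite fct_sumE; apply: eq_bigr => j _.
rewrite [act _ _ _ _]linextZ linextX xpart_xdmon dpart_xdmon unitmE.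
rewrite [opm X _ _]opm_unit; last exact: weyl_XX W.
by rewrite [opm D _ _]opm_unit //; exact: weyl_DD W.
Qed.
End Kill.

(** * Leading forms *)

Lemma common_denom (n : nat) (q : 'I_n -> rat) : exists N : nat, (0 < N)%N /\
  exists p : 'I_n -> int, forall j, q j * N%:R = (p j)%:~R.
Proof.
exists (\prod_j absz (denq (q j)))%N; split.
  by apply: prodn_gt0 => j; rewrite absz_gt0 denq_neq0.
exists (fun j => numq (q j) * (\prod_(k | k != j) absz (denq (q k)))%N%:Z) => j.
rewrite (bigD1 j) //= natrM intrM mulrA; congr (_ * _).
by rewrite pmulrn absz_denq numqE.
Qed.

Section Lead.
Variables (d n : nat) (A : 'M[int]_(d, n)) (beta : 'I_d -> CC).
Variables (Lx Ld : 'I_n -> rat) (c : rat) (tau rho s2 : {set 'I_n}) (v : 'I_d -> rat).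
Variables (l : 'I_n -> 'I_d -> rat) (o : 'I_n -> 'I_n) (kap : 'I_n -> nat).
Hypotheses (hc : 0 < c) (hL : forall j, Lx j + Ld j = c).
Hypothesis fr : frame (acol A) Lx c tau rho s2 v l o kap.
Notation V := (inV (acol A) s2 l).
Notation I := 'rV[int]_(n + d).
Notation un := (@un d n).
Notation al := (al A).
Notation X := (serX A beta rho s2 l).
Notation D := (serD A beta rho s2 l).
Notation BB := (BB A l).
Notation lam := (lam (acol A) Lx v).
Let hdual := fr_dual fr.
Let W : weyl X D := ser_weyl beta hdual.

Definition va j := dotp (acol A j) v.
(** The weight of [x^e t^g], such that [x_k t^(a_k)] has weight [lam k] for [k] outside [rho]. *)
Definition om (g : I) : rat :=
  \sum_(j | j \notin rho) Lx j * (xc j g)%:~R + \sum_i (rsubmx g 0 i)%:~R * v i.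

Lemma lamE j : lam j = Lx j + va j. Proof. by []. Qed.

Lemma omD g h : om (g + h) = om g + om h.
Proof.
rewrite /om addrACA -!big_split; congr (_ + _); apply: eq_bigr => j _ /=.
  by rewrite xcD intrD mulrDr.
by rewrite rsubD mxE intrD mulrDl.
Qed.

Lemma om0 : om 0 = 0.
Proof. by apply: (addrI (om 0)); rewrite -omD !addr0. Qed.

Lemma omN g : om (- g) = - om g.
Proof. by apply/eqP; rewrite -addr_eq0 -omD addNr om0. Qed.

Lemma om_un j : j \notin rho -> om (un j) = Lx j.
Proof.
move=> jr; rewrite /om [X in _ + X]big1 ?addr0 => [|i _]; last by rewrite rsub_un mxE mul0r.
rewrite (bigD1 j) //= xc_un eqxx mulr1 big1 ?addr0 // => k /andP[_ /negPf kj].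
by rewrite xc_un kj mulr0.
Qed.

Lemma om_al j : om (al j) = va j.
Proof.
rewrite /om big1 ?add0r => [|k _]; last by rewrite xc_al mulr0.
by apply: eq_bigr => i _; rewrite rsub_al mxE.
Qed.

(* The parts of X and D that raise weights by exactly L_x(j) and L_d(j). *)
Definition hX j (u : I -> CC) : I -> CC := fun g =>
  if j \in rho then - (\sum_(k | [&& V k, k \notin rho & lam k == lam j])
     BB j k * u (g - (un k + al k - al j)))
  else u (g - un j).
Definition hD j (u : I -> CC) : I -> CC := fun g => if j \in tau then u (g - al j) else 0.

(* u has weights at most N, and uh is its part of weight N. *)
Definition leads (N : rat) (u uh : I -> CC) :=
  forall g, (N < om g -> u g = 0) /\ (om g = N -> u g = uh g).

Lemma tau_V j : j \in tau -> V j.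
Proof.
rewrite (fr_tau fr) => /eqP e; apply: contraLR hc => /(fr_out fr).
by rewrite e leNgt.
Qed.

Lemma leads_ge N u uh g : leads N u uh -> N < om g -> u g = 0.
Proof. by move=> /(_ g)[]. Qed.

(** For [j] in [rho], the term with [th0] changes weights by [Lx j - lam j], less than [Lx j] as
    heights on [rho] are positive; the term of [k] changes them by [Lx j - lam j + lam k], which
    reaches [Lx j] only on the level of [j]. *)
Lemma leads_X j N u uh : leads N u uh -> leads (N + Lx j) (X j u) (hX j uh).
Proof.
move=> H g; rewrite /serX /latX /hX; case: (boolP (j \in rho)) => jr; last first.
  have := H (g - un j); rewrite omD omN om_un //.
  by rewrite ltrBrDr => -[H1 H2]; split=> [/H1//|e]; apply: H2; rewrite e addrK.
have lj := fr_pos fr jr.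
have omA : om (g + al j) = om g + va j by rewrite omD om_al.
have omk k : k \notin rho -> om (g - (un k + al k - al j)) = om g - lam k + va j.
  by move=> kr; rewrite omD omN !omD omN om_un // !om_al lamE; ring.
have z1 : N + Lx j <= om g -> u (g + al j) = 0.
  move=> le; apply: (leads_ge H); rewrite omA; move: lj le; rewrite lamE; lra.
have z2 k : N + Lx j <= om g -> V k -> k \notin rho -> (lam k != lam j) || (N + Lx j < om g) ->
    BB j k * u (g - (un k + al k - al j)) = 0.
  move=> le Vk kr lt; have [B0|B0] := eqVneq (dotp (acol A k) (l j)) 0.
    by rewrite /BB B0 rmorph0 mul0r.
  rewrite (leads_ge H) ?mulr0 // omk //.
  have := fr_rep fr Vk jr B0; move: lt le; rewrite !lamE.
  case/orP => [ne le le2|]; last by lra.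
  have : Lx k + va k < Lx j + va j by rewrite lt_neqAle ne.
  by move: le; lra.
split=> [lt|e].
  rewrite z1 ?ltW // mulr0 add0r big1 ?oppr0 // => k /andP[Vk kr].
  by rewrite z2 ?ltW // lt orbT.
rewrite z1 ?e // mulr0 add0r (bigID (fun k => lam k == lam j)) /= [X in _ + X]big1 ?addr0.
  congr (- _); apply: eq_big => [k|k /andP[/andP[_ kr] /eqP lk]]; first by rewrite andbA.
  congr (_ * _); have [_] := H (g - (un k + al k - al j)); apply.
  by rewrite omk // e lk lamE; ring.
by move=> k /andP[/andP[Vk kr] lk]; rewrite z2 ?e // lk.
Qed.

(** The factor [t^(a_j)] adds [lam j - Lx j <= Ld j], with equality on [tau]; differentiating a
    power of [x_j] adds [Ld j - c], which is strictly less. *)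
Lemma leads_D j N u uh : leads N u uh -> leads (N + Ld j) (D j u) (hD j uh).
Proof.
move=> H g; have hLj := hL j; have le_c := fr_le fr j; have tauE := fr_tau fr j.
have omA : om (g - al j) = om g - va j by rewrite omD omN om_al.
have zA : (N + Ld j < om g) || (j \notin tau) -> N + Ld j <= om g -> u (g - al j) = 0.
  move=> lt le; apply: (leads_ge H); rewrite omA.
  move: lt => /orP[|jt]; first by move: le_c hLj; rewrite lamE; lra.
  have : lam j < c by rewrite lt_neqAle le_c -tauE jt.
  by move: le hLj; rewrite lamE; lra.
have eA : om g = N + Ld j -> j \in tau -> u (g - al j) = uh (g - al j).
  move=> e; rewrite tauE => /eqP lj; have [_] := H (g - al j); apply.
  by rewrite omA e; move: lj hLj; rewrite lamE; lra.
have z j' : N + Ld j <= om g -> j' = j -> j \notin rho -> u (g + un j') = 0.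
  move=> le -> jr; apply: (leads_ge H); rewrite omD om_un //; move: le hLj hc; lra.
rewrite /serD /latD /hD; case: (boolP (j \in rho)) => jr.
  split=> [lt|e]; first by rewrite zA ?lt // ltW.
  by case: (boolP (j \in tau)) => jt; [exact: eA|rewrite zA ?jt ?orbT // e].
split=> [lt|e].
  by rewrite z ?ltW // zA ?lt ?ltW // !mulr0 addr0.
rewrite z ?e // mulr0 add0r.
case: (boolP (j \in tau)) => jt; first by rewrite tau_V // mul1r eA.
by rewrite zA ?jt ?orbT ?e // mulr0.
Qed.

Lemma leads_opm (O Oh : 'I_n -> (I -> CC) -> I -> CC) (w : 'I_n -> rat) N u uh (a : 'X_{1..n}) :
  (forall j N u uh, leads N u uh -> leads (N + w j) (O j u) (Oh j uh)) ->
  leads N u uh -> leads (N + \sum_j w j * (a j)%:R) (opm O a u) (opm Oh a uh).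
Proof.
move=> HO H; rewrite /opm.
suff K r : leads (N + \sum_(j <- r) w j * (a j)%:R) (wordop O r a u) (wordop Oh r a uh) by exact: K.
elim: r => [|j r IH]; first by rewrite big_nil addr0.
rewrite big_cons /= addrCA addrC.
elim: (a j) => [|k IHk]; first by rewrite mulr0 addr0.
by rewrite -natr1 mulrDr mulr1 addrA; exact: HO.
Qed.

Definition mon_op (X' D' : 'I_n -> (I -> CC) -> I -> CC) m u := opm X' (xpart m) (opm D' (dpart m) u).

Lemma leads_mon N u uh m : leads N u uh ->
  leads (N + Lweight Lx Ld m) (mon_op X D m u) (mon_op hX hD m uh).
Proof.
move=> H; have := leads_opm (xpart m) leads_X (leads_opm (dpart m) leads_D H).
congr leads; rewrite -addrA /Lweight; congr (_ + _).
rewrite addrC -big_split; apply: eq_bigr => j _.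
by rewrite !mnmE.
Qed.

Lemma actE X' D' P (u : I -> CC) g : act X' D' P u g = \sum_(m <- msupp P) P@_m * mon_op X' D' m u g.
Proof. by rewrite /act /linext fct_sumE. Qed.

Lemma lead_act P N u uh mt : leads N u uh -> mt \in msupp P ->
  (forall m, m \in msupp P -> Lweight Lx Ld m <= Lweight Lx Ld mt) ->
  forall g, om g = N + Lweight Lx Ld mt -> act X D P u g = act hX hD (inL Lx Ld P) uh g.
Proof.
move=> H mtP mtmax g e.
rewrite actE /inL /act linext_sum fct_sumE [RHS]big_mkcond /=.
rewrite !big_seq; apply: eq_bigr => m mP.
rewrite linextZ linextX [RHS](_ : _ = if all (fun m' => Lweight Lx Ld m' <= Lweight Lx Ld m) (msupp P)
  then P@_m * mon_op hX hD m uh g else 0); last by case: ifP.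
have [H1 H2] := leads_mon m H g.
case: ifP => [/allP H3|nall].
  have lE : Lweight Lx Ld m = Lweight Lx Ld mt by apply/eqP; rewrite eq_le mtmax ?H3.
  by rewrite H2 // e lE.
rewrite H1 ?mulr0 // e ltrD2l lt_neqAle mtmax // andbT.
by apply: contraFN nall => /eqP lE; apply/allP => m' m'P; rewrite lE mtmax.
Qed.

(** A finite kernel acts on arbitrary families, so an identity obtained from the series can be
    evaluated at characters. *)
Definition isconv (w : rat) (O : (I -> CC) -> I -> CC) := exists L : seq (I * CC),
  (forall p, p \in L -> om p.1 = w) /\ forall u g, O u g = \sum_(p <- L) p.2 * u (g - p.1).

Lemma conv_id : isconv 0 id.
Proof.
exists [:: (0, 1)]; split=> [p|u g]; last by rewrite big_seq1 mul1r subr0.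
by rewrite inE => /eqP->; exact: om0.
Qed.

Lemma conv0 w : isconv w (fun _ _ => 0).
Proof. by exists [::]; split=> // u g; rewrite big_nil. Qed.

Lemma conv_comp w1 w2 O1 O2 : isconv w1 O1 -> isconv w2 O2 -> isconv (w1 + w2) (fun u => O1 (O2 u)).
Proof.
move=> [L1 [H1 E1]] [L2 [H2 E2]].
exists [seq (p.1 + q.1, p.2 * q.2) | p <- L1, q <- L2]; split=> [p|u g].
  by move=> /allpairsP[[p1 p2] /= [/H1 e1 /H2 e2 ->]]; rewrite omD e1 e2.
rewrite E1 big_allpairs_dep; apply: eq_bigr => p _; rewrite E2 mulr_sumr.
by apply: eq_bigr => q _; rewrite /= mulrA opprD addrA.
Qed.

Lemma conv_add w O1 O2 : isconv w O1 -> isconv w O2 -> isconv w (fun u g => O1 u g + O2 u g).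
Proof.
move=> [L1 [H1 E1]] [L2 [H2 E2]]; exists (L1 ++ L2); split=> [p|u g].
  by rewrite mem_cat => /orP[/H1|/H2].
by rewrite big_cat E1 E2.
Qed.

Lemma conv_scale w k O : isconv w O -> isconv w (fun u g => k * O u g).
Proof.
move=> [L [H E]]; exists [seq (p.1, k * p.2) | p <- L]; split=> [p /mapP[q /H e ->] //|u g].
by rewrite E big_map mulr_sumr; apply: eq_bigr => p _; rewrite mulrA.
Qed.

Lemma conv_shift w g0 : om g0 = w -> isconv w (fun u g => u (g - g0)).
Proof.
move=> e; exists [:: (g0, 1)]; split=> [p|u g]; last by rewrite big_seq1 mul1r.
by rewrite inE => /eqP->.
Qed.

Lemma conv_sum (J : eqType) (r : seq J) (P : pred J) w (O : J -> (I -> CC) -> I -> CC) :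
  (forall j, j \in r -> P j -> isconv w (O j)) -> isconv w (fun u g => \sum_(j <- r | P j) O j u g).
Proof.
elim: r => [|j r IH] H.
  by have [L [H1 H2]] := conv0 w; exists L; split=> // u g; rewrite big_nil -H2.
have [|L [H1 H2]] := IH; first by move=> j' j'r; apply: H; rewrite inE j'r orbT.
have [Pj|nPj] := boolP (P j); last by exists L; split=> // u g; rewrite big_cons (negPf nPj) H2.
have [L' [H1' H2']] := conv_add (H j (mem_head _ _) Pj) (ex_intro _ L (conj H1 H2)).
by exists L'; split=> // u g; rewrite big_cons Pj -H2'.
Qed.

Lemma conv_opm (O : 'I_n -> (I -> CC) -> I -> CC) (w : 'I_n -> rat) (a : 'X_{1..n}) :
  (forall j, isconv (w j) (O j)) -> isconv (\sum_j w j * (a j)%:R) (opm O a).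
Proof.
move=> H; rewrite /opm.
suff K r : isconv (\sum_(j <- r) w j * (a j)%:R) (wordop O r a) by exact: K.
elim: r => [|j r IH]; first by rewrite big_nil; exact: conv_id.
rewrite big_cons; apply: (conv_comp (O1 := iter (a j) (O j))) => //.
elim: (a j) => [|k IHk]; first by rewrite mulr0; exact: conv_id.
by rewrite -natr1 mulrDr mulr1 addrC; apply: (conv_comp (O1 := O j)).
Qed.

Lemma conv_hX j : isconv (Lx j) (hX j).
Proof.
rewrite /hX; case: (boolP (j \in rho)) => jr; last by apply: conv_shift; exact: om_un.
suff [L [H E]] : isconv (Lx j) (fun u g => -1 * \sum_(k | [&& V k, k \notin rho & lam k == lam j])
     BB j k * u (g - (un k + al k - al j))).
  by exists L; split=> // u g; rewrite -E mulN1r.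
apply: conv_scale; apply: conv_sum => k _ /and3P[_ kr /eqP lk].
apply: conv_scale; apply: conv_shift; rewrite !omD omN om_un // !om_al -lamE lk lamE; ring.
Qed.

Lemma conv_hD j : isconv (Ld j) (hD j).
Proof.
rewrite /hD; case: (boolP (j \in tau)) => jt; last exact: conv0.
apply: conv_shift; rewrite om_al; move: jt (hL j); rewrite (fr_tau fr) => /eqP; rewrite lamE; lra.
Qed.

Lemma conv_act P w : (forall m, m \in msupp P -> Lweight Lx Ld m = w) -> isconv w (act hX hD P).
Proof.
move=> H; suff [L [H1 H2]] : isconv w (fun u g => \sum_(m <- msupp P) P@_m * mon_op hX hD m u g).
  by exists L; split=> // u g; rewrite actE -H2.
apply: conv_sum => m mP _; apply: conv_scale; rewrite -(H m mP).
have := conv_comp (conv_opm (xpart m) conv_hX) (conv_opm (dpart m) conv_hD).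
congr isconv; rewrite /Lweight -big_split; apply: eq_bigr => j _.
by rewrite !mnmE.
Qed.

End Lead.

(** * The top part of the series and the vanishing of initial forms *)

Lemma max_seq (T : eqType) (f : T -> rat) (s : seq T) : s != [::] ->
  exists x, x \in s /\ forall y, y \in s -> f y <= f x.
Proof.
elim: s => [//|x s IH] _; have [->|/IH[y [ys ym]]] := eqVneq s [::].
  by exists x; rewrite mem_head; split=> // y; rewrite inE => /eqP->.
have [le|lt] := lerP (f x) (f y).
  by exists y; rewrite inE ys orbT; split=> // z; rewrite inE => /orP[/eqP->|/ym].
exists x; rewrite mem_head; split=> // z; rewrite inE => /orP[/eqP->//|/ym le].
exact: le_trans le (ltW lt).
Qed.

Lemma min_natP (T : Type) (P : T -> Prop) (f : T -> nat) : (exists x, P x) ->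
  exists x, P x /\ forall y, P y -> (f x <= f y)%N.
Proof.
move=> [x0 Px0]; pose Q k := `[< exists x, P x /\ f x = k >].
have exQ : exists k, Q k by exists (f x0); apply/asboolP; exists x0.
case: (ex_minnP exQ) => k /asboolP[x [Px <-]] kmin; exists x; split=> // y Py.
by apply: kmin; apply/asboolP; exists y.
Qed.

Lemma min_intP (T : Type) (P : T -> Prop) (f : T -> int) (b : int) : (forall x, P x -> b <= f x) ->
  (exists x, P x) -> exists x, P x /\ forall y, P y -> f x <= f y.
Proof.
move=> fb exP; have [x [Px xm]] := min_natP (fun x => absz (f x - b)) exP.
exists x; split=> // y Py; have := xm y Py; have := fb y Py; have := fb x Px.
by move: (f x) (f y); clear; lia.
Qed.

(* The lexicographically least element of P + Q has a unique decomposition. *)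
Lemma lex_min (G : zmodType) (J : eqType) (crd : J -> G -> int) (P Q : G -> Prop) (js : seq J) :
  (forall j g h, crd j (g + h) = crd j g + crd j h) ->
  (exists g, P g) -> (exists e, Q e) ->
  (forall j, exists b : int, forall g, P g -> b <= crd j g) ->
  (forall j, j \in js -> forall e, Q e -> 0 <= crd j e) ->
  exists g e, [/\ P g, Q e & forall g' e', P g' -> Q e' ->
    (forall j, j \in js -> crd j (g' + e') = crd j (g + e)) ->
    forall j, j \in js -> crd j g' = crd j g /\ crd j e' = crd j e].
Proof.
move=> cD [g0 Pg0] [q0 Qq0] Pb; elim: js => [|j js IH] Qb.
  by exists g0, q0; split.
have [|g [e [Pg Qe H]]] := IH; first by move=> i ijs; apply: Qb; rewrite inE ijs orbT.
have [b bP] := Pb j.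
pose P' g' := P g' /\ forall i, i \in js -> crd i g' = crd i g.
pose Q' e' := Q e' /\ forall i, i \in js -> crd i e' = crd i e.
have [||g1 [[Pg1 g1E] g1m]] := @min_intP _ P' (crd j) b.
- by move=> g' [/bP].
- by exists g.
have [||e1 [[Qe1 e1E] e1m]] := @min_intP _ Q' (crd j) 0.
- by move=> e' [Qe' _]; apply: Qb; rewrite ?mem_head.
- by exists e.
exists g1, e1; split=> // g' e' Pg' Qe' sE.
have ge i : i \in js -> crd i g' = crd i g /\ crd i e' = crd i e.
  apply: (H g' e' Pg' Qe') => k kjs.
  by rewrite sE ?inE ?kjs ?orbT // !cD g1E // e1E.
have Pg2 : P' g' by split=> // i /ge[].
have Qe2 : Q' e' by split=> // i /ge[].
move=> i; rewrite inE => /orP[/eqP->|ijs]; last first.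
  by have [-> ->] := ge i ijs; rewrite g1E // e1E.
(* Two integers, each at least its minimum, whose sum is the sum of the minima, are both minimal. *)
have := sE j (mem_head _ _); rewrite !cD.
have := g1m g' Pg2; have := e1m e' Qe2.
by move: (crd j g') (crd j e') (crd j g1) (crd j e1); clear; lia.
Qed.

Section Vanish.
Variables (d n : nat) (A : 'M[int]_(d, n)) (beta : 'I_d -> CC).
Variables (Lx Ld : 'I_n -> rat) (c : rat) (tau rho s2 : {set 'I_n}) (v : 'I_d -> rat).
Variables (l : 'I_n -> 'I_d -> rat) (o : 'I_n -> 'I_n) (kap : 'I_n -> nat).
Hypotheses (hc : 0 < c) (hL : forall j, Lx j + Ld j = c).
Hypothesis fr : frame (acol A) Lx c tau rho s2 v l o kap.
Notation V := (inV (acol A) s2 l).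
Notation I := 'rV[int]_(n + d).
Notation colv := (colv A).
Notation X := (serX A beta rho s2 l).
Notation lam := (lam (acol A) Lx v).
Notation e0 := (e0 beta s2 l).
Notation rs := (rs A).
Notation nsupp := (nsupp A beta s2 l).
Notation inW := (inW A s2 l).
Notation usupp := (usupp A beta s2 l).
Notation minI := (minI A beta s2 l).
Notation om := (om Lx rho v).
Let hdisj := fr_disj fr.
Let hdual := fr_dual fr.

Lemma nsupp_s2 g : (forall j, ~~ V j -> j \notin s2 -> 0 <= xc j g) -> nsupp g \subset s2.
Proof.
move=> H; apply/subsetP => j; rewrite in_set => /andP[Vj /asboolP[m [mE m0]]].
apply: contraLR m0 => js; rewrite -leNgt.
move: mE; rewrite /e0 (negPf js) add0r => /eqP; rewrite eqr_int => /eqP <-.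
exact: H.
Qed.

Lemma nsupp_ge0 g j : nsupp g \subset s2 -> ~~ V j -> j \notin s2 -> 0 <= xc j g.
Proof.
move=> /subsetP H Vj js; rewrite leNgt; apply/negP => lt.
have : j \in nsupp g.
  by rewrite in_set Vj; apply/asboolP; exists (xc j g); rewrite /e0 (negPf js) add0r.
by move/H; rewrite (negPf js).
Qed.

(** The exponent 0 has negative support inside [s2], because [e0] vanishes elsewhere; a negative
    support of least cardinality is minimal for inclusion. *)
Lemma minI_exists : exists Is : {set 'I_n}, [/\ Is \subset s2, minI Is 0 & exists g, usupp Is 0 g].
Proof.
pose P g := inW 0 g /\ nsupp g \subset s2.
have rs0 : rs 0 = 0 by rewrite /rs big1 // => j _; rewrite /xc !mxE scale0r.
have P0 : P 0.
  split.
    apply/andP; split; apply/forallP => j; apply/implyP => _; first by rewrite /xc !mxE.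
    by rewrite rs0 addr0 tlv0.
  by apply: nsupp_s2 => j _ _; rewrite /xc !mxE.
have [g [[gW gs] gm]] := min_natP (fun g => #|nsupp g|) (ex_intro _ 0 P0).
exists (nsupp g); split=> //.
  move=> g' g'W sub; apply/eqP; rewrite eqEcard sub /=; apply: gm; split=> //.
  exact: subset_trans sub gs.
(* [P] ignores the exponent of [t], which is reset to the value that [usupp] demands. *)
pose g1 : I := row_mx (lsubmx g) (rs g).
have xg1 j : xc j g1 = xc j g by rewrite /xc /g1 row_mxKl.
have rs1 : rs g1 = rs g by apply: eq_bigr => j _; rewrite xg1.
exists g1; apply/and3P; split.
- rewrite /inW rs1; move: gW => /andP[H1 H2]; apply/andP; split=> //.
  by apply/forallP => j; rewrite xg1; exact: (forallP H1 j).
- by rewrite /g1 row_mxKr -/g1 rs1 add0r.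
- by apply/eqP/setP => j; rewrite !in_set xg1.
Qed.

Variable Is : {set 'I_n}.
Hypotheses (Is_s2 : Is \subset s2) (mI : minI Is 0).

Lemma usupp_ge0 g j : usupp Is 0 g -> ~~ V j -> j \notin s2 -> 0 <= xc j g.
Proof. by move=> /and3P[_ _ /eqP e]; apply: nsupp_ge0; rewrite e. Qed.

Lemma rs_out g : inW 0 g -> rs g = \sum_(j | ~~ V j) xc j g *: colv j.
Proof.
move=> gW; rewrite /rs (bigID V) /= big1 ?add0r // => j Vj.
by rewrite (xcV gW Vj) scale0r.
Qed.

Lemma xc_s2 g k : inW 0 g -> k \in s2 ->
  (xc k g)%:~R = - \sum_(j | ~~ V j && (j \notin s2)) (xc j g)%:~R * dotp (acol A j) (l k) :> rat.
Proof.
move=> gW ks; have := gW => /andP[_ /forall_inP /(_ k ks) /eqP]; rewrite add0r rs_out //.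
rewrite tlv_sum (bigID (fun j => j \notin s2)) /=.
rewrite [X in _ + X](_ : _ = (xc k g)%:~R) => [/eqP|].
  rewrite addr_eq0 => /eqP SE; rewrite -[LHS]opprK -SE; congr (- _); apply: eq_bigr => j _; by rewrite tlvZ tlv_col.
rewrite (bigD1 k) /=; last by rewrite negbK ks (s2_V hdual ks).
rewrite tlvZ tlv_col hdual ?in_setU ?ks ?orbT // eqxx mulr1 big1 ?addr0 //.
move=> j /andP[/andP[_ /negPn js] /negPf jk].
by rewrite tlvZ tlv_col hdual ?in_setU ?ks ?js ?orbT // eq_sym jk mulr0.
Qed.

(** Coordinates in [V] vanish, those in [s2] follow from the span condition by duality ([xc_s2]),
    and all together fix the exponent of [t]. *)
Lemma usupp_inj g g' : usupp Is 0 g -> usupp Is 0 g' ->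
  (forall j, ~~ V j -> j \notin s2 -> xc j g = xc j g') -> g = g'.
Proof.
move=> /and3P[gW /eqP gR _] /and3P[gW' /eqP gR' _] H.
have xE j : xc j g = xc j g'.
  have [Vj|Vj] := boolP (V j); first by rewrite (xcV gW Vj) (xcV gW' Vj).
  have [js|js] := boolP (j \in s2); last exact: H.
  apply/eqP; rewrite -(eqr_int rat) !xc_s2 //; apply/eqP; congr (- _).
  by apply: eq_bigr => k /andP[Vk ks]; rewrite H.
rewrite -[g]hsubmxK -[g']hsubmxK gR gR'; congr (row_mx _ (_ + _)).
  by apply/rowP => j; exact: xE.
by apply: eq_bigr => j _; rewrite xE.
Qed.

Lemma om_usupp g : usupp Is 0 g -> om g = \sum_(j | ~~ V j && (j \notin s2)) (xc j g)%:~R * lam j.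
Proof.
move=> /and3P[gW /eqP gR _].
rewrite /om gR add0r (bigID V) /= big1 ?add0r; last first.
  by move=> j /andP[_ Vj]; rewrite (xcV gW Vj) mulr0.
have -> : \sum_i (rs g 0 i)%:~R * v i = \sum_(j | ~~ V j) (xc j g)%:~R * va A v j.
  rewrite rs_out //.
  rewrite (eq_bigr (fun i => \sum_(j | ~~ V j) (xc j g)%:~R * (acol A j i * v i))); last first.
    by move=> i _; rewrite summxE rmorph_sum mulr_suml; apply: eq_bigr => j _; rewrite !mxE /= intrM mulrA.
  by rewrite exchange_big; apply: eq_bigr => j _; rewrite mulr_sumr.
rewrite (eq_bigl (fun j => ~~ V j)) => [|j]; last first.
  by case: (boolP (V j)) => Vj; rewrite ?andbF // andbT (rho_nV hdisj hdual Vj).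
rewrite -big_split /= (bigID (fun j => j \notin s2)) /= [X in _ + X]big1 ?addr0.
  by apply: eq_bigr => j _; rewrite lamE; ring.
move=> j /andP[_ /negPn js]; have := fr_s2 fr js; rewrite lamE => e.
by rewrite mulrC -mulrDr e mulr0.
Qed.

(** By [om_usupp] the weight is a sum of natural numbers times heights at most 0; after clearing
    denominators it takes integer values bounded above. *)
Lemma max_usupp : (exists g, usupp Is 0 g) ->
  exists g, usupp Is 0 g /\ forall g', usupp Is 0 g' -> om g' <= om g.
Proof.
move=> ex; have [N [N0 [p pE]]] := common_denom lam.
pose f (g : I) := - \sum_(j | ~~ V j && (j \notin s2)) xc j g * p j.
have fE g : usupp Is 0 g -> om g * N%:R = - (f g)%:~R.
  move=> gs; rewrite om_usupp // mulr_suml /f intrN opprK rmorph_sum; apply: eq_bigr => j _.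
  by rewrite /= intrM -mulrA pE.
have N0' : 0 < N%:R :> rat by rewrite ltr0n.
have [g gs|//|g [gs gm]] := @min_intP _ (usupp Is 0) f 0.
  rewrite /f -sumrN sumr_ge0 // => j /andP[Vj js].
  rewrite -mulrN mulr_ge0 ?(usupp_ge0 gs) // oppr_ge0 -(ler_int rat) -pE.
  by apply: mulr_le0_ge0; [exact: (fr_out fr)|exact: ltW].
exists g; split=> // g' g's; rewrite -(ler_pM2r N0') !fE // lerN2 ler_int.
exact: gm.
Qed.

Variable gam : 'I_n -> int -> CC.
Hypothesis gam0 : forall j z, gam j z != 0.
Hypothesis gamS : forall j z, e0 j + z%:~R + 1 != 0 -> (e0 j + z%:~R + 1) * gam j (z + 1) = gam j z.
Notation U := (useries A beta s2 l Is gam 0).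

Lemma useries_neq0 g : (U g != 0) = usupp Is 0 g.
Proof.
rewrite /useries; case: ifP => _; last by rewrite eqxx.
by apply/prodf_neq0 => j _.
Qed.

(* The product of the lexicographically extreme monomials of O and of the top part of U cannot
   cancel. *)
Lemma conv_torsion w O M : isconv Lx rho v w O -> (exists g, usupp Is 0 g /\ om g = M) ->
  (forall g, usupp Is 0 g -> om g <= M) ->
  (forall g, om g = w + M -> O U g = 0) -> forall u g, O u g = 0.
Proof.
move=> [L [Lw LE]] [g0 [g0s g0M]] gM OU.
(* The list of a convolution may repeat shifts; only the collected coefficients [K] decide whether
   it is zero. *)
pose K g := \sum_(p <- L | p.1 == g) p.2.
pose ks := undup [seq p.1 | p <- L].
have OE u g : O u g = \sum_(k <- ks) K k * u (g - k).
  rewrite LE (eq_bigr (fun k => \sum_(p <- L) if p.1 == k then p.2 * u (g - p.1) else 0)); last first.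
    by move=> k _; rewrite /K mulr_suml big_mkcond; apply: eq_bigr => p _; case: eqP => // ->.
  rewrite exchange_big /= !big_seq; apply: eq_bigr => p pL.
  rewrite (bigD1_seq p.1) ?undup_uniq ?mem_undup ?map_f //= eqxx big1 ?addr0 // => k /negPf.
  by rewrite eq_sym => ->.
have [H|/existsNP[k0 /eqP Kk0]] := pselect (forall k, K k = 0).
  by move=> u g; rewrite OE big1 // => k _; rewrite H mul0r.
have Kks k : K k != 0 -> k \in ks.
  apply: contraR; rewrite mem_undup => kL; rewrite /K big1_seq // => p /andP[/eqP pk pL].
  by case/negP: kL; rewrite -pk map_f.
pose Q g := usupp Is 0 g /\ om g = M.
pose js := [seq j <- enum 'I_n | ~~ V j && (j \notin s2)].
have [|||||g [e [Kg [es eM] H]]] := @lex_min _ _ (@xc d n) (fun g => K g != 0) Q js.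
- exact: xcD.
- by exists k0.
- by exists g0.
- move=> j; exists (- \sum_(k <- ks) `|xc j k|) => k /Kks kks.
  rewrite lerNl (big_rem k) //=; apply: ler_wpDr; first exact: sumr_ge0.
  by rewrite -normrN ler_norm.
- by move=> j; rewrite mem_filter => /andP[/andP[Vj js2] _] e [es _]; exact: (usupp_ge0 es).
exfalso; have := OU (g + e).
rewrite omD eM (_ : om g = w); last first.
  by have := Kks g Kg; rewrite mem_undup => /mapP[p /Lw pw ->].
move=> /(_ erefl) /eqP; rewrite OE (bigD1_seq g) ?undup_uniq ?Kks //= big1_seq ?addr0.
  rewrite mulf_eq0 (negPf Kg) /= [g + e]addrC addrK => U0.
  by move: es; rewrite -useries_neq0 U0.
move=> k /andP[kg kks]; have [->|Kk] := eqVneq (K k) 0; first by rewrite mul0r.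
have [->|U0] := eqVneq (U (g + e - k)) 0; first by rewrite mulr0.
case/negP: kg; apply/eqP.
have e's : usupp Is 0 (g + e - k) by rewrite -useries_neq0.
have ke : k + (g + e - k) = g + e by rewrite addrC subrK.
have e'M : om (g + e - k) = M.
  move: (omD Lx rho v k (g + e - k)); rewrite ke omD eM.
  have kw h : K h != 0 -> om h = w.
    by move=> /Kks; rewrite mem_undup => /mapP[p /Lw pw ->].
  by rewrite (kw g Kg) (kw k Kk) => /addrI.
have {}H := H k (g + e - k) Kk (conj e's e'M) (fun j _ => congr1 (xc j) ke).
have e'e : g + e - k = e.
  apply: (usupp_inj e's es) => j Vj js2.
  by have [|_ ->] := H j; first by rewrite mem_filter Vj js2 mem_enum.
by rewrite e'e in ke; exact: addIr ke.
Qed.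

Lemma eigen_opm (W : lmodType CC) (O : 'I_n -> W -> W) (y : 'I_n -> CC) (u : W) (a : 'X_{1..n}) :
  (forall j, lin_op (O j)) -> (forall j, O j u = y j *: u) ->
  opm O a u = (\prod_j y j ^+ a j) *: u.
Proof.
move=> Ol Oy; rewrite /opm.
elim: (index_enum _) => [|j r IH]; first by rewrite big_nil scale1r.
rewrite big_cons /= IH lin_opZ; last exact: lin_op_iter.
rewrite mulrC -scalerA; congr (_ *: _); elim: (a j) => [|k IHk] /=; first by rewrite scale1r.
by rewrite IHk lin_opZ // Oy scalerA -exprSr.
Qed.

(** On a common eigenvector a normally ordered expression acts by its value at the eigenvalues. *)
Lemma eigen_act (W : lmodType CC) (X' D' : 'I_n -> W -> W) (p : 'I_(n + n) -> CC) u P :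
  (forall j, lin_op (X' j)) -> (forall j, lin_op (D' j)) ->
  (forall j, X' j u = p (lshift n j) *: u) -> (forall j, D' j u = p (rshift n j) *: u) ->
  act X' D' P u = meval p P *: u.
Proof.
move=> Xl Dl Xe De; move: P; apply: linext_eq => [k P Q|k P Q|m].
- exact: act_lin.
- by rewrite mevalD mevalZ scalerDl scalerA.
rewrite act_opm0 (eigen_opm _ Dl De) lin_opZ; last exact: opm_lin.
rewrite (eigen_opm _ Xl Xe) scalerA mevalX big_split_ord /= mulrC; congr ((_ * _) *: _).
  by apply: eq_bigr => j _; rewrite mnmE.
by apply: eq_bigr => j _; rewrite mnmE.
Qed.

End Vanish.

Section FrameVanish.
Variables (d n : nat) (A : 'M[int]_(d, n)) (beta : 'I_d -> CC).
Variables (Lx Ld : 'I_n -> rat) (c : rat) (tau rho s2 : {set 'I_n}) (v : 'I_d -> rat).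
Variables (l : 'I_n -> 'I_d -> rat) (o : 'I_n -> 'I_n) (kap : 'I_n -> nat).
Hypotheses (hc : 0 < c) (hL : forall j, Lx j + Ld j = c).
Hypothesis fr : frame (acol A) Lx c tau rho s2 v l o kap.
Notation V := (inV (acol A) s2 l).
Notation I := 'rV[int]_(n + d).
Notation lam := (lam (acol A) Lx v).
Notation BB := (BB A l).
Notation hX := (hX A Lx rho s2 v l).
Notation hD := (hD A tau).

Definition tmon (t : 'I_d -> CC) (j : 'I_n) : CC := \prod_i t i ^ (A i j).

Lemma hX_lin j : lin_op (hX j).
Proof.
move=> k u w; apply/funext => g; rewrite fctZD /hX; case: ifP => // _.
under eq_bigr do rewrite fctZD mulrDr mulrCA.
rewrite big_split -mulr_sumr /=; ring.
Qed.

Lemma hD_lin j : lin_op (hD j).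
Proof.
move=> k u w; apply/funext => g; rewrite fctZD /hD; case: ifP => // _.
by rewrite mulr0 addr0.
Qed.

(* On the points y_k t^{a_k} = - sum B_kj y_j t^{a_j}, the functions y^{-e} t^{-g} are
   eigenvectors of the leading operators. *)
Theorem frame_vanish P (p : 'I_(n + n) -> CC) (t : 'I_d -> CC) : HA A beta P ->
  (forall i, t i != 0) -> (forall j, j \notin rho -> p (lshift n j) != 0) ->
  (forall j, p (rshift n j) = (j \in tau)%:R * tmon t j) ->
  (forall k, k \in rho -> p (lshift n k) * tmon t k +
     \sum_(j | [&& V j, j \notin rho & lam j == lam k]) BB k j * (p (lshift n j) * tmon t j) = 0) ->
  meval p (inL Lx Ld P) = 0.
Proof.
move=> PH t0 p0 pxi prho.
have [P0|Pn0] := eqVneq P 0.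
  by rewrite P0 /inL msupp0 big_nil meval0.
have [m0 m0P] : exists m0, m0 \in msupp P.
  by exists (mlead P); exact: mlead_supp.
have [mt [mtP mtmax]] : exists mt, mt \in msupp P /\
    forall m, m \in msupp P -> Lweight Lx Ld m <= Lweight Lx Ld mt.
  by apply: max_seq; apply: contraTneq m0P => ->.
have [Is [Is2 mI exu]] := minI_exists A beta s2 l.
have [g0 [g0s g0m]] := max_usupp fr Is2 exu.
have [gam gamP] := fin_all_exists (fun j => gamma_ratio (e0 beta s2 l j)).
have gam0 j z : gam j z != 0 by have [] := gamP j z.
have gamS j z := (gamP j z).2.
pose U := useries A beta s2 l Is gam 0.
have lU : leads Lx rho v (om Lx rho v g0) U U.
  move=> g; split=> // lt; apply/eqP; rewrite -[_ == 0]negbK.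
  by rewrite (useries_neq0 _ _ _ _ _ gam0); apply: contraL lt => /g0m; rewrite -leNgt.
have PU := HA_kill (fr_disj fr) (fr_dual fr) (fr_basis fr) gamS mI PH.
have slice g : om Lx rho v g = Lweight Lx Ld mt + om Lx rho v g0 ->
    act hX hD (inL Lx Ld P) U g = 0.
  by move=> e; rewrite -(lead_act beta hc hL fr lU mtP mtmax) ?PU // e addrC.
have inLw m : m \in msupp (inL Lx Ld P) -> Lweight Lx Ld m = Lweight Lx Ld mt.
  rewrite /inL => /msupp_sum_le /flatten_mapP[m' ]; rewrite mem_filter => /andP[/allP Q m'P].
  move=> /msuppZ_le; rewrite msuppX inE => /eqP->.
  by apply/eqP; rewrite eq_le mtmax // Q.
have cv := conv_act hL fr inLw.
have zero := conv_torsion fr Is2 gam0 cv (ex_intro _ g0 (conj g0s erefl)) g0m slice.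
pose chi : I -> CC := fun g => (\prod_(j | j \notin rho) p (lshift n j) ^ (- xc j g)) *
   \prod_i t i ^ (- rsubmx g 0 i).
have chiD g h : chi (g + h) = chi g * chi h.
  rewrite /chi mulrACA -!big_split; congr (_ * _); apply: eq_bigr => j jr /=.
    by rewrite xcD opprD expfzDr // p0.
  by rewrite rsubD mxE opprD expfzDr // t0.
have chi0 : chi 0 = 1.
  rewrite /chi !big1 ?mulr1 // => j _; by rewrite /xc !mxE oppr0 expr0z.
have chi_un j : j \notin rho -> chi (- un d j) = p (lshift n j).
  move=> jr; rewrite /chi [X in _ * X]big1 ?mulr1 => [|i _].
    rewrite (bigD1 j) //= xcN xc_un eqxx opprK expr1z big1 ?mulr1 // => k /andP[_ /negPf kj].
    by rewrite xcN xc_un kj opprK expr0z.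
  by rewrite rsubN rsub_un oppr0 mxE oppr0 expr0z.
have chi_al j : chi (- al A j) = tmon t j.
  rewrite /chi big1 ?mul1r => [|k _]; last by rewrite xcN xc_al !oppr0 expr0z.
  by apply: eq_bigr => i _; rewrite rsubN rsub_al !mxE opprK.
have chi_al' j : chi (al A j) * tmon t j = 1 by rewrite -chi_al -chiD subrr.
have tm0 j : tmon t j != 0 by apply/prodf_neq0 => i _; exact: expfz_neq0.
(* [zero] holds for all families, not only for [U], so it applies to the character [chi]. *)
have := zero chi 0.
rewrite (eigen_act (p := p)).
- by rewrite [X in X = _ -> _](_ : _ = meval p (inL Lx Ld P) * chi 0) // chi0 mulr1.
- exact: hX_lin.
- exact: hD_lin.
- move=> j; apply/funext => g; rewrite [RHS](_ : _ = p (lshift n j) * chi g) // /hX.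
  case: ifP => jr; last by rewrite chiD chi_un ?jr // mulrC.
  apply: (mulIf (tm0 j)); rewrite mulrAC; have := prho j jr => /eqP.
  rewrite addr_eq0 => /eqP->; rewrite !mulNr !mulr_suml; congr (- _); apply: eq_bigr => k /and3P[_ kr _].
  rewrite !opprB chiD chiD opprD chiD chi_un // chi_al.
  by rewrite -[RHS]mulr1 -(chi_al' j); ring.
- move=> j; apply/funext => g; rewrite [RHS](_ : _ = p (rshift n j) * chi g) // /hD pxi.
  by case: ifP => _; rewrite ?mul0r // mul1r chiD chi_al mulrC.
Qed.

End FrameVanish.

(** * Degeneration to the conormal variety *)

Lemma expz_sum (F : fieldType) (x : F) (J : finType) (f : J -> int) : x != 0 ->
  x ^ (\sum_j f j) = \prod_j x ^ f j.
Proof.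
move=> x0; elim/big_rec2: _ => [|j y z _ <-]; first exact: expr0z.
by rewrite expfzDr.
Qed.

Lemma prodf_expz (F : fieldType) (J : finType) (f : J -> F) (z : int) :
  (\prod_j f j) ^ z = \prod_j f j ^ z.
Proof.
elim/big_rec2: _ => [|j x y _ <-]; first exact: exp1rz.
by rewrite expfzMl.
Qed.

Lemma int_root (z : CC) (m : int) : z != 0 -> m != 0 -> exists s : CC, s != 0 /\ s ^ m = z.
Proof.
move=> z0 m0; have [s s0 sE] : exists2 s : CC, s != 0 & s ^+ absz m = z.
  exists ((absz m).-root z); last by rewrite rootCK // absz_gt0.
  by rewrite rootC_eq0 // absz_gt0.
case: (intP m) m0 sE => [//|k|k] _.
  by move=> sE; exists s.
rewrite abszN /= => sE; exists s^-1; rewrite invr_neq0 //; split=> //.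
by rewrite exprz_inv opprK.
Qed.

(* A character of the lattice spanned by the columns of M extends to Z^d. *)
Lemma char_extend (d N : nat) (M : 'M[int]_(d, N)) (z : 'I_N -> CC) :
  (forall j, z j != 0) ->
  (forall u : 'I_N -> int, (forall i, \sum_j M i j * u j = 0) -> \prod_j z j ^ u j = 1) ->
  exists t : 'I_d -> CC, (forall i, t i != 0) /\ forall j, \prod_i t i ^ M i j = z j.
Proof.
move=> z0 zrel; have [L Lu [R Ru [dd _ ME]]] := int_Smith_normal_form M.
set Dm := \matrix_(i, j) _ in ME.
pose zt (i : 'I_N) := \prod_j z j ^ (invmx R j i).
have zt0 i : zt i != 0 by apply/prodf_neq0 => j _; exact: expfz_neq0.
have zt1 i : (forall k, Dm k i = 0) -> zt i = 1.
  move=> Di; apply: zrel => k.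
  have : (M *m invmx R) k i = 0.
    rewrite ME mulmxK // mxE big1 // => k' _; by rewrite Di mulr0.
  by rewrite mxE.
have thex (k : 'I_d) : exists th : CC, th != 0 /\ forall i : 'I_N, (k == i :> nat) -> dd`_k != 0 ->
    th ^ dd`_k = zt i.
  have [[i [/eqP ki dk]]|H] := pselect (exists i : 'I_N, (k == i :> nat) /\ dd`_k != 0).
    have [s [s0 sE]] := int_root (zt0 i) dk; exists s; split=> // i' /eqP ki' _.
    by rewrite sE; congr zt; apply: val_inj; rewrite /= -ki -ki'.
  by exists 1; rewrite oner_neq0; split=> // i ki dk; case: H; exists i.
have [th thP] := fin_all_exists thex.
have thD i : \prod_k th k ^ Dm k i = zt i.
  have [[k [ki dk]]|H] := pselect (exists k : 'I_d, (k == i :> nat) /\ dd`_k != 0).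
    rewrite (bigD1 k) //= mxE ki mulr1n ((thP k).2 i ki dk) big1 ?mulr1 // => k' kk'.
    rewrite mxE; case: eqP => [k'i|_]; last by rewrite mulr0n expr0z.
    by case/eqP: kk'; apply: val_inj; rewrite /= k'i (eqP ki).
  have D0 k : Dm k i = 0.
    rewrite mxE; have [ki|_] := eqVneq (k : nat) (i : nat); last by rewrite mulr0n.
    by rewrite mulr1n; apply/eqP; apply: contra_notT H => dk; exists k; split=> //; exact/eqP.
  by rewrite zt1 // big1 // => k _; rewrite D0 expr0z.
exists (fun i => \prod_k th k ^ (invmx L k i)); split=> [i|j].
  by apply/prodf_neq0 => k _; rewrite expfz_neq0 // (thP k).1.
rewrite (eq_bigr (fun i => \prod_k th k ^ (invmx L k i * M i j))); last first.
  by move=> i _; rewrite prodf_expz; apply: eq_bigr => k _; rewrite exprz_exp.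
rewrite exchange_big (eq_bigr (fun k => \prod_i (th k ^ Dm k i) ^ R i j)) /=; last first.
  move=> k _; rewrite -expz_sum; last exact: (thP k).1.
  have -> : \sum_i invmx L k i * M i j = (Dm *m R) k j.
    by rewrite -[Dm *m R](mulKmx Lu) [L *m (Dm *m R)]mulmxA -ME mxE.
  rewrite mxE expz_sum; last exact: (thP k).1.
  by apply: eq_bigr => i _; rewrite exprz_exp.
rewrite exchange_big (eq_bigr (fun i => \prod_j' z j' ^ (invmx R j' i * R i j))) /=; last first.
  move=> i _; rewrite -prodf_expz thD /zt prodf_expz; apply: eq_bigr => j' _.
  by rewrite exprz_exp.
rewrite exchange_big /= (eq_bigr (fun j' => z j' ^ (1%:M : 'M[int]_N) j' j)); last first.
  by move=> j' _; rewrite -expz_sum // -[1%:M](mulVmx Ru) mxE.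
rewrite (bigD1 j) //= mxE eqxx expr1z big1 ?mulr1 // => j' /negPf j'j.
by rewrite mxE j'j expr0z.
Qed.

Lemma poly_nonroot (S : {poly CC}) : S != 0 -> exists z : CC, z != 0 /\ S.[z] != 0.
Proof.
move=> S0; pose rs := [seq (k.+1)%:R : CC | k <- iota 0 (size S)].
have [z zr Sz] : exists2 z, z \in rs & S.[z] != 0.
  apply: contrapT => H.
  have : (size rs < size S)%N.
    apply: max_poly_roots => //.
      by apply/allP => z zr; rewrite rootE; apply: contra_notT H => ?; exists z.
    rewrite map_inj_uniq ?iota_uniq // => a b /eqP; rewrite eqr_nat eqSS; exact: eqP.
  by rewrite size_map size_iota ltnn.
exists z; split=> //; by case/mapP: zr => k _ ->; rewrite pnatr_eq0.
Qed.

Lemma base_inj (n N : nat) (f g : 'I_n -> nat) : (forall i, f i < N)%N -> (forall i, g i < N)%N ->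
  (\sum_i f i * N ^ i)%N = (\sum_i g i * N ^ i)%N -> f =1 g.
Proof.
elim: n f g => [|n IH] f g fN gN; first by move=> _ [].
rewrite !big_ord_recl /= !muln1.
have E (h : 'I_n.+1 -> nat) : (\sum_(i < n) h (lift ord0 i) * N ^ bump 0 i =
    (\sum_(i < n) h (lift ord0 i) * N ^ i) * N)%N.
  by rewrite big_distrl; apply: eq_bigr => i _; rewrite /bump add1n expnSr mulnA.
rewrite !E => e.
have N0 : (0 < N)%N by apply: leq_ltn_trans (fN ord0).
have e0 : f ord0 = g ord0.
  have := congr1 (fun x => x %% N)%N e.
  by rewrite ![(_ + _ * N)%N]addnC !modnMDl !modn_small.
move: e; rewrite e0 => /addnI /eqP; rewrite eqn_pmul2r // => /eqP e.
have H := IH (fun i => f (lift ord0 i)) (fun i => g (lift ord0 i)) (fun i => fN _) (fun i => gN _) e.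
by move=> i; case: (unliftP ord0 i) => [j ->|->]; [exact: H|exact: e0].
Qed.

(* Kronecker substitution. *)
Lemma mpoly_nonroot (n : nat) (P : {mpoly CC[n]}) : P != 0 ->
  exists y : 'I_n -> CC, (forall j, y j != 0) /\ meval y P != 0.
Proof.
move=> P0; pose N := (\max_(m <- msupp P) mdeg m).+1.
have mN m j : m \in msupp P -> (m j < N)%N.
  move=> mP; rewrite ltnS; apply: (@leq_trans (mdeg m)).
    by rewrite mdegE (bigD1 j) //= leq_addr.
  by rewrite (big_rem m) //= leq_maxl.
pose e (m : 'X_{1..n}) := (\sum_j m j * N ^ j)%N.
pose S : {poly CC} := \sum_(m <- msupp P) P@_m *: 'X^(e m).
have [m0 m0P] : exists m0, m0 \in msupp P by exists (mlead P); exact: mlead_supp.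
have S0 : S != 0.
  apply/eqP => S0; have /eqP := congr1 (fun p : {poly CC} => p`_(e m0)) S0.
  rewrite coef0 /S coef_sum (bigD1_seq m0) ?msupp_uniq //= coefZ coefXn eqxx mulr1.
  rewrite big1_seq ?addr0 ?mcoeff_eq0 ?m0P // => m /andP[mm0 mP].
  rewrite coefZ coefXn; case: eqP => [em|_]; last by rewrite mulr0.
  case/eqP: mm0; apply/mnmP => j.
  by apply: (base_inj _ _ (esym em)) => i; exact: mN.
have [z [z0 Sz]] := poly_nonroot S0.
exists (fun j => z ^+ (N ^ j)); split=> [j|]; first exact: expf_neq0.
move: Sz; rewrite mevalE /S horner_sum; congr (_ != 0); apply: eq_bigr => m _.
rewrite hornerZ hornerXn; congr (_ * _); rewrite /e -prodrXr; apply: eq_bigr => j _.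
by rewrite -exprM mulnC.
Qed.

Section HardInclusion.
Variables (d n : nat) (A : 'M[int]_(d, n)) (beta : 'I_d -> CC).
Variables (Lx Ld : 'I_n -> rat) (c : rat) (tau rho s2 : {set 'I_n}) (v : 'I_d -> rat).
Variables (l : 'I_n -> 'I_d -> rat) (o : 'I_n -> 'I_n) (kap : 'I_n -> nat).
Hypotheses (hc : 0 < c) (hL : forall j, Lx j + Ld j = c).
Hypothesis fr : frame (acol A) Lx c tau rho s2 v l o kap.
Notation V := (inV (acol A) s2 l).
Notation lam := (lam (acol A) Lx v).
Notation BB := (BB A l).

Lemma tmon_neq0 (t : 'I_d -> CC) j : (forall i, t i != 0) -> tmon A t j != 0.
Proof. by move=> t0; apply/prodf_neq0 => i _; exact: expfz_neq0. Qed.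

(** [char_extend] needs the prescribed values to respect the integer relations among the columns of
    [M]. By [fr_dom] these do not involve the differences [a_(o k) - a_k], and on [tau] the values
    already come from [eta]. *)
Lemma frame_torus (eta : 'I_d -> CC) (th : 'I_n -> CC) :
  (forall i, eta i != 0) -> (forall k, th k != 0) ->
  exists t : 'I_d -> CC, [/\ forall i, t i != 0, forall j, j \in tau -> tmon A t j = tmon A eta j &
    forall k, k \in rho :\: tau -> tmon A t (o k) = th k * tmon A t k].
Proof.
move=> eta0 th0.
pose M : 'M[int]_(d, n + n) := row_mx (\matrix_(i, j) (A i j *+ (j \in tau)))
  (\matrix_(i, k) ((A i (o k) - A i k) *+ (k \in rho :\: tau))).
pose z (i : 'I_(n + n)) := match fintype.split i with
  inl j => if j \in tau then tmon A eta j else 1 | inr k => if k \in rho :\: tau then th k else 1 end.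
have zl j : z (lshift n j) = if j \in tau then tmon A eta j else 1 by rewrite /z (unsplitK (inl _ j)).
have zr k : z (rshift n k) = if k \in rho :\: tau then th k else 1 by rewrite /z (unsplitK (inr _ k)).
have [||t [t0 tE]] := @char_extend d (n + n) M z.
- move=> i; case: (split_ordP i) => j ->; rewrite ?zl ?zr; case: ifP => _ //; rewrite ?oner_neq0 //.
  exact: tmon_neq0.
- move=> u uM; pose u1 j : int := u (lshift n j) *+ (j \in tau).
  pose x1 k : int := u (rshift n k) *+ (k \in rho :\: tau).
  have uM' i : \sum_j A i j * u1 j + \sum_k x1 k * (A i (o k) - A i k) = 0.
    rewrite -[RHS](uM i) big_split_ord; congr (_ + _); apply: eq_bigr => j _.
      by rewrite row_mxEl mxE /u1 mulrnAl mulrnAr.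
    by rewrite row_mxEr mxE /x1 !mulrnAl mulrC.
  have x0 k : x1 k = 0.
    have := @fr_dom _ _ _ _ _ _ _ _ _ _ _ _ fr (fun j => (u1 j)%:~R) (fun k => (x1 k)%:~R) _ _ _ k.
    move=> H; apply/eqP; rewrite -(intr_eq0 rat); apply/eqP; apply: H => [j jt|j jt|i].
    + by rewrite /u1 (negPf jt).
    + by rewrite /x1 (negPf jt).
    + rewrite -[RHS](_ : (0 : int)%:~R = 0) // -(uM' i) intrD !raddf_sum /=.
      congr (_ + _); apply: eq_bigr => j _; rewrite intrM /acol ?intrB //.
      exact: mulrC.
  rewrite big_split_ord /= [X in _ * X]big1 ?mulr1 => [|k _]; last first.
    rewrite zr; case: (boolP (k \in _)) => kr; last by rewrite exp1rz.
    by have := x0 k; rewrite /x1 kr mulr1n => ->; rewrite expr0z.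
  transitivity (\prod_i eta i ^ (\sum_j A i j * u1 j)).
    rewrite (eq_bigr (fun i => \prod_j eta i ^ (A i j * u1 j))) => [|i _]; last by rewrite expz_sum.
    rewrite exchange_big; apply: eq_bigr => j _; rewrite zl /u1; case: ifP => _.
      by rewrite mulr1n /tmon prodf_expz; apply: eq_bigr => i _; rewrite exprz_exp.
    by rewrite mulr0n exp1rz big1 // => i _; rewrite mulr0 expr0z.
  rewrite big1 // => i _; have := uM' i; rewrite [X in _ + X]big1 ?addr0 => [->|k _].
    exact: expr0z.
  by rewrite x0 mul0r.
exists t; split=> // [j jt|k kr].
  have := tE (lshift n j); rewrite zl jt => <-; apply: eq_bigr => i _.
  by rewrite row_mxEl mxE jt mulr1n.
have := tE (rshift n k); rewrite zr kr => <-; rewrite /tmon -big_split; apply: eq_bigr => i _ /=.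
by rewrite row_mxEr mxE kr mulr1n -expfzDr // subrK.
Qed.

Section Degeneration.
Variables (eta : 'I_d -> CC) (p : 'I_(n + n) -> CC).
Hypothesis eta0 : forall i, eta i != 0.
Hypothesis pxi : forall j, p (rshift n j) = (j \in tau)%:R * tmon A eta j.
Hypothesis ptan : forall i, \sum_j p (lshift n j) * (A i j)%:~R * p (rshift n j) = 0.

Let tm := tmon A eta.
Let tm0 j : tm j != 0. Proof. exact: tmon_neq0. Qed.

(** The conormality equations contracted with the dual vector [l k]. *)
Lemma tangent_BB k : \sum_(j in tau) BB k j * (tm j * p (lshift n j)) = 0.
Proof.
transitivity (\sum_i ratr (l k i) * (\sum_j p (lshift n j) * (A i j)%:~R * p (rshift n j))).
  rewrite (eq_bigr (fun i => \sum_j ratr (l k i) * (p (lshift n j) * (A i j)%:~R * p (rshift n j)))).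
    rewrite exchange_big big_mkcond /=; apply: eq_bigr => j _.
    rewrite (eq_bigr (fun i => ratr (acol A j i * l k i) * (p (lshift n j) * p (rshift n j)))).
      rewrite -mulr_suml -rmorph_sum /= pxi; case: (j \in tau); last by rewrite mul0r !mulr0.
      by rewrite mul1r [p _ * _]mulrC.
    by move=> i _; rewrite rmorphM /= /acol ratr_int; ring.
  by move=> i _; rewrite mulr_sumr.
by rewrite big1 // => i _; rewrite ptan mulr0.
Qed.

Lemma BB_rho j k : j \in rho -> k \in rho -> BB j k = (j == k)%:R.
Proof.
move=> jr kr; rewrite /BB (fr_dual fr) ?in_setU ?jr ?kr //.
by case: eqP; rewrite ?rmorph1 ?rmorph0.
Qed.

(* Parametrises the fibre of the conormal variety over p by the coordinates outside rho :&: tau. *)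
Definition fibpt (y : 'I_n -> CC) (i : 'I_(n + n)) : CC := match fintype.split i with
  | inl j => if j \in rho :&: tau then
      - (tm j)^-1 * \sum_(k in tau :\: rho) BB j k * tm k * y k else y j
  | inr j => p (rshift n j) end.

Lemma fibpt_l y j : fibpt y (lshift n j) = if j \in rho :&: tau then
      - (tm j)^-1 * \sum_(k in tau :\: rho) BB j k * tm k * y k else y j.
Proof. by rewrite /fibpt (unsplitK (inl _ j)). Qed.

Lemma fibpt_r y j : fibpt y (rshift n j) = p (rshift n j).
Proof. by rewrite /fibpt (unsplitK (inr _ j)). Qed.

(** For [j] in [rho :&: tau], [tangent_BB] contains no other coordinate from [rho], so it can be
    solved for [x_j]. *)
Lemma fibpt_p : fibpt (xcoord p) =1 p.
Proof.
move=> i; case: (split_ordP i) => j ->; last exact: fibpt_r.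
rewrite fibpt_l; case: ifP => // /setIP[jr jt].
have := tangent_BB j; rewrite (bigID (mem rho)) /= (bigD1 j) ?jt ?jr //=.
rewrite BB_rho // eqxx mul1r [X in _ + X + _]big1 ?addr0 => [|k /andP[/andP[kt kr] /negPf kj]]; last first.
  by rewrite BB_rho // eq_sym kj mul0r.
move/eqP; rewrite addr_eq0 => /eqP e.
rewrite mulNr -mulrN; apply: (mulfI (tm0 j)); rewrite mulVKf // e; congr (- _).
apply: eq_big => [k|k _]; first by rewrite in_setD andbC.
by rewrite mulrA.
Qed.

Lemma fibpt_poly f : exists G : {mpoly CC[n]}, forall y, meval y G = meval (fibpt y) f.
Proof.
pose q (i : 'I_(n + n)) : {mpoly CC[n]} := match fintype.split i with
  | inl j => if j \in rho :&: tau then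
      - (tm j)^-1 *: \sum_(k in tau :\: rho) (BB j k * tm k) *: 'X_k else 'X_j
  | inr j => (p (rshift n j))%:MP end.
exists (f \mPo [tuple q i | i < n + n]) => y; rewrite comp_mpoly_meval; apply: meval_eq => i.
rewrite tnth_mktuple /q /fibpt; case: (fintype.split i) => j; last by rewrite mevalC.
case: ifP => _; last by rewrite mevalXU.
rewrite mevalZ raddf_sum /=; congr (_ * _); apply: eq_bigr => k _.
by rewrite mevalZ mevalXU.
Qed.

(** For [k] in [tau] the level of [k] is [tau] itself, and the relation of [frame_vanish] is built
    into [fibpt]; only the relations for [k] outside [tau] remain as hypotheses. *)
Lemma fibpt_vanish P t y : HA A beta P -> (forall i, t i != 0) ->
  (forall j, j \in tau -> tmon A t j = tm j) -> (forall j, j \notin rho -> y j != 0) ->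
  (forall k, k \in rho :\: tau -> y k * tmon A t k +
     \sum_(j | [&& V j, j \notin rho & lam j == lam k]) BB k j * (y j * tmon A t j) = 0) ->
  meval (fibpt y) (inL Lx Ld P) = 0.
Proof.
move=> PH t0 ttau y0 yrho.
have yl j : j \notin rho -> fibpt y (lshift n j) = y j by move=> jr; rewrite fibpt_l in_setI (negPf jr).
apply: (frame_vanish hc hL fr PH t0) => [j jr|j|k kr].
- by rewrite yl ?y0.
- rewrite fibpt_r pxi; case: (boolP (j \in tau)) => jt; rewrite ?mul0r // ttau //.
case: (boolP (k \in tau)) => kt; last first.
  rewrite -[RHS](yrho k) ?in_setD ?kr ?kt // fibpt_l in_setI (negPf kt) andbF; congr (_ + _).
  by apply: eq_bigr => j /and3P[_ jr _]; rewrite yl.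
rewrite fibpt_l in_setI kr kt ttau // mulrAC mulNr mulVf // mulN1r addrC; apply/eqP; rewrite subr_eq0.
apply/eqP; apply: eq_big => [j|j /and3P[_ jr lj]].
  have := fr_tau fr k; rewrite kt => /esym/eqP->; rewrite -(fr_tau fr) in_setD.
  case: (boolP (j \in tau)) => jt; last by rewrite !andbF.
  by rewrite (tau_V hc fr jt).
rewrite yl // ttau; first by rewrite mulrA mulrAC.
by rewrite (fr_tau fr) (eqP lj) -(fr_tau fr).
Qed.

(** If the restriction [G] to the fibre is nonzero, its part [Gt] of top [kap]-weight dominates
    along curves with [y_j] of order [z^(- kap j)]. The leading coefficients [y1] are free, because
    the torus parameter absorbs the relations for [k] outside [tau]; so [G] would be nonzero at a
    point covered by [fibpt_vanish]. *)
Lemma hard_frame P : HA A beta P -> meval p (inL Lx Ld P) = 0.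
Proof.
move=> PH; have [G GE] := fibpt_poly (inL Lx Ld P).
rewrite -(meval_eq _ fibpt_p) -GE; apply/eqP; apply: contraT => Gp.
pose wt (m : 'X_{1..n}) := (\sum_j kap j * m j)%N.
have [mt [mtG mtmax]] : exists mt, mt \in msupp G /\ forall m, m \in msupp G -> (wt m <= wt mt)%N.
  have [|mt [mtG H]] := @max_seq _ (fun m => (wt m)%:R) (msupp G).
    by apply: contraNneq Gp => s0; rewrite mevalE s0 big_nil.
  by exists mt; split=> // m /H; rewrite ler_nat.
pose Gt := \sum_(m <- msupp G | wt m == wt mt) G@_m *: 'X_[m].
have Gt0 : Gt != 0.
  apply/eqP => /(congr1 (mcoeff mt)) /eqP; rewrite mcoeff0 /Gt raddf_sum big_mkcond /=.
  rewrite (bigD1_seq mt) ?msupp_uniq //= eqxx mcoeffZ mcoeffX eqxx mulr1 big1 ?addr0; last first.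
    by move=> m mmt; case: ifP => // _; rewrite mcoeffZ mcoeffX (negPf mmt) mulr0.
  by rewrite mcoeff_eq0 mtG.
have [y1 [y10 y1G]] := mpoly_nonroot Gt0.
(* With this ratio the relation at [k], reduced to its dominant term [o k], returns the chosen value
   [y1 k]. *)
pose th k := - y1 k / (BB k (o k) * y1 (o k)).
have Bok k : k \in rho :\: tau -> BB k (o k) != 0.
  by move=> /(fr_o fr)[_ _ _ + _]; rewrite /BB fmorph_eq0.
have [|t [t0 ttau tth]] := @frame_torus eta (fun k => if k \in rho :\: tau then th k else 1) eta0.
  move=> k; case: ifP => kr; last exact: oner_neq0.
  by rewrite /th mulf_neq0 // ?oppr_eq0 // invr_neq0 // mulf_neq0 // Bok.
(* For z != 0 the point y_j = z^(- kap j) * (yh j).[z] satisfies the relations of the frame, so h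
   vanishes at z, while h.[0] is the value at y1 of the top weight part Gt of G. *)
pose yh k : {poly CC} := if k \in rho :\: tau then
   - \sum_(j | [&& V j, j \notin rho & lam j == lam k])
      (BB k j * (tmon A t j / tmon A t k) * y1 j) *: 'X^(kap k - kap j) else (y1 k)%:P.
pose h := \sum_(m <- msupp G) G@_m *: ('X^(wt mt - wt m) * \prod_j yh j ^+ m j).
have Xn0 (N : nat) : ('X^N : {poly CC}).[0] = (N == 0%N)%:R.
  by rewrite hornerXn; case: N => [|N]; rewrite ?expr0 // expr0n.
have yh0 k : (yh k).[0] = y1 k.
  rewrite /yh; case: ifP => kr; last by rewrite hornerC.
  have [o1 o2 o3 o4 o5] := fr_o fr kr.
  rewrite hornerN horner_sum (bigD1 (o k)) /=; last by rewrite o1 o2 o3 eqxx.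
  rewrite big1 ?addr0 => [|j /andP[/and3P[jV jr /eqP lj] jo]].
    rewrite hornerZ Xn0 o5 subnn eqxx mulr1 tth // kr mulfK ?tmon_neq0 // /th.
    by field; rewrite y10 Bok.
  rewrite hornerZ Xn0; have [B0|B0] := eqVneq (BB k j) 0; first by rewrite B0 !mul0r.
  have B0' : dotp (acol A j) (l k) != 0 by move: B0; rewrite /BB fmorph_eq0.
  by rewrite subn_eq0 leqNgt (fr_kap fr kr jr jo jV B0' lj) mulr0.
have h0 : h != 0.
  apply: contraNneq y1G => h0; have := congr1 (fun q : {poly CC} => q.[0]) h0.
  rewrite horner0 => e; apply/eqP; rewrite -[RHS]e /h horner_sum /Gt raddf_sum big_mkcond /=.
  rewrite !big_seq; apply: eq_bigr => m mG.
  rewrite hornerZ hornerM Xn0 subn_eq0 eqn_leq mtmax //=.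
  case: ifP => _; last by rewrite mul0r mulr0.
  rewrite mul1r mevalZ mevalX horner_prod; congr (_ * _); apply: eq_bigr => j _.
  by rewrite horner_exp yh0.
have [z [z0 /eqP hz]] := poly_nonroot h0; case: hz.
pose y j := z ^- kap j * (yh j).[z].
have yG : meval y G = z ^- wt mt * h.[z].
  rewrite mevalE /h horner_sum mulr_sumr !big_seq; apply: eq_bigr => m mG.
  rewrite hornerZ hornerM hornerXn horner_prod mulrCA; congr (_ * _); rewrite mulrA.
  rewrite [LHS](_ : _ = \prod_j (z ^- (kap j * m j) * (yh j).[z] ^+ m j)); last first.
    by apply: eq_bigr => j _; rewrite exprMn exprVn -exprM.
  rewrite big_split /=; congr (_ * _); last by apply: eq_bigr => j _; rewrite horner_exp.
  rewrite -[RHS](mulfK (expf_neq0 (wt m) z0)) -(mulrA (z ^- wt mt)) -exprD subnK ?mtmax //.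
  rewrite mulVf ?expf_neq0 // mul1r /wt.
  by rewrite -prodrXr prodfV.
apply: (mulfI (invr_neq0 (expf_neq0 (wt mt) z0))); rewrite -yG mulr0 GE.
have yr j : j \notin rho -> y j = z ^- kap j * y1 j.
  by move=> jr; rewrite /y /yh in_setD (negPf jr) andbF hornerC.
apply: (fibpt_vanish PH t0 ttau) => [j jr|k kr].
  by rewrite yr // mulf_neq0 // invr_neq0 // expf_neq0.
rewrite /y {1}/yh kr hornerN horner_sum mulrN mulNr addrC; apply/eqP; rewrite subr_eq0; apply/eqP.
rewrite mulr_sumr mulr_suml; apply: eq_bigr => j /and3P[jV jr /eqP lj].
rewrite -/(y j) yr // hornerZ hornerXn; have [->|B0] := eqVneq (BB k j) 0; first by rewrite !(mul0r, mulr0).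
have B0' : dotp (acol A j) (l k) != 0 by move: B0; rewrite /BB fmorph_eq0.
have le : (kap j <= kap k)%N.
  have [->|jo] := eqVneq j (o k); first by have [_ _ _ _ ->] := fr_o fr kr.
  exact: ltnW (fr_kap fr kr jr jo jV B0' lj).
have e : z ^- kap j = z ^- kap k * z ^+ (kap k - kap j).
  apply: (mulIf (expf_neq0 (kap j) z0)); rewrite -mulrA -exprD subnK //.
  by rewrite !mulVf ?expf_neq0.
rewrite e; field.
by rewrite tmon_neq0 // expf_neq0.
Qed.

End Degeneration.

End HardInclusion.

Lemma hard_incl (d n : nat) (A : 'M[int]_(d, n)) (beta : 'I_d -> CC) (Lx Ld : 'I_n -> rat) (c : rat)
    (tau : {set 'I_n}) (v : 'I_d -> rat) (p : 'I_(n + n) -> CC) (P : Dpoly n) :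
  full_mat A -> 0 < c -> (forall j, Lx j + Ld j = c) ->
  (forall j, dotp (acol A j) v <= Ld j) -> (forall j, (j \in tau) = (dotp (acol A j) v == Ld j)) ->
  Upsilon A tau p -> HA A beta P -> meval p (inL Lx Ld P) = 0.
Proof.
move=> Afull c0 hL vle vtau [[eta [eta0 pxi]] ptan].
have full x : inspan (acol A) setT x.
  have [K KE] := choice (fun i : 'I_d => Afull (fun i' => (i == i')%:R)).
  exists (fun j => \sum_i x i * (K i j)%:~R); split=> [j|i]; first by rewrite in_setT.
  rewrite /comb; under eq_bigr do rewrite mulr_suml.
  rewrite exchange_big (eq_bigr (fun i' => x i' * (i' == i)%:R)) => [|i' _]; last first.
    under eq_bigr do rewrite -mulrA.
    rewrite -mulr_sumr; congr (_ * _).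
    rewrite -[RHS](_ : ((i' == i)%:R : int)%:~R = _); last by case: (i' == i).
    rewrite KE raddf_sum; apply: eq_bigr => j _.
    by rewrite /= intrM mulrC.
  by rewrite (bigD1 i) //= eqxx mulr1 big1 ?addr0 // => i' /negPf->; rewrite mulr0.
have [||rho [s2 [v' [l [o [kap fr]]]]]] := @frame_exists n d (acol A) Lx c tau c0 full v.
- by move=> j; rewrite /lam -(hL j) lerD2l.
- by move=> j; rewrite vtau /lam -(hL j) (inj_eq (addrI _)).
apply: (hard_frame c0 hL fr eta0) => [j|i]; first by rewrite [LHS]pxi mulrC.
rewrite -[RHS](ptan (fun j => (A i j)%:~R * xicoord p j)); last first.
  exists (fun i' => (i' == i)%:R) => j; rewrite (bigD1 i) //= eqxx mul1r big1 ?addr0 //.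
  by move=> i' /negPf->; rewrite !mul0r.
by apply: eq_bigr => j _; rewrite mulrA.
Qed.

(** * Points of the characteristic variety *)

Lemma HA_mem (d n : nat) (A : 'M[int]_(d, n)) beta g : HA_gen A beta g -> HA A beta g.
Proof.
move=> gA; exists [:: (1, g)]; split=> [q|f]; first by rewrite inE => /eqP->.
have Dact1 h : Dact (1 : Dpoly n) h = h.
  rewrite /Dact msupp1 big_seq1 mcoeff1 eqxx scale1r.
  have -> : xpart (0 : 'X_{1..n + n})%MM = 0%MM by apply/mnmP => j; rewrite !mnmE.
  have -> : dpart (0 : 'X_{1..n + n})%MM = 0%MM by apply/mnmP => j; rewrite !mnmE.
  by rewrite mderivm0m mpolyX0 mul1r.
by rewrite big_seq1 Dact1.
Qed.

Section InitialForms.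
Variables (n : nat) (Lx Ld : 'I_n -> rat).
Notation Lw := (Lweight Lx Ld).

Lemma inL_split (H R : Dpoly n) (w : rat) : H != 0 -> (forall m, m \in msupp H -> Lw m = w) ->
  (forall m, m \in msupp R -> Lw m < w) -> inL Lx Ld (H + R) = H.
Proof.
move=> H0 Hw Rw.
have HR m : m \in msupp H -> R@_m = 0.
  by move=> mH; apply: memN_msupp_eq0; apply: contraL (lexx w) => /Rw; rewrite (Hw _ mH) ltNge.
have le_w m : m \in msupp (H + R) -> Lw m <= w.
  by move=> /msuppD_le; rewrite mem_cat => /orP[/Hw->|/Rw/ltW].
have m0H : mlead H \in msupp H by exact: mlead_supp.
have m0P : mlead H \in msupp (H + R) by rewrite mcoeff_msupp mcoeffD HR // addr0 -mcoeff_msupp.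
apply/mpolyP => m; rewrite /inL raddf_sum big_mkcond /=.
have [mP|mP] := boolP (m \in msupp (H + R)); last first.
  rewrite big1_seq => [|m' /andP[_ m'P]].
    apply/esym/memN_msupp_eq0; apply: contra mP => mH.
    by rewrite mcoeff_msupp mcoeffD HR // addr0 -mcoeff_msupp.
  case: ifP => // _; rewrite mcoeffZ mcoeffX; case: eqP => [e|_]; last by rewrite mulr0.
  by rewrite -e m'P in mP.
rewrite (bigD1_seq m) ?msupp_uniq //= big1 ?addr0 => [|m' m'm]; last first.
  by case: ifP => // _; rewrite mcoeffZ mcoeffX (negPf m'm) mulr0.
case: ifP => [/allP max|nmax].
  rewrite mcoeffZ mcoeffX eqxx mulr1 mcoeffD.
  have [mH|mH] := boolP (m \in msupp H); first by rewrite HR // addr0.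
  move: mP => /msuppD_le; rewrite mem_cat (negPf mH) /= => /Rw.
  by rewrite ltNge -(Hw _ m0H) max.
apply/esym/memN_msupp_eq0; apply: contraFN nmax => /Hw e; apply/allP => m' m'P.
by rewrite e le_w.
Qed.

Lemma Lweight_xdmon a b : Lw (xdmon a b) = \sum_j (Lx j * (a j)%:R + Ld j * (b j)%:R).
Proof.
by apply: eq_bigr => j _; rewrite !mnmE (unsplitK (inl _ j)) (unsplitK (inr _ j)).
Qed.

Lemma meval_xdmon (p : 'I_(n + n) -> CC) a b :
  meval p 'X_[xdmon a b] = \prod_j (xcoord p j ^+ a j * xicoord p j ^+ b j).
Proof.
rewrite mevalX big_split_ord big_split; congr (_ * _); apply: eq_bigr => j _.
  by rewrite mnmE (unsplitK (inl _ j)).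
by rewrite mnmE (unsplitK (inr _ j)).
Qed.

Lemma xdmon_inj a b a' b' : xdmon a b = xdmon a' b' :> 'X_{1..n + n} -> a = a' /\ b = b'.
Proof.
by move=> e; have := congr1 (@xpart n) e; have := congr1 (@dpart n) e; rewrite !xpart_xdmon !dpart_xdmon.
Qed.

End InitialForms.

Section EasyInclusion.
Variables (d n : nat) (A : 'M[int]_(d, n)) (beta : 'I_d -> CC) (Lx Ld : 'I_n -> rat) (c : rat).
Variable p : 'I_(n + n) -> CC.
Hypotheses (Afull : full_mat A) (c0 : 0 < c) (hL : forall j, Lx j + Ld j = c).
Hypothesis pch : chL A beta Lx Ld p.
Let xi := xicoord p.
Let tau := [set j | xi j != 0].
Let xpow (b : 'X_{1..n}) := \prod_j xi j ^+ b j.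

Lemma xpowE b : meval p 'X_[xdmon 0%MM b] = xpow b.
Proof. by rewrite meval_xdmon; apply: eq_bigr => j _; rewrite mnmE expr0 mul1r. Qed.

(** The weights of the two monomials differ by the sum of [Ld j * u j]: if it is 0 the binomial is
    its own initial form, if it is negative only [xi^(u_-)] survives. *)
Lemma ch_toric (u : 'I_n -> int) : (forall i, \sum_j A i j * u j = 0) ->
  (\sum_j Ld j * (u j)%:~R = 0 -> xpow (upos u) = xpow (uneg u)) /\
  (\sum_j Ld j * (u j)%:~R < 0 -> xpow (uneg u) = 0).
Proof.
move=> uA; have gA : HA A beta (toric_gen u) by apply: HA_mem; left; exists u.
have := pch gA; rewrite /toric_gen; set mp := xdmon _ _; set mn := xdmon _ _ => ev.
have wE : Lweight Lx Ld mp - Lweight Lx Ld mn = \sum_j Ld j * (u j)%:~R.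
  rewrite !Lweight_xdmon -sumrB; apply: eq_bigr => j _; rewrite mnmE mulr0 !add0r -mulrBr.
  by rewrite -[u j in RHS]upos_uneg intrB.
split=> [w0|w0].
  apply/eqP; rewrite -!xpowE -/mp -/mn; have [<-//|mpn] := eqVneq mp mn.
  rewrite -subr_eq0 -mevalB; apply/eqP.
  rewrite -[RHS]ev; congr meval; rewrite -[X in inL _ _ X]addr0; symmetry.
  apply: (@inL_split _ _ _ _ _ (Lweight Lx Ld mn)) => [|m|m]; last by rewrite msupp0.
    apply/eqP => /(congr1 (mcoeff mp))/eqP; rewrite mcoeff0 mcoeffB !mcoeffX eqxx [mn == mp]eq_sym (negPf mpn).
    by rewrite subr0 oner_eq0.
  move=> /msuppB_le; rewrite mem_cat !msuppX !inE => /orP[]/eqP-> //.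
  by apply/eqP; rewrite -subr_eq0 wE w0.
apply/eqP; rewrite -xpowE -/mn -oppr_eq0 -mevalN -[X in _ == X]ev; apply/eqP; congr meval; symmetry.
rewrite addrC; apply: (@inL_split _ _ _ _ _ (Lweight Lx Ld mn)) => [|m|m].
- by rewrite oppr_eq0 -msupp_eq0 msuppX.
- by rewrite (perm_mem (msuppN _)) msuppX inE => /eqP->.
- by rewrite msuppX inE => /eqP->; rewrite -subr_lt0 wE.
Qed.

Lemma ch_euler i : \sum_j (A i j)%:~R * (xcoord p j * xi j) = 0.
Proof.
have gA : HA A beta (euler_gen A beta i) by apply: HA_mem; right; exists i.
have := pch gA; rewrite /euler_gen; set S := \sum_j _ => ev.
have -> : \sum_j (A i j)%:~R * (xcoord p j * xi j) = meval p S.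
  rewrite /S raddf_sum; apply: eq_bigr => j _; rewrite /= mevalZ meval_xdmon; congr (_ * _).
  rewrite (bigD1 j) //= !mnmE eqxx !expr1 big1 ?mulr1 // => k /negPf kj.
  by rewrite !mnmE kj !expr0 mulr1.
rewrite -[RHS]ev; congr meval; symmetry; apply: (@inL_split _ _ _ _ _ c) => [|m|m].
(* A zero row would leave only the constant; fullness excludes it. *)
- have [j Aij] : exists j, A i j != 0.
    apply: contrapT => H; have [k kE] := Afull (fun=> 1); have := kE i.
    rewrite big1 // => j _; have [->|Aij] := eqVneq (A i j) 0; first by rewrite mul0r.
    by case: H; exists j.
  apply/eqP => /(congr1 (mcoeff (xdmon (unitm j) (unitm j))))/eqP; rewrite mcoeff0 /S raddf_sum.
  rewrite (bigD1 j) //= mcoeffZ mcoeffX eqxx mulr1 big1 ?addr0; first by rewrite intr_eq0 (negPf Aij).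
  move=> k kj; rewrite mcoeffZ mcoeffX; case: eqP => [/xdmon_inj[/mnmP/(_ k) + _]|_]; last by rewrite mulr0.
  by rewrite !mnmE eqxx (negPf kj).
- rewrite /S => /msupp_sum_le /flatten_mapP[j _ /msuppZ_le]; rewrite msuppX inE => /eqP->.
  rewrite Lweight_xdmon (bigD1 j) //= !mnmE eqxx !mulr1 hL big1 ?addr0 // => k /negPf kj.
  by rewrite !mnmE kj !mulr0 addr0.
- rewrite (perm_mem (msuppN _)) msuppC; case: ifP => // _; rewrite inE => /eqP->.
  by rewrite /Lweight big1 // => j _; rewrite !mnmE !mulr0 addr0.
Qed.

Lemma xpow_eq0 (b : 'X_{1..n}) : (forall j, j \notin tau -> b j = 0%N) -> xpow b != 0.
Proof.
move=> btau; apply/prodf_neq0 => j _; have [jt|/btau->] := boolP (j \in tau); last by rewrite expr0 oner_neq0.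
by rewrite expf_neq0 //; move: jt; rewrite in_set.
Qed.

(** Otherwise Motzkin's certificate, cleared of denominators, is an integer relation [u] with [u_-]
    supported on [tau], so [xi^(u_-)] is nonzero. Negative weight contradicts this at once; for
    weight 0, [u] is positive somewhere outside [tau], so [xi^(u_+) = 0]. *)
Lemma ch_height : exists v, (forall j, dotp (acol A j) v <= Ld j) /\
  forall j, (j \in tau) = (dotp (acol A j) v == Ld j).
Proof.
have [||] := @motzkin _ _ (acol A) Ld tau set0 (~: tau).
  by move=> j; rewrite in_setC.
  move=> [v [vE _ vT]]; exists v; split=> j.
    have [jt|jt] := boolP (j \in tau); first by rewrite vE.
    by apply: ltW; apply: vT; rewrite in_setC.
  have [jt|jt] := boolP (j \in tau); first by rewrite vE ?eqxx.
  by rewrite lt_eqF // vT // in_setC.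
move=> [m [_ m0 mA mh]].
have [N [N0 [u uE]]] := common_denom m.
have N0' : 0 < N%:R :> rat by rewrite ltr0n.
have uA i : \sum_j A i j * u j = 0.
  apply/eqP; rewrite -(intr_eq0 rat) raddf_sum /=.
  rewrite (eq_bigr (fun j => N%:R * (m j * acol A j i))) => [|j _].
    by rewrite -mulr_sumr mA mulr0.
  by rewrite /= intrM -uE /acol; ring.
have u0 j : j \notin tau -> 0 <= u j.
  by move=> /m0 mj; rewrite -(ler0z rat) -uE mulr_ge0 // ltW.
have uneg0 : xpow (uneg u) != 0.
  by apply: xpow_eq0 => j /u0 uj; rewrite mnmE ltNge uj.
have SE : \sum_j Ld j * (u j)%:~R = (\sum_j m j * Ld j) * N%:R.
  by rewrite mulr_suml; apply: eq_bigr => j _; rewrite -uE mulrCA mulrA.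
have [T0 Tneg] := ch_toric uA; exfalso.
have Sge : 0 <= \sum_j m j * Ld j.
  rewrite leNgt; apply/negP => lt; case/eqP: uneg0; apply: Tneg.
  by rewrite SE pmulr_llt0.
case: mh => [|[le [j jt mj]]]; first by rewrite ltNge Sge.
have S0 : \sum_j m j * Ld j = 0 by apply/eqP; rewrite eq_le le.
case/eqP: uneg0; rewrite -T0; last by rewrite SE S0 mul0r.
have jt' : j \notin tau by rewrite -in_setC.
have uj : u j != 0 by rewrite -(intr_eq0 rat) -uE mulf_neq0 // gt_eqF.
rewrite /xpow (bigD1 j) //= mnmE u0 // [xi j](_ : _ = 0); last first.
  by apply/eqP; move: jt'; rewrite in_set negbK.
by rewrite expr0n absz_eq0 (negPf uj) mul0r.
Qed.

Lemma ch_upsilon : Upsilon A tau p.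
Proof.
split; last first.
  move=> v [k vE].
  transitivity (\sum_i k i * \sum_j (A i j)%:~R * (xcoord p j * xi j)); last first.
    by rewrite big1 // => i _; rewrite ch_euler mulr0.
  under [RHS]eq_bigr do rewrite mulr_sumr.
  rewrite exchange_big; apply: eq_bigr => j _; rewrite vE mulr_sumr; apply: eq_bigr => i _.
  by rewrite /xi /=; ring.
have [v [_ vtau]] := ch_height.
pose M : 'M[int]_(d, n) := \matrix_(i, j) (A i j *+ (j \in tau)).
pose z j := if j \in tau then xi j else 1.
have z0 j : z j != 0 by rewrite /z in_set; case: ifP => // _; exact: oner_neq0.
(* On [tau] the weights [Ld] are the values of [v], so relations among these columns have weight 0,
   and the toric equations say that [xi] respects them. *)
have [|eta [eta0 etaE]] := char_extend (M := M) z0.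
  move=> u uM; pose u1 j := u j *+ (j \in tau).
  have uA i : \sum_j A i j * u1 j = 0.
    by rewrite -[RHS](uM i); apply: eq_bigr => j _; rewrite mxE mulrnAr mulrnAl.
  have u1t j : j \notin tau -> u1 j = 0 by rewrite /u1 => /negPf->.
  have [T0 _] := ch_toric uA.
  have {}T0 : xpow (upos u1) = xpow (uneg u1).
    apply: T0; transitivity (\sum_i v i * (\sum_j A i j * u1 j)%:~R); last first.
      by rewrite big1 // => i _; rewrite uA mulr0.
    under [RHS]eq_bigr do rewrite raddf_sum mulr_sumr.
    rewrite exchange_big; apply: eq_bigr => j _ /=.
    have [jt|/u1t->] := boolP (j \in tau); last by rewrite mulr0 big1 // => i _; rewrite mulr0 mulr0.
    move: (jt); rewrite vtau => /eqP <-; rewrite /dotp mulr_suml; apply: eq_bigr => i _.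
    by rewrite /acol intrM mulrA [v i * _]mulrC.
  have n0 : xpow (uneg u1) != 0 by apply: xpow_eq0 => j /u1t uj; rewrite mnmE uj ltxx.
  apply: (mulIf n0); rewrite mul1r -{2}T0 /xpow -big_split; apply: eq_bigr => j _ /=.
  have [jt|jt] := boolP (j \in tau); last by rewrite /z !mnmE (negPf jt) u1t // lexx ltxx exp1rz mulr1.
  rewrite /z jt !exprnP -expfzDr; last by move: jt; rewrite in_set.
  by congr (_ ^ _); rewrite -[RHS](subrK (uneg u1 j)%:Z) upos_uneg /u1 jt.
exists eta; split=> // j; have [jt|jt] := boolP (j \in tau); last first.
  by rewrite mulr0; apply/eqP; move: jt; rewrite in_set negbK.
rewrite mulr1; rewrite -/(xi j); have := etaE j; rewrite /z jt => <-; apply: eq_bigr => i _.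
by rewrite mxE jt.
Qed.

End EasyInclusion.

(** * Faces of the umbrella and conclusion *)

(** Multiplying [ell <= M] by the positive denominator of the chart gives
    [(l - M f).a_j <= (M eps - l0) L'_j]. The face misses [0] exactly when [M eps - l0 > 0], and
    then one can divide; conversely [(-1, v)] with [M = 0] defines the face. *)
Lemma umbrellaP (d n : nat) (A : 'M[int]_(d, n)) (L' : 'I_n -> rat) f eps tau :
  umbrella_data A L' f eps -> umbrella A L' f eps tau <->
  exists v, (forall j, dotp (acol A j) v <= L' j) /\ forall j, (j \in tau) = (dotp (acol A j) v == L' j).
Proof.
move=> [e0 fe].
have den j : 0 < dotp (acol A j) f + eps * L' j.
  have [_] := fe j; rewrite (eq_bigr (fun i => acol A j i * f i)) => [|i _]; last by rewrite mulrC.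
  rewrite -/(dotp _ _) => lt; rewrite -[_ * L' j]opprK subr_gt0; apply: le_lt_trans lt.
  by rewrite -mulrN ler_pM2l // -normrN ler_norm.
have denE l0 l j : lval_col A L' f eps l0 l j = (l0 * L' j + dotp (acol A j) l) / (dotp (acol A j) f + eps * L' j).
  by rewrite /lval_col /dotp; congr ((_ + _) / (_ + _)); apply: eq_bigr => i _; rewrite mulrC.
split=> [[l0 [l [M [lt [le tauE]]]]]|[v [le tauE]]].
  pose K := M * eps - l0.
  have K0 : 0 < K by rewrite subr_gt0; move: lt; rewrite /lval_zero ltr_pdivrMr.
  pose v i := K^-1 * (l i + - M * f i).
  have vE j : dotp (acol A j) v = K^-1 * (dotp (acol A j) l - M * dotp (acol A j) f).
    by rewrite dotpZr dotpDr dotpZr mulNr.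
  exists v; split=> j; [move: (le j)|rewrite tauE]; rewrite denE vE.
    rewrite ler_pdivrMr // ler_pdivrMl // /K; clear; lra.
  rewrite -(inj_eq (mulIf (lt0r_neq0 (den j)))) divfK ?lt0r_neq0 //.
  rewrite -[RHS](inj_eq (mulfI (lt0r_neq0 K0))) mulVKf ?lt0r_neq0 // /K.
  by apply/eqP/eqP; clear; lra.
exists (-1), v, 0; split; first by rewrite /lval_zero mulN1r oppr_lt0 invr_gt0.
split=> j; rewrite denE mulN1r addrC.
  by rewrite ler_pdivrMr // mul0r subr_le0.
by rewrite tauE mulf_eq0 invr_eq0 (gt_eqF (den j)) orbF subr_eq0.
Qed.

Theorem theorem3p2 (d n : nat) (A : 'M[int]_(d, n))
    (hfull : full_mat A) (hpointed : pointed_mat A)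
    (Lx Ld : 'I_n -> rat) (c : rat) (hc : 0 < c)
    (hL : forall j, Lx j + Ld j = c)
    (f : 'I_d -> rat) (eps : rat) (hfe : umbrella_data A Ld f eps)
    (beta : 'I_d -> CC) :
  (forall p : 'I_(n + n) -> CC,
      chL A beta Lx Ld p <->
      exists tau, umbrella A Ld f eps tau /\ zclosure (Upsilon A tau) p) /\
  (forall p : 'I_(n + n) -> CC,
      (exists tau, umbrella A Ld f eps tau /\ zclosure (Upsilon A tau) p) <->
      (exists tau, umbrella A Ld f eps tau /\ Upsilon A tau p)) /\
  (forall (tau sigma : {set 'I_n}) (p : 'I_(n + n) -> CC),
      umbrella A Ld f eps tau -> umbrella A Ld f eps sigma ->
      Upsilon A tau p -> Upsilon A sigma p -> tau = sigma).
Proof.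
have easy p : chL A beta Lx Ld p -> exists tau, umbrella A Ld f eps tau /\ Upsilon A tau p.
  move=> pch; exists [set j | xicoord p j != 0]; split; last exact: ch_upsilon hfull hc hL pch.
  by apply/(umbrellaP _ hfe); exact: ch_height pch.
have hard p : (exists tau, umbrella A Ld f eps tau /\ zclosure (Upsilon A tau) p) -> chL A beta Lx Ld p.
  move=> [tau [/(umbrellaP _ hfe)[v [vle vtau]] pcl]] P PH; apply: pcl => q qtau.
  exact: hard_incl hfull hc hL vle vtau qtau PH.
have cl p : (exists tau, umbrella A Ld f eps tau /\ Upsilon A tau p) ->
    exists tau, umbrella A Ld f eps tau /\ zclosure (Upsilon A tau) p.
  by move=> [tau [utau ptau]]; exists tau; split=> // g; apply.
(* [tau] is recovered from [p], which gives disjointness. *)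
have supp tau p : Upsilon A tau p -> tau = [set j | xicoord p j != 0].
  move=> [[eta [eta0 xiE]] _]; apply/setP => j; rewrite in_set xiE mulf_eq0 negb_or.
  by rewrite (tmon_neq0 A j eta0) pnatr_eq0 eqb0 negbK.
split=> [p|]; first by split=> [/easy/cl|/hard].
split=> [p|tau sigma p _ _ /supp -> /supp ->//].
by split=> [/hard/easy|/cl].
Qed.
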